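(* Let $F$ be a coefficient-multiplicative normalized Lubin--Tate formal group over $\mathfrak o_k$ associated with $\pi$ (with $\sigma=\operatorname{id}$ and data as in the context). For every $m,n\in\mathbb N_{>0}$ the following hold. (i) $$v_k\bigl(\mathfrak F_{1,n}^F(T^m)\bigr)\ge v_q(m)-v_q(n)-1.$$ (ii) $$v_k\left(\sum_{d\mid(m,n)}\eta^F(d)\frac{\mathfrak F_{1,m/d}^F(T^{n/d})}{c_{\overline{n/d}}}\right)\ge-1.$$ (iii) $$v_k\left(\sum_{d\mid(m,n)}\eta^F(d)\frac{\mathfrak F_{1,m/d}^F(T^{n/d})}{c_{\overline{n/d}}}\right)\ge\min_{d\mid(m,n)}\left\{\left\lfloor\frac1{q-1}\left(\frac nd-1-\frac{mq}d\right)\right\rfloor_+-v_q\left(\frac nd\right)\right\}-1.$$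
   Context: $\mathbb N=\{0,1,2,\dots\}$; $(m,n)$ is the gcd; $\lfloor x\rfloor_+=\max\{0,\lfloor x\rfloor\}$. Let $p$ be an odd prime, $k/\mathbb Q_p$ a finite Galois extension with valuation ring $\mathfrak o_k$, uniformizer $\pi$, residue field $\kappa_k$ with $q=\#\kappa_k=p^{f_k}$, and valuation $v_k$ with $v_k(\pi)=1$. Let $v_q(n)=\lfloor v_p(n)/f_k\rfloor$. Data defining $F$: a submonoid $N_{(p)}$ of the multiplicative monoid $\mathbb N_{(p)}$ of positive integers prime to $p$ which is monus-closed ($m,n\in N_{(p)}$ implies $m/(m,n)\in N_{(p)}$); a multiplicative map $\rho:N_{(p)}\to\mathfrak o_k^\ast$ ($\rho(mm')=\rho(m)\rho(m')$); $f_F,f_{k/F}\in\mathbb N_{>0}$ with $f_Ff_{k/F}=f_k$; and $1=\nu_0,\nu_1,\dots,\nu_{f_{k/F}-1}\in\mathfrak o_k^\ast$. Put $N=\langle p^{f_F}\rangle\times N_{(p)}=\{p^{f_Fa}m\mid a\in\mathbb N,m\in N_{(p)}\}$ and $c_{p^{f_Fj}q^im}=\pi^i\nu_j\rho(m)$ for $0\le j<f_{k/F}$, $i\in\mathbb N$, $m\in N_{(p)}$. Then $\log_F(T)=\sum_{n\in N}\frac{(-1)^{n-1}}{c_n}T^n$ and $F(X,Y)=\log_F^{-1}(\log_F(X)+\log_F(Y))$, which is a Lubin--Tate formal $\mathfrak o_k$-module over $\mathfrak o_k$ for $\pi$, with $[\alpha]_F(T)=\log_F^{-1}(\alpha\log_F(T))$.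 For $n\in\mathbb N_{>0}$, $\overline n$ is the largest (for divisibility) element of $N$ dividing $n$. The function $\eta^F:\mathbb N_{>0}\to k$ is the Dirichlet inverse of $n\mapsto1/c_{\overline n}$: $\sum_{d\mid n}\eta^F(d)/c_{\overline{n/d}}=\delta_{n,1}$ for all $n\in\mathbb N_{>0}$. Coleman trace: for $g\in\mathfrak o_k[[T]]$, $\operatorname{Tr}_{Co}(g)=h$ is characterized by $h([\pi]_F(T))=\frac1\pi\sum_{a\in F[\pi]}g(a+_FT)$, with $F[\pi]$ the set of roots of $[\pi]_F$ in the maximal ideal of $\overline k$. $\mathfrak F_{1,m}^F(g)$ is the coefficient of $T^m$ in $\operatorname{Tr}_{Co}(g)$. *)

(* Defs.v *)
From HB Require Import structures.
From mathcomp Require Import all_boot all_order all_algebra all_field.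
From mathcomp Require Import boolp classical_sets functions cardinality fsbigop.
From mathcomp Require Import constructive_ereal.

Set Implicit Arguments.
Unset Strict Implicit.
Unset Printing Implicit Defensive.

Import Order.TTheory GRing.Theory Num.Theory.

Local Open Scope classical_set_scope.
Local Open Scope ring_scope.

(** * Valuations

  Valuations are additive, with values in [\bar R] and [v 0 = +oo]. *)

Definition is_valuation (R : numDomainType) (K : fieldType) (v : K -> \bar R) :
    Prop :=
  [/\ forall x, v x = +oo%E <-> x = 0,
      forall x, v x <> -oo%E,
      forall x y, v (x * y) = (v x + v y)%E
    & forall x y, (Order.min (v x) (v y) <= v (x + y)%R)%E].

Definition vcvg (R : numDomainType) (K : fieldType) (v : K -> \bar R)
    (u : nat -> K) (l : K) : Prop :=
  forall M : R, exists n0 : nat,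
    forall n : nat, (n0 <= n)%N -> (M%:E <= v (u n - l)%R)%E.

Definition vcauchy (R : numDomainType) (K : fieldType) (v : K -> \bar R)
    (u : nat -> K) : Prop :=
  forall M : R, exists n0 : nat,
    forall i j : nat, (n0 <= i)%N -> (n0 <= j)%N -> (M%:E <= v (u i - u j)%R)%E.

(** [(K, v)] is the field of p-adic numbers with the p-adic valuation, i.e. the
  completion of the rationals: [K] is complete, [v] restricts to the p-adic
  valuation (the values on positive integers determine those on all rationals),
  and the rationals are dense.  This determines [(K, v)] up to a unique
  isomorphism. *)
Definition is_padic_field (p : nat) (K : fieldType) (v : K -> \bar int) : Prop :=
  [/\ is_valuation v,
      forall n : nat, (0 < n)%N -> v n%:R = (Posz (logn p n))%:E,
      forall (x : K) (M : int), exists r : rat, (M%:E <= v (x - ratr r)%R)%E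
    & forall u : nat -> K, vcauchy v u -> exists l : K, vcvg v u l].

(** [v] extends [v0] up to a positive factor (the ramification index). *)
Definition valuation_above (K0 : fieldType) (L : fieldExtType K0)
    (v0 : K0 -> \bar int) (v : L -> \bar int) : Prop :=
  is_valuation v /\
  exists2 e : int, 0 < e & forall x : K0, v x%:A = (e%:E * v0 x)%E.

(** The residue field as a set of cosets [x + {z | 0 < v z}], [x] integral. *)
Definition residue_field (K : fieldType) (v : K -> \bar int) : set (set K) :=
  [set [set y | (0 < v (y - x)%R)%E] | x in [set x | (0 <= v x)%E]].

(** [(kb, i, w)] is an algebraic closure of [(k, v)], with the (unique)
  extension of [v]; the latter takes rational values. *)
Definition is_valued_algebraic_closure (k : fieldType) (v : k -> \bar int)
    (kb : closedFieldType) (i : {rmorphism k -> kb}) (w : kb -> \bar rat) :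
    Prop :=
  [/\ forall x : kb, algebraicOver i x,
      is_valuation w
    & forall x : k, w (i x) = er_map intr (v x)].

(** * Formal power series

  [f : series K] stands for the series with [f n] the coefficient of [T^n], and
  [F : series2 K] for the one with [F i j] the coefficient of [X^i Y^j]. *)

Definition series (K : Type) := nat -> K.
Definition series2 (K : Type) := nat -> nat -> K.

Section Series.
Variable K : fieldType.
Implicit Types f g : series K.

Definition strunc (n : nat) f : {poly K} := \poly_(i < n.+1) f i.

Definition smonom (m : nat) : series K := fun n => (n == m)%:R.

(** [f(g(T))] for [g 0 = 0]: the coefficient of [T^n] only depends on [f] and
  [g] modulo [T^(n+1)]. *)
Definition scomp f g : series K :=
  fun n => (strunc n f \Po strunc n g)`_n.

(** The compositional inverse of [f], for [f 0 = 0] and [f 1 != 0], computed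
  coefficient by coefficient; see [scomp_sinv]. *)
Fixpoint sinv_trunc f (n : nat) : {poly K} :=
  if n is n'.+1 then
    let P := sinv_trunc f n' in
    P + (((n == 1)%:R - (strunc n f \Po P)`_n) / f 1%N) *: 'X^n
  else 0.

Definition sinv f : series K := fun n => (sinv_trunc f n)`_n.

(** [f^-1(f(X) + f(Y))].  In [{poly {poly K}}] the inner variable is [X] and the
  outer one is [Y]; the coefficient of [X^i Y^j] only depends on the series
  modulo total degree [i + j + 1]. *)
Definition group_law f : series2 K := fun i j =>
  let fX := (strunc (i + j) f)%:P in
  let fY := map_poly polyC (strunc (i + j) f) in
  (map_poly polyC (strunc (i + j) (sinv f)) \Po (fX + fY))`_j`_i.

(** [f^-1(a f(T))] *)
Definition group_mul f (a : K) : series K := scomp (sinv f) (fun n => a * f n).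

Lemma size_sinv_trunc f n : (size (sinv_trunc f n) <= n.+1)%N.
Proof.
elim: n => [|n IH] /=; first by rewrite size_poly0.
apply: (leq_trans (size_polyD _ _)); rewrite geq_max (leq_trans IH) //=.
by apply: (leq_trans (size_scale_leq _ _)); rewrite size_polyXn.
Qed.

Lemma coef_sinv_trunc f m n : (m <= n)%N -> (sinv_trunc f n)`_m = sinv f m.
Proof.
elim: n => [|n IH]; first by rewrite leqn0 => /eqP ->.
rewrite leq_eqVlt => /orP[/eqP -> //|le_mn] /=.
by rewrite coefD coefZ coefXn (ltn_eqF le_mn) mulr0 addr0 IH.
Qed.

Lemma strunc_sinv f n : strunc n (sinv f) = sinv_trunc f n.
Proof.
apply/polyP=> m; rewrite coef_poly ltnS; case: leqP => [le_mn|lt_nm].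
  by rewrite coef_sinv_trunc.
by rewrite nth_default // (leq_trans (size_sinv_trunc f n)).
Qed.

Lemma sinv0 f : sinv f 0%N = 0.
Proof. by rewrite /sinv /= coef0. Qed.

Lemma coef_strunc_comp f n (P : {poly K}) m :
  (strunc n f \Po P)`_m = \sum_(j < n.+1) f j * (P ^+ j)`_m.
Proof.
rewrite /strunc poly_def linear_sum coef_sum; apply: eq_bigr => j _ /=.
by rewrite comp_polyZ comp_Xn_poly coefZ.
Qed.

Lemma scomp_sinv f :
  f 0%N = 0 -> f 1%N != 0 -> scomp f (sinv f) =1 smonom 1.
Proof.
move=> f0 f1 [|n]; rewrite /scomp /smonom strunc_sinv.
  by rewrite coef_strunc_comp big_ord1 f0 mul0r.
rewrite [sinv_trunc _ _]/=; set P := sinv_trunc f n.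
set a := (_ - _) / _; set A := P + _.
have P0 : P.[0] = 0 by rewrite horner_coef0 coef_sinv_trunc // sinv0.
have A0 : A.[0] = 0 by rewrite hornerD hornerZ hornerXn expr0n P0 add0r mulr0.
have key j : (A ^+ j)`_n.+1 = (P ^+ j)`_n.+1 + (j == 1)%:R * a.
  apply/eqP; rewrite addrC -subr_eq -coefB subrXX addrAC subrr add0r.
  rewrite -scalerAl coefZ coefXnM ltnn subnn -horner_coef0 horner_sum.
  rewrite mulrC; apply/eqP; congr (_ * _).
  case: j => [|[|j]]; first by rewrite big_ord0.
    by rewrite big_ord1 !expr0 mulr1 hornerC.
  apply: big1 => -[l lt_l] _ /=; rewrite hornerM !horner_exp A0 P0 !expr0n.
  case: l lt_l => [|l] lt_l; last by rewrite mulr0.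
  by rewrite subn0 mul0r.
have -> : (strunc n.+1 f \Po A)`_n.+1 = (strunc n.+1 f \Po P)`_n.+1 + f 1%N * a.
  rewrite !coef_strunc_comp.
  under eq_bigr => j _ do rewrite key mulrDr.
  rewrite big_split /=; congr (_ + _).
  rewrite big_ord_recl mul0r mulr0 add0r big_ord_recl mul1r big1 ?addr0 // => j _.
  by rewrite mul0r mulr0.
by rewrite /a mulrCA divff // mulr1 addrC subrK.
Qed.

End Series.

(** * The formal group attached to the data *)

(** The monoid generated by [p^fF] and [Np]. *)
Definition gen_monoid (p fF : nat) (Np : set nat) : set nat :=
  [set (p ^ (fF * a) * m)%N | a in [set: nat] & m in Np].

Definition monus_closed_submonoid (p : nat) (Np : set nat) : Prop :=
  [/\ forall m : nat, Np m -> (0 < m)%N /\ coprime p m,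
      Np 1%N,
      forall m n : nat, Np m -> Np n -> Np (m * n)%N
    & forall m n : nat, Np m -> Np n -> Np (m %/ gcdn m n)%N].

Definition lt_log (K : fieldType) (N : set nat) (c : nat -> K) : series K :=
  fun n => if n \in N then (-1) ^+ n.-1 / c n else 0.

(** The largest, for divisibility, element of [N] dividing [n]. *)
Definition Nbar (N : set nat) (n : nat) : nat :=
  xget 1%N [set d | [/\ N d, (d %| n)%N
                      & forall e : nat, N e -> (e %| n)%N -> (e %| d)%N]].

Definition is_dirichlet_inverse (K : fieldType) (f g : nat -> K) : Prop :=
  forall n : nat, (0 < n)%N ->
    \sum_(d <- divisors n) g d * f (n %/ d)%N = (n == 1%N)%:R.

(** * The Coleman trace *)

Section Coleman.
Variables (k : fieldType) (v : k -> \bar int).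
Variables (kb : closedFieldType) (i : {rmorphism k -> kb}) (w : kb -> \bar rat).

Definition sintegral (g : series k) : Prop := forall n, (0 <= v (g n))%E.

(** The limit of [\sum_n u n] for the topology given by [w]. *)
Definition vsum (u : nat -> kb) : kb :=
  xget 0 [set l | vcvg w (fun n => \sum_(j < n) u j) l].

(** The roots of [f] in the maximal ideal of [kb]. *)
Definition torsion (f : series k) : set kb :=
  [set a | (0 < w a)%E /\ vcvg w (fun n => \sum_(j < n) i (f j) * a ^+ j) 0].

(** [F(a, T)].  It converges coefficientwise if [F] is integral and [0 < w a]. *)
Definition translate (F : series2 k) (a : kb) : series kb :=
  fun n => vsum (fun j => i (F j n) * a ^+ j).

(** [g(F(a, T))].  Here [F(a, T)] has constant term [a], so that every
  coefficient of [\sum_n g n * F(a, T) ^+ n] is a convergent infinite sum. *)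
Definition stranslate (F : series2 k) (g : series k) (a : kb) : series kb :=
  fun m => vsum (fun n => i (g n) * (strunc m (translate F a) ^+ n)`_m).

(** [Tr] is the Coleman trace of the formal group with logarithm [l]:
  [h = Tr g] is characterized by
  [h([pi](T)) = pi^-1 * \sum_(a in F[pi]) g(F(a, T))]. *)
Definition is_coleman_trace (l : series k) (pi : k)
    (Tr : series k -> series k) : Prop :=
  forall g : series k, sintegral g -> forall m : nat,
    i (scomp (Tr g) (group_mul l pi) m) =
    (i pi)^-1 * \sum_(a \in torsion (group_mul l pi))
                   stranslate (group_law l) g a m.

End Coleman.

(* Main.v *)
(** Let [mulpi] be the series of the multiplication by [pi].  By the functional
  equation lemma, the group law and [mulpi] are integral, and [mulpi] is
  congruent to [X^q] modulo [pi].  Weierstrass division by [mulpi] gives a monic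
  polynomial [X^q - \sum_(i < q) b_i(S) X^i], with [b_i] congruent to [0] for
  [i > 0] and to [S] for [i = 0], that vanishes at [X] for [S = mulpi(X)].  At
  [S = mulpi(T)] its roots are the [q] distinct series [F(a, T)], for [a] in the
  [pi]-torsion.  Hence [pi] times the trace of [T^m] is the power sum [L m] of its
  roots, as a series in [S]: this is the coefficient of [T^m] in
  [- T Q'(T) / Q(T)], with [Q] the reciprocal polynomial.

  Writing [Q] as a product of factors [1 - y_d T^d] shows that the [L m] are the
  ghost components of a Witt vector, so that [L m - phi(L (m / q))] is divisible
  by [pi^(v_q(m))], where [phi] substitutes [S^q] for [S].  This implies (i) by
  induction, and (ii) since [eta] is an integral function convolved with
  [1 - pi^-1 q^-s].  Giving [pi] the weight [q - 1] and [S] the weight [q], the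
  coefficient [b_(q-j)] has weight at least [j], so that [L m] has weight at least
  [m], which gives (iii). *)

Require Import Defs.
From HB Require Import structures.
From mathcomp Require Import all_boot all_order all_algebra all_field.
From mathcomp Require Import boolp classical_sets functions cardinality fsbigop.
From mathcomp Require Import constructive_ereal.
From mathcomp Require Import ring lra zify.

Set Implicit Arguments.
Unset Strict Implicit.
Unset Printing Implicit Defensive.

Import Order.TTheory GRing.Theory Num.Theory.

Local Open Scope classical_set_scope.
Local Open Scope card_scope.
Local Open Scope ring_scope.

(** * Formal power series *)

(** An algebraic closure of a p-adic field is not complete, so an integral series has no evident
    value at a point of the maximal ideal of [kb]. At a [pi]-torsion point a value exists for an
    algebraic reason: Weierstrass division writes the series as a polynomial plus a multiple of
    [[pi]], and only the polynomial survives. All other substitutions take place in power series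
    rings, where convergence is formal, and [pi]-adic size is recorded separately, as divisibility
    with an integral quotient. The trace is characterized only after composition with [[pi]]. As
    [pi] is invertible in [k], the series [[pi]] has a compositional inverse with coefficients in
    [k], so identities between series in [S] may be checked at [S = [pi](T)]. The weights come from
    giving [X] weight 1: then [pi X] and [X^q] both have weight [q], and so has [S = [pi](X)], all
    of whose monomials have weight at least [q]. This matches the valuation [1/(q-1)] of nonzero
    torsion points. *)

Definition fps (R : Type) : Type := nat -> R.

HB.instance Definition _ (R : choiceType) := Choice.copy (fps R) (nat -> R).
HB.instance Definition _ (R : zmodType) := GRing.Zmodule.copy (fps R) (nat -> R).

Section PowerSeriesRing.
Variable R : comNzRingType.
Implicit Types f g h : fps R.

Lemma fpsP f g : (forall n, f n = g n) -> f = g.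
Proof. by move=> fg; apply: funext. Qed.

Definition fps_mul f g : fps R := fun n => \sum_(j < n.+1) f j * g (n - j)%N.
Definition fps_const (a : R) : fps R := fun n => if n is 0%N then a else 0.

Definition ptrunc n f : {poly R} := \poly_(i < n.+1) f i.

Lemma coef_ptrunc n f i : (i <= n)%N -> (ptrunc n f)`_i = f i.
Proof. by move=> le_in; rewrite coef_poly ltnS le_in. Qed.

Lemma coefM_agree n (p p' r r' : {poly R}) :
  (forall i, (i <= n)%N -> p`_i = p'`_i) ->
  (forall i, (i <= n)%N -> r`_i = r'`_i) ->
  forall i, (i <= n)%N -> (p * r)`_i = (p' * r')`_i.
Proof.
move=> pp' rr' i le_in; rewrite !coefM; apply: eq_bigr => j _.
by rewrite pp' ?rr' //; have := ltn_ord j; lia.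
Qed.

(** Up to any degree, series multiply as their polynomial truncations do, so associativity and
    commutativity are inherited from [{poly R}]. *)
Lemma fps_mulE n f g i : (i <= n)%N -> fps_mul f g i = (ptrunc n f * ptrunc n g)`_i.
Proof.
move=> le_in; rewrite coefM; apply: eq_bigr => j _.
by rewrite !coef_ptrunc //; have := ltn_ord j; lia.
Qed.

Lemma fps_mulA : associative fps_mul.
Proof.
move=> f g h; apply: fpsP => n.
rewrite !(@fps_mulE n) //.
have e f' g' i : (i <= n)%N ->
    (ptrunc n (fps_mul f' g'))`_i = (ptrunc n f' * ptrunc n g')`_i.
  by move=> le_in; rewrite coef_ptrunc // (fps_mulE _ _ le_in).
rewrite (@coefM_agree n _ (ptrunc n f) _ (ptrunc n g * ptrunc n h)) //; last first.
  by move=> i; apply: e.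
rewrite [RHS](@coefM_agree n _ (ptrunc n f * ptrunc n g) _ (ptrunc n h)) //.
  by rewrite mulrA.
by move=> i; apply: e.
Qed.

Lemma fps_mulC : commutative fps_mul.
Proof. by move=> f g; apply: fpsP => n; rewrite !(@fps_mulE n) // mulrC. Qed.

Lemma fps_const_mulE a f n : fps_mul (fps_const a) f n = a * f n.
Proof.
rewrite /fps_mul big_ord_recl subn0 big1 ?addr0 // => j _.
by rewrite mul0r.
Qed.

Lemma fps_mul1 : left_id (fps_const 1) fps_mul.
Proof. by move=> f; apply: fpsP => n; rewrite fps_const_mulE mul1r. Qed.

Lemma fps_mulDl : left_distributive fps_mul +%R.
Proof.
move=> f g h; apply: fpsP => n; rewrite /fps_mul -[RHS]big_split /=.
by apply: eq_bigr => j _; rewrite -mulrDl.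
Qed.

Lemma fps_one_neq0 : fps_const 1 != 0 :> fps R.
Proof. by apply/eqP => /(congr1 (fun f => f 0%N)) /eqP; rewrite oner_eq0. Qed.

HB.instance Definition _ := GRing.Zmodule_isComNzRing.Build (fps R)
  fps_mulA fps_mulC fps_mul1 fps_mulDl fps_one_neq0.

Lemma coef_fpsM f g n : (f * g) n = \sum_(j < n.+1) f j * g (n - j)%N.
Proof. by []. Qed.

Lemma coef_fpsM_ptrunc f g n : (f * g) n = (ptrunc n f * ptrunc n g)`_n.
Proof. exact: fps_mulE. Qed.

Lemma coef_fpsD f g n : (f + g) n = f n + g n. Proof. by []. Qed.
Lemma coef_fpsN f n : (- f) n = - f n. Proof. by []. Qed.
Lemma coef_fpsB f g n : (f - g) n = f n - g n. Proof. by []. Qed.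
Lemma coef_fps1 n : (1 : fps R) n = (n == 0%N)%:R. Proof. by case: n. Qed.

Lemma coef_fps_sum (I : Type) (r : seq I) (P : pred I) (F : I -> fps R) n :
  (\sum_(i <- r | P i) F i) n = \sum_(i <- r | P i) F i n.
Proof. by elim/big_rec2: _ => // i x y _ <-. Qed.

Lemma coef_fpsMn f m n : (f *+ m) n = f n *+ m.
Proof. by elim: m => [|m IH]; rewrite ?mulr0n // !mulrS coef_fpsD IH. Qed.

Lemma coef_fpsM0 f g : (f * g) 0%N = f 0%N * g 0%N.
Proof. by rewrite coef_fpsM big_ord1. Qed.

Definition fps_coef0 (g : fps R) : R := g 0%N.
Lemma fps_coef0_zmod : zmod_morphism fps_coef0. Proof. by []. Qed.
Lemma fps_coef0_monoid : monoid_morphism fps_coef0.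
Proof. by split=> // g h; apply: coef_fpsM0. Qed.
HB.instance Definition _ :=
  GRing.isZmodMorphism.Build (fps R) R fps_coef0 fps_coef0_zmod.
HB.instance Definition _ :=
  GRing.isMonoidMorphism.Build (fps R) R fps_coef0 fps_coef0_monoid.

Lemma fps_const_zmod : zmod_morphism fps_const.
Proof. by move=> a b; apply: fpsP => -[|n] //; rewrite coef_fpsB /= subrr. Qed.

Lemma fps_const_monoid : monoid_morphism fps_const.
Proof.
split=> // a b; apply: fpsP => n.
by rewrite [RHS]fps_const_mulE; case: n => //= n; rewrite mulr0.
Qed.

HB.instance Definition _ := GRing.isZmodMorphism.Build R (fps R) fps_const fps_const_zmod.
HB.instance Definition _ := GRing.isMonoidMorphism.Build R (fps R) fps_const fps_const_monoid.

Lemma coef_fps_constM a f n : (fps_const a * f) n = a * f n.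
Proof. exact: fps_const_mulE. Qed.

Definition fpsX : fps R := fun n => (n == 1%N)%:R.

Lemma coef_fpsXM f n : (fpsX * f) n = if n is n'.+1 then f n' else 0.
Proof.
case: n => [|n]; first by rewrite coef_fpsM0 mul0r.
rewrite coef_fpsM !big_ord_recl mul0r add0r /= mul1r subSS subn0 big1 ?addr0 //.
by move=> j _; rewrite mul0r.
Qed.

Lemma coef_fpsXnM m f n : (fpsX ^+ m * f) n = if (m <= n)%N then f (n - m)%N else 0.
Proof.
elim: m n => [|m IH] [|n]; rewrite ?expr0 ?mul1r ?subn0 //.
  by rewrite exprS -mulrA coef_fpsXM.
by rewrite exprS -mulrA coef_fpsXM IH subSS ltnS.
Qed.

Lemma coef_fpsXn m n : (fpsX ^+ m) n = (n == m)%:R.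
Proof.
rewrite -[fpsX ^+ m]mulr1 coef_fpsXnM coef_fps1; case: leqP => [le_mn|lt_nm].
  by rewrite subn_eq0 eqn_leq le_mn andbT.
by rewrite ltn_eqF.
Qed.

Lemma fps_split f : f = fps_const (f 0%N) + fpsX * ((fun n => f n.+1) : fps R).
Proof.
by apply: fpsP => -[|n]; rewrite coef_fpsD coef_fpsXM /= ?addr0 ?add0r.
Qed.

End PowerSeriesRing.

Arguments fpsX {R}.

Section PowerSeriesMap.
Variables (R S : comNzRingType) (s : {rmorphism R -> S}).

Definition fps_map (f : fps R) : fps S := fun n => s (f n).

Lemma fps_map_zmod : zmod_morphism fps_map.
Proof. by move=> f g; apply: fpsP => n; rewrite /fps_map coef_fpsB rmorphB. Qed.

Lemma fps_map_monoid : monoid_morphism fps_map.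
Proof.
split=> [|f g]; apply: fpsP => n; rewrite /fps_map.
  by rewrite !coef_fps1 rmorph_nat.
by rewrite !coef_fpsM rmorph_sum; apply: eq_bigr => j _; rewrite rmorphM.
Qed.

HB.instance Definition _ :=
  GRing.isZmodMorphism.Build (fps R) (fps S) fps_map fps_map_zmod.
HB.instance Definition _ :=
  GRing.isMonoidMorphism.Build (fps R) (fps S) fps_map fps_map_monoid.

End PowerSeriesMap.

(** * Formal derivatives *)

Section PowerSeriesDerivative.
Variable R : comNzRingType.
Implicit Types g h : fps R.

Definition fps_deriv g : fps R := fun n => g n.+1 *+ n.+1.

Lemma fps_deriv_zmod : zmod_morphism fps_deriv.
Proof. by move=> g h; apply: fpsP => n; rewrite /fps_deriv !coef_fpsB mulrnBl. Qed.

HB.instance Definition _ :=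
  GRing.isZmodMorphism.Build (fps R) (fps R) fps_deriv fps_deriv_zmod.

Lemma coef_fps_deriv_ptrunc g n i : (i <= n)%N ->
  ((ptrunc n.+1 g)^`())`_i = fps_deriv g i.
Proof. by move=> le_in; rewrite coef_deriv coef_ptrunc. Qed.

Lemma fps_derivM g h : fps_deriv (g * h) = fps_deriv g * h + g * fps_deriv h.
Proof.
apply: fpsP => n; rewrite {1}/fps_deriv coef_fpsM_ptrunc -coef_deriv derivM.
rewrite coefD coef_fpsD; congr (_ + _); rewrite coef_fpsM coefM;
  apply: eq_bigr => i _; have := ltn_ord i => lt_in.
  by rewrite coef_fps_deriv_ptrunc ?coef_ptrunc //; lia.
by rewrite coef_fps_deriv_ptrunc ?coef_ptrunc //; lia.
Qed.

Lemma fps_deriv_const a : fps_deriv (fps_const a) = 0.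
Proof. by apply: fpsP => n; rewrite /fps_deriv /= mul0rn. Qed.

Lemma fps_deriv_exp g m : fps_deriv (g ^+ m) = g ^+ m.-1 * fps_deriv g *+ m.
Proof.
elim: m => [|m IH]; first by rewrite expr0 -(rmorph1 (@fps_const R)) fps_deriv_const.
rewrite exprS fps_derivM IH mulrS [fps_deriv g * _]mulrC; congr (_ + _).
by rewrite mulrnAr mulrA; case: m {IH} => [|m]; rewrite ?mulr0n // [m.+1.-1]/= -exprS.
Qed.

End PowerSeriesDerivative.

(** * Complete filtered rings *)

(** Completeness comes with an explicit rate: the remainder after [N] terms lies in step [N].
    Substituting an element of step 1 in a series only calls for sums of this kind. *)
Record filtration (A : comNzRingType) := Filtration {
  fil :> nat -> A -> Prop;
  fil_all : forall x, fil 0%N x;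
  filS : forall n x, fil n.+1 x -> fil n x;
  fil0 : forall n, fil n 0;
  filB : forall n x y, fil n x -> fil n y -> fil n (x - y);
  filM : forall m n x y, fil m x -> fil n y -> fil (m + n)%N (x * y);
  fil_sep : forall x, (forall n, fil n x) -> x = 0;
  fil_sum : forall u : nat -> A, (forall n, fil n (u n)) ->
    exists s, forall N, fil N (s - \sum_(n < N) u n)
}.

Section FilteredRing.
Variables (A : comNzRingType) (F : filtration A).
Implicit Types x y : A.

Lemma filN n x : F n x -> F n (- x).
Proof. by move=> Fx; rewrite -sub0r; apply: filB => //; apply: fil0. Qed.

Lemma filD n x y : F n x -> F n y -> F n (x + y).
Proof. by move=> Fx Fy; rewrite -[y]opprK; apply/filB/filN. Qed.

Lemma filW m n x : (m <= n)%N -> F n x -> F m x.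
Proof.
move=> /subnK <-; elim: (n - m)%N => [|d IH] //; rewrite addSn => Fx.
exact/IH/filS.
Qed.

Lemma filMl n x y : F n y -> F n (x * y).
Proof. by move=> Fy; rewrite -[n]add0n; apply: filM => //; apply: fil_all. Qed.

Lemma filMr n x y : F n x -> F n (x * y).
Proof. by rewrite mulrC; apply: filMl. Qed.

Lemma fil_bigsum (I : Type) (r : seq I) (P : pred I) (u : I -> A) n :
  (forall i, P i -> F n (u i)) -> F n (\sum_(i <- r | P i) u i).
Proof. by move=> Fu; elim/big_ind: _ => // [|*]; [apply: fil0 | apply: filD]. Qed.

Lemma filX y n : F 1%N y -> F n (y ^+ n).
Proof.
move=> Fy; elim: n => [|n IH]; first exact: fil_all.
by rewrite exprS -add1n; apply: filM.
Qed.

Lemma fil_eq x y : (forall n, F n (x - y)) -> x = y.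
Proof. by move=> /fil_sep /eqP; rewrite subr_eq0 => /eqP. Qed.

Lemma filC n x y : F n (x - y) -> F n (y - x).
Proof. by move=> /filN; rewrite opprB. Qed.

Lemma fil_trans n x y z : F n (x - y) -> F n (y - z) -> F n (x - z).
Proof. by move=> Fxy Fyz; rewrite -[x](subrK y) -addrA; apply: filD. Qed.

Definition asum (u : nat -> A) : A :=
  xget 0 [set s | forall N, F N (s - \sum_(n < N) u n)].

Lemma asumP u : (forall n, F n (u n)) -> forall N, F N (asum u - \sum_(n < N) u n).
Proof.
move=> /fil_sum; exact: (@xgetPex _ 0 [set s | forall N, F N (s - \sum_(n < N) u n)]).
Qed.

Lemma asum_eq (u : nat -> A) (s : A) : (forall N, F N (s - \sum_(n < N) u n)) -> asum u = s.
Proof.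
move=> Fs; apply: fil_eq => N; apply: (@fil_trans _ _ (\sum_(n < N) u n)).
  pose P := [set s | forall N, F N (s - \sum_(n < N) u n)].
  by have /(_ N) := @xgetPex _ 0 P (ex_intro _ s Fs).
exact: filC.
Qed.

(** Substitution of [y] in a series with coefficients in [A]; the junk value for
  [y] outside of the first step of the filtration is the constant term, which
  makes [gcomp y] a ring morphism for every [y]. *)
Definition gsub y : A := if `[< F 1%N y >] then y else 0.

Definition gcomp y (h : fps A) : A := asum (fun n => h n * gsub y ^+ n).

Lemma gsub_fil y : F 1%N (gsub y).
Proof. by rewrite /gsub; case: asboolP => // _; apply: fil0. Qed.

Lemma gcomp_approx y (h : fps A) N : F N (gcomp y h - \sum_(n < N) h n * gsub y ^+ n).
Proof. by apply: asumP => n; apply/filMl/filX/gsub_fil. Qed.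

Lemma gcompP y (h : fps A) N : F 1%N y -> F N (gcomp y h - \sum_(n < N) h n * y ^+ n).
Proof.
by move=> Fy; have := gcomp_approx y h N; rewrite /gsub; case: asboolP.
Qed.

Lemma gcomp_eq y (h : fps A) (s : A) : F 1%N y ->
  (forall N, F N (s - \sum_(n < N) h n * y ^+ n)) -> gcomp y h = s.
Proof. by move=> Fy; rewrite /gcomp /gsub; case: asboolP => // _; apply: asum_eq. Qed.

Lemma gcomp_zmod y : zmod_morphism (gcomp y).
Proof.
move=> h h'; apply: asum_eq => N.
under eq_bigr do rewrite coef_fpsB mulrBl.
have := filB (gcomp_approx y h N) (gcomp_approx y h' N); congr (F N _).
by rewrite sumrB; ring.
Qed.

Lemma fil_horner (P : {poly A}) y N :
  F 1%N y -> (forall i, (i < N)%N -> P`_i = 0) -> F N P.[y].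
Proof.
move=> Fy P0; rewrite horner_coef; apply: fil_bigsum => i _.
case: (ltnP i N) => [lt_iN|le_Ni]; first by rewrite P0 // mul0r; apply: fil0.
by apply: filMl; apply: (filW le_Ni); apply: filX.
Qed.

Lemma horner_ptrunc (h : fps A) y N :
  (ptrunc N h).[y] = \sum_(n < N.+1) h n * y ^+ n.
Proof. by rewrite horner_poly. Qed.

Lemma gcomp_monoid y : monoid_morphism (gcomp y).
Proof.
have Fy := gsub_fil y; split=> [|h h']; apply: asum_eq => [] [|N]; try exact: fil_all.
  rewrite big_ord_recl coef_fps1 mulr1 big1 ?addr0 ?subrr; first exact: fil0.
  by move=> j _; rewrite coef_fps1 mul0r.
rewrite -horner_ptrunc; set z := gsub y in Fy *.
(* The product of the truncations and the truncated product have the same coefficients up to degree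
   [N], so their values at [z] differ by an element of step [N.+1]. *)
apply: (@fil_trans _ _ ((ptrunc N h * ptrunc N h').[z])); last first.
  rewrite -hornerN -hornerD; apply: fil_horner => // i; rewrite ltnS => le_iN.
  by rewrite coefB [in X in _ - X]coef_ptrunc // -(fps_mulE h h' le_iN) subrr.
rewrite hornerM !horner_ptrunc.
apply: (@fil_trans _ _ (gcomp y h * \sum_(n < N.+1) h' n * z ^+ n)).
  by rewrite -mulrBr; apply/filMl/gcomp_approx.
by rewrite -mulrBl; apply/filMr/gcomp_approx.
Qed.

HB.instance Definition _ y :=
  GRing.isZmodMorphism.Build (fps A) A (gcomp y) (gcomp_zmod y).
HB.instance Definition _ y :=
  GRing.isMonoidMorphism.Build (fps A) A (gcomp y) (gcomp_monoid y).

Lemma gcomp_const y a : gcomp y (fps_const a) = a.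
Proof.
apply: asum_eq => -[|N]; first exact: fil_all.
rewrite big_ord_recl mulr1 big1 ?addr0 ?subrr; first exact: fil0.
by move=> j _; rewrite mul0r.
Qed.

Lemma gcompX y : F 1%N y -> gcomp y fpsX = y.
Proof.
move=> Fy; apply: gcomp_eq => // -[|[|N]]; first exact: fil_all.
  by rewrite big_ord1 mul0r subr0.
rewrite !big_ord_recl mul0r mul1r expr1 big1 => [|j _]; last by rewrite mul0r.
by rewrite add0r addr0 subrr; apply: fil0.
Qed.

Lemma gcomp_fil y (h : fps A) n :
  F 1%N y -> (forall j, F (n - j)%N (h j)) -> F n (gcomp y h).
Proof.
move=> Fy Fh; rewrite -[gcomp y h](subrK (\sum_(i < n) h i * y ^+ i)).
apply: filD; first exact: gcompP.
apply: fil_bigsum => i _; have le_in : (n <= n - i + i)%N by lia.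
apply: (filW le_in).
by apply: filM; [apply: Fh | apply: filX].
Qed.

(** The geometric series converges for [x] in step 1. It supplies the inverses of series with
    invertible constant term below. *)
Lemma geometric x : F 1%N x -> (1 - x) * gcomp x (fun=> 1) = 1.
Proof.
move=> Fx; have <- : gcomp x (1 - fpsX) = 1 - x by rewrite rmorphB rmorph1 /= gcompX.
rewrite -rmorphM -[RHS](rmorph1 (gcomp x)); congr gcomp; apply: fpsP => n.
by rewrite mulrBl mul1r coef_fpsB coef_fpsXM coef_fps1; case: n => [|n]; rewrite ?subr0 ?subrr.
Qed.

End FilteredRing.

Section FilteredMorphism.
Variables (A B : comNzRingType) (FA : filtration A) (FB : filtration B).
Variable s : {rmorphism A -> B}.
Hypothesis s_cont : forall n x, FA n x -> FB n (s x).

Lemma rmorph_gcomp y h : FA 1%N y -> s (gcomp FA y h) = gcomp FB (s y) (fps_map s h).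
Proof.
move=> Fy; symmetry; apply: gcomp_eq; first exact: s_cont.
move=> N; have /s_cont := gcompP h N Fy; rewrite rmorphB rmorph_sum /=.
by congr (FB N (_ - _)); apply: eq_bigr => n _; rewrite rmorphM rmorphXn.
Qed.

End FilteredMorphism.

(** * Filtrations on a field and on power series *)

Section FilteredField.
Variable K : fieldType.

Lemma field_fil_sum (u : nat -> K) : (forall n, (0 < n)%N -> u n = 0) ->
  exists s, forall N, (0 < N)%N -> s - \sum_(n < N) u n = 0.
Proof.
move=> u0; exists (u 0%N) => -[|N] // _; rewrite big_ord_recl big1 ?addr0 ?subrr //.
by move=> j _; apply: u0.
Qed.

(** The field is taken discrete, so that [fps_fil] over it is the X-adic filtration; the valuation
    of the field enters through [divides_in] instead. *)
Definition field_fil : filtration K.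
Proof.
apply: (@Filtration K (fun n x => (0 < n)%N -> x = 0)) => //.
- by move=> [|n] x //= ->.
- by move=> n x y x0 y0 n0; rewrite x0 ?y0 ?subrr.
- move=> [|m] n x y x0 y0; rewrite ?add0n => n0; first by rewrite y0 ?mulr0.
  by rewrite x0 ?mul0r.
- by move=> x /(_ 1%N); apply.
- exact: field_fil_sum.
Defined.

End FilteredField.

Section FilteredSeries.
Variables (B : comNzRingType) (FB : filtration B).

Lemma fps_fil_sum (u : nat -> fps B) :
  (forall n j, FB (n - j)%N (u n j)) ->
  exists s : fps B, forall N j, FB (N - j)%N ((s - \sum_(n < N) u n) j).
Proof.
move=> Fu.
(* Step [n - j] is the whole ring while [n <= j], so the terms before the j-th are added up as they
   are, and only the later ones form a convergent series in [B]. *)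
pose s : fps B := fun j => \sum_(n < j) u n j + asum FB (fun m => u (m + j)%N j).
exists s => N j; rewrite coef_fpsB coef_fps_sum /s.
case: (ltnP N j) => [lt_Nj|le_jN].
  by have /eqP -> : (N - j == 0)%N; [lia | apply: fil_all].
have Fv m : FB m (u (m + j)%N j) by have := Fu (m + j)%N j; rewrite addnK.
have := asumP Fv (N - j)%N; congr (FB _ _).
rewrite -!(big_mkord xpredT (fun n => u n j)) (@big_cat_nat _ _ _ j 0 N) //=.
have -> : \sum_(j <= n < N) u n j = \sum_(n < N - j) u (n + j)%N j.
  by rewrite -{1}[j]add0n big_addn big_mkord.
by rewrite opprD addrACA subrr add0r.
Qed.

(** The new variable has degree 1: applied twice to the discrete field, this filters [k[[X]][[T]]]
    by total degree. *)
Definition fps_fil : filtration (fps B).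
Proof.
apply: (@Filtration (fps B) (fun n f => forall j, FB (n - j)%N (f j))).
- by move=> f j; rewrite sub0n; apply: fil_all.
- by move=> n f Ff j; apply: filW (Ff j); lia.
- by move=> n j; apply: fil0.
- by move=> n f g Ff Fg j; apply: filB.
- move=> m n f g Ff Fg j; rewrite coef_fpsM; apply: fil_bigsum => i _.
  apply: (@filW _ _ _ ((m - i) + (n - (j - i)))%N); last exact: filM.
  by have := ltn_ord i; lia.
- move=> f Ff; apply: fpsP => j; apply: (fil_sep (f := FB)) => n.
  by have := Ff (n + j)%N j; rewrite addnK.
- exact: fps_fil_sum.
Defined.

Lemma fpsX_fil : fps_fil 1%N fpsX.
Proof.
by case=> [|j]; [apply: fil0 | rewrite subSS sub0n; apply: fil_all].
Qed.

Lemma fps_const_fil n a : FB n a -> fps_fil n (fps_const a).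
Proof. by move=> Fa [|j] //=; [rewrite subn0 | apply: fil0]. Qed.

End FilteredSeries.

(** * Substitution in series with scalar coefficients *)

Section Substitution.
Variables (k A : comNzRingType) (F : filtration A) (c : {rmorphism k -> A}).

Definition subst (y : A) : fps k -> A := gcomp F y \o fps_map c.

HB.instance Definition _ y := GRing.RMorphism.copy (subst y) (gcomp F y \o fps_map c).

Lemma substP y (f : fps k) N : F 1%N y -> F N (subst y f - \sum_(n < N) c (f n) * y ^+ n).
Proof. exact: gcompP. Qed.

Lemma subst_eq y (f : fps k) (s : A) : F 1%N y ->
  (forall N, F N (s - \sum_(n < N) c (f n) * y ^+ n)) -> subst y f = s.
Proof. exact: gcomp_eq. Qed.

Lemma subst_const y a : subst y (fps_const a) = c a.
Proof.
rewrite -[RHS](gcomp_const F y) /subst /=; congr gcomp.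
by apply: fpsP => -[|n]; rewrite /fps_map /= ?rmorph0.
Qed.

Lemma substX y : F 1%N y -> subst y fpsX = y.
Proof.
move=> Fy; rewrite -[RHS](gcompX Fy) /subst /=; congr gcomp.
by apply: fpsP => n; rewrite /fps_map /fpsX rmorph_nat.
Qed.

End Substitution.

Section SubstitutionMorphism.
Variables (k A B : comNzRingType) (FA : filtration A) (FB : filtration B).
Variables (cA : {rmorphism k -> A}) (cB : {rmorphism k -> B}).
Variable s : {rmorphism A -> B}.
Hypothesis s_cont : forall n x, FA n x -> FB n (s x).
Hypothesis s_c : forall a, s (cA a) = cB a.

Lemma rmorph_subst y f : FA 1%N y -> s (subst FA cA y f) = subst FB cB (s y) f.
Proof.
move=> Fy; rewrite /subst /= (rmorph_gcomp s_cont) //; congr gcomp.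
by apply: fpsP => n; rewrite /fps_map s_c.
Qed.

End SubstitutionMorphism.

(** * Congruences modulo powers of a uniformizer *)

Record is_subring (A : comNzRingType) (P : A -> Prop) : Prop := IsSubring {
  sub_one : P 1;
  sub_sub : forall x y, P x -> P y -> P (x - y);
  sub_mul : forall x y, P x -> P y -> P (x * y)
}.

(** The quotient has to lie in [P]: below, [w] is the constant [pi], invertible in [A], so that
    divisibility in [A] itself would carry no information. *)
Definition divides_in (A : comNzRingType) (P : A -> Prop) (w : A) (n : nat) (x : A) :=
  exists2 z, P z & x = w ^+ n * z.

Section Congruences.
Variables (A : comNzRingType) (P : A -> Prop).
Hypothesis subP : is_subring P.
Local Hint Resolve subP : core.
Implicit Types x y : A.

Lemma sub_zero : P 0.
Proof. by rewrite -(subrr 1); apply: sub_sub => //; apply: sub_one. Qed.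

Lemma sub_opp x : P x -> P (- x).
Proof. by move=> Px; rewrite -sub0r; apply: sub_sub => //; apply: sub_zero. Qed.

Lemma sub_add x y : P x -> P y -> P (x + y).
Proof. by move=> Px Py; rewrite -[y]opprK; apply: sub_sub => //; apply: sub_opp. Qed.

Lemma sub_exp x n : P x -> P (x ^+ n).
Proof.
by move=> Px; elim: n => [|n IH]; [exact: sub_one | rewrite exprS; apply: sub_mul].
Qed.

Lemma sub_bigsum (I : Type) (r : seq I) (C : pred I) (u : I -> A) :
  (forall i, C i -> P (u i)) -> P (\sum_(i <- r | C i) u i).
Proof. by move=> Pu; elim/big_ind: _ => // [|*]; [apply: sub_zero | apply: sub_add]. Qed.

Lemma sub_natmul x n : P x -> P (x *+ n).
Proof.
move=> Px; elim: n => [|n IH]; rewrite ?mulr0n ?mulrS; first exact: sub_zero.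
exact: sub_add.
Qed.

Lemma sub_nat n : P n%:R.
Proof. by apply: sub_natmul; apply: sub_one. Qed.

Variable w : A.
Hypothesis Pw : P w.
Local Notation div := (divides_in P w).

Lemma div_in n x : div n x -> P x.
Proof. by case=> z Pz ->; apply: sub_mul => //; apply: sub_exp. Qed.

Lemma in_div x : P x -> div 0 x.
Proof. by exists x; rewrite ?mul1r. Qed.

Lemma div_zero n : div n 0.
Proof. by exists 0; rewrite ?mulr0 //; apply: sub_zero. Qed.

Lemma div_sub n x y : div n x -> div n y -> div n (x - y).
Proof.
move=> [z Pz ->] [t Pt ->]; exists (z - t); first exact: sub_sub.
by rewrite mulrBr.
Qed.

Lemma div_opp n x : div n x -> div n (- x).
Proof. by move=> dx; rewrite -sub0r; apply: div_sub => //; apply: div_zero. Qed.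

Lemma div_add n x y : div n x -> div n y -> div n (x + y).
Proof. by move=> dx dy; rewrite -[y]opprK; apply: div_sub => //; apply: div_opp. Qed.

Lemma div_mul m n x y : div m x -> div n y -> div (m + n) (x * y).
Proof.
move=> [z Pz ->] [t Pt ->]; exists (z * t); first exact: sub_mul.
by rewrite exprD; ring.
Qed.

Lemma div_mull n x y : P x -> div n y -> div n (x * y).
Proof. by move=> /in_div dx dy; rewrite -[n]add0n; apply: div_mul. Qed.

Lemma div_mulr n x y : div n x -> P y -> div n (x * y).
Proof. by move=> dx Py; rewrite mulrC; apply: div_mull. Qed.

Lemma div_le m n x : (m <= n)%N -> div n x -> div m x.
Proof.
move=> /subnKC <- [z Pz ->]; exists (w ^+ (n - m) * z).
  by apply: sub_mul => //; apply: sub_exp.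
by rewrite exprD mulrA.
Qed.

Lemma div_bigsum n (I : Type) (r : seq I) (C : pred I) (u : I -> A) :
  (forall i, C i -> div n (u i)) -> div n (\sum_(i <- r | C i) u i).
Proof. by move=> du; elim/big_ind: _ => // [|*]; [apply: div_zero | apply: div_add]. Qed.

Lemma div_trans n x y z : div n (x - y) -> div n (y - z) -> div n (x - z).
Proof. by move=> dxy dyz; rewrite -[x](subrK y) -addrA; apply: div_add. Qed.

Lemma div_sym n x y : div n (x - y) -> div n (y - x).
Proof. by move=> /div_opp; rewrite opprB. Qed.

Lemma congM n x x' y y' : P x -> P y' ->
  div n (x - x') -> div n (y - y') -> div n (x * y - x' * y').
Proof.
move=> Px Py' dx dy; rewrite (_ : _ - _ = x * (y - y') + (x - x') * y'); last by ring.
by apply: div_add; [apply: div_mull | apply: div_mulr].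
Qed.

Lemma congX n x y h : P x -> P y -> div n (x - y) -> div n (x ^+ h - y ^+ h).
Proof.
move=> Px Py dxy; rewrite subrXX; apply: div_mulr => //.
by apply: sub_bigsum => i _; apply: (sub_mul subP); apply: sub_exp.
Qed.

Variable p : nat.
Hypotheses (p_pr : prime p) (div_p : div 1 p%:R).

(** The cofactor of [x - y] in [x^p - y^p] is congruent to [p y^(p-1)], hence to 0, modulo [w]; this
    is the extra factor. *)
Lemma congXp n x y : (0 < n)%N -> P x -> P y ->
  div n (x - y) -> div n.+1 (x ^+ p - y ^+ p).
Proof.
move=> n_gt0 Px Py dxy; rewrite subrXX -addn1; apply: div_mul => //.
have -> : \sum_(i < p) x ^+ (p.-1 - i) * y ^+ i =
    \sum_(i < p) (x ^+ (p.-1 - i) - y ^+ (p.-1 - i)) * y ^+ i + p%:R * y ^+ p.-1.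
  rewrite -[p in p%:R]card_ord -sum1_card natr_sum mulr_suml -big_split /=.
  apply: eq_bigr => i _; rewrite mulrBl -exprD subnK ?mul1r ?subrK //.
  by rewrite -ltnS prednK ?ltn_ord ?prime_gt0.
apply: div_add; last by apply: div_mulr; [exact: div_p | exact: sub_exp].
apply: div_bigsum => i _; apply: div_mulr; last exact: sub_exp.
by apply: congX => //; apply: div_le dxy.
Qed.

Lemma congXpn n m x y : (0 < n)%N -> P x -> P y ->
  div n (x - y) -> div (n + m)%N (x ^+ (p ^ m) - y ^+ (p ^ m)).
Proof.
move=> n_gt0 Px Py dxy; elim: m => [|m IH]; first by rewrite addn0 expn0.
rewrite addnS expnSr !exprM; apply: congXp => //; try exact: sub_exp.
by rewrite addn_gt0 n_gt0.
Qed.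

(** Each of the [logn p h] successive p-th powers gains a factor [w], and the remaining exponent
    loses none. *)
Lemma congX_logn h x y : (0 < h)%N -> P x -> P y ->
  div 1 (x - y) -> div (logn p h).+1 (x ^+ h - y ^+ h).
Proof.
move=> h_gt0 Px Py dxy; have := pfactor_dvdnn p h.
move: (logn p h) => l /dvdnP [m ->].
rewrite mulnC !exprM -add1n; apply: congX; try exact: sub_exp.
by apply: congXpn.
Qed.

Lemma congDp x y : P x -> P y -> div 1 ((x + y) ^+ p - (x ^+ p + y ^+ p)).
Proof.
move=> Px Py; rewrite exprDn -(prednK (prime_gt0 p_pr)) big_ord_recl big_ord_recr /=.
rewrite subn0 subnn !expr0 mulr1 mul1r bin0 binn !mulr1n.
set s := \sum_(i < _) _; rewrite (_ : _ - _ = s); last by ring.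
apply: div_bigsum => i _.
have /dvdnP [m ->] : (p %| 'C(p.-1.+1, bump 0 i))%N.
  by rewrite (prednK (prime_gt0 p_pr)); apply: prime_dvd_bin => //;
    rewrite /bump leq0n add1n; have := ltn_ord i; lia.
rewrite -mulr_natr mulnC natrM mulrA mulrC.
apply: div_mull; first exact: sub_nat.
by apply: div_mull => //; apply: (sub_mul subP); apply: sub_exp.
Qed.

Lemma congDpn m x y : P x -> P y ->
  div 1 ((x + y) ^+ (p ^ m) - (x ^+ (p ^ m) + y ^+ (p ^ m))).
Proof.
move=> Px Py; elim: m => [|m IH].
  by rewrite expn0 !expr1 subrr; apply: div_zero.
rewrite expnSr !exprM; set xm := x ^+ _ in IH *; set ym := y ^+ _ in IH *.
have Pxm : P xm by apply: sub_exp.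
have Pym : P ym by apply: sub_exp.
apply: (@div_trans _ _ ((xm + ym) ^+ p)); last exact: congDp.
by apply: congX => //; [apply/sub_exp/sub_add | apply: sub_add].
Qed.

End Congruences.

(** * Rings with a Frobenius lift *)

(** The instances are [k], [k[[X]]] and [k[[X]][[T]]] with [phi] raising the
  variables to the power [q]: this handles series in one and in two variables
  simultaneously. *)
Record frobenius_ring (k : fieldType) (O : k -> Prop) (pi : k) (q : nat)
    (A : comNzRingType) := FrobeniusRing {
  ffil :> filtration A;
  fcst : {rmorphism k -> A};
  fint : A -> Prop;
  fphi : {rmorphism A -> A};
  fint_sub : is_subring fint;
  fint_cst : forall a, O a -> fint (fcst a);
  fint_closed : forall x, (forall n, exists2 y, fint y & ffil n (x - y)) -> fint x;
  fphi_fil : forall n x, (0 < n)%N -> ffil n x -> ffil n.+1 (fphi x);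
  fphi_cst : forall a, fphi (fcst a) = fcst a;
  fphiP : forall x, fint x -> divides_in fint (fcst pi) 1 (fphi x - x ^+ q)
}.

Section SeriesFrobenius.
Variables (k : fieldType) (O : k -> Prop) (pi : k) (p f : nat).
Hypotheses (O_pi : O pi) (p_pr : prime p) (f_gt0 : (0 < f)%N).
Hypothesis O_p : divides_in O pi 1 p%:R.
Local Notation q := (p ^ f)%N.
Variables (B : comNzRingType) (FB : frobenius_ring O pi q B).

Lemma q_gt1 : (1 < q)%N.
Proof. by rewrite -(exp1n f) ltn_exp2r // prime_gt1. Qed.
Local Hint Resolve q_gt1 : core.

Lemma q_gt0 : (0 < q)%N. Proof. exact: ltnW. Qed.
Local Hint Resolve q_gt0 : core.

Definition series_phi (g : fps B) : fps B :=
  fun n => if (q %| n)%N then fphi FB (g (n %/ q)%N) else 0.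

Definition series_int (g : fps B) : Prop := forall n, fint FB (g n).

Lemma series_phi_zmod : zmod_morphism series_phi.
Proof.
move=> g h; apply: fpsP => n; rewrite coef_fpsB /series_phi.
by case: (q %| n)%N; rewrite ?subrr // coef_fpsB rmorphB.
Qed.

Lemma series_phiE g n i : (i <= n)%N ->
  series_phi g i = (map_poly (fphi FB) (ptrunc n g) \Po 'X^q)`_i.
Proof.
move=> le_in; rewrite coef_comp_poly_Xn // coef_map coef_ptrunc //.
exact: leq_trans (leq_div _ _) _.
Qed.

Lemma series_phi_monoid : monoid_morphism series_phi.
Proof.
split=> [|g h]; apply: fpsP => n.
  rewrite /series_phi !coef_fps1; case: (posnP n) => [->|n_gt0].
    by rewrite dvdn0 div0n rmorph1.
  case: ifP => // dvd_qn.
  by rewrite ?coef_fps1 gtn_eqF ?rmorph0 // divn_gt0 // dvdn_leq.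
rewrite (series_phiE _ (leqnn n)).
rewrite coef_fpsM_ptrunc.
rewrite (@coefM_agree _ n _ (map_poly (fphi FB) (ptrunc n g) \Po 'X^q) _
    (map_poly (fphi FB) (ptrunc n h) \Po 'X^q)) //; try by move=> i le_in;
    rewrite coef_ptrunc // -series_phiE.
rewrite -comp_polyM -rmorphM /= !coef_comp_poly_Xn //; case: ifP => // _.
by rewrite !coef_map coef_ptrunc ?leq_div // -(fps_mulE g h (leq_div n q)).
Qed.

HB.instance Definition _ :=
  GRing.isZmodMorphism.Build (fps B) (fps B) series_phi series_phi_zmod.
HB.instance Definition _ :=
  GRing.isMonoidMorphism.Build (fps B) (fps B) series_phi series_phi_monoid.

Definition series_cst : k -> fps B := @fps_const B \o fcst FB.
HB.instance Definition _ := GRing.RMorphism.copy series_cst (@fps_const B \o fcst FB).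

Lemma series_int_sub : is_subring series_int.
Proof.
have S := fint_sub FB; split=> [n|g h Ig Ih n|g h Ig Ih n].
- by rewrite coef_fps1; apply: sub_nat.
- exact: sub_sub.
- by rewrite coef_fpsM; apply: sub_bigsum => // i _; apply: sub_mul.
Qed.

Lemma series_int_const a : fint FB a -> series_int (fps_const a).
Proof. by move=> Ia [|n] //=; exact: (sub_zero (fint_sub FB)). Qed.

Lemma coef_series_cstXM n (g : fps B) i :
  (series_cst pi ^+ n * g) i = fcst FB pi ^+ n * g i.
Proof.
have -> : series_cst pi ^+ n = fps_const (fcst FB pi ^+ n) by rewrite [RHS]rmorphXn.
exact: coef_fps_constM.
Qed.

Lemma series_div n (g : fps B) :
  (forall i, divides_in (fint FB) (fcst FB pi) n (g i)) <->
  divides_in series_int (series_cst pi) n g.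
Proof.
split=> [dg|[h Ih ->] i]; last first.
  by exists (h i) => //; rewrite coef_series_cstXM.
have /choice [h hP] i : exists z, fint FB z /\ g i = fcst FB pi ^+ n * z.
  by have [z] := dg i; exists z.
exists h => [i|]; first by case: (hP i).
apply: fpsP => i; rewrite coef_series_cstXM.
by case: (hP i).
Qed.

Lemma series_phi_split g : series_phi g =
  fps_const (fphi FB (g 0%N)) + fpsX ^+ q * series_phi (fun n => g n.+1).
Proof.
apply: fpsP => n; rewrite coef_fpsD coef_fpsXnM /series_phi.
case: (posnP n) => [->|n_gt0]; first by rewrite dvdn0 div0n leqn0 gtn_eqF ?addr0.
have -> : fps_const (fphi FB (g 0%N)) n = 0 by case: n n_gt0.
rewrite add0r; case: leqP => [le_qn|lt_nq].
  have [m ->] : exists m, n = (m + q)%N by exists (n - q)%N; rewrite subnK.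
  by rewrite addnK dvdn_addl // divnDr // divnn q_gt0 addn1.
by case: ifP => // /(dvdn_leq n_gt0); rewrite leqNgt lt_nq.
Qed.

(** With [g = c + X g'], the q-th power of [g] is [c^q + X^q g'^q] modulo [pi]. Degree [n] of the
    second term is degree [n - q] of the claim for [g'], whence a strong induction on the degree. *)
Lemma series_phiP g : series_int g ->
  divides_in series_int (series_cst pi) 1 (series_phi g - g ^+ q).
Proof.
move=> Ig; apply/series_div => n; move: n g Ig.
have S := series_int_sub; have SB := fint_sub FB.
have Ipi : series_int (series_cst pi) by apply/series_int_const/fint_cst.
have IpiB : fint FB (fcst FB pi) by apply: fint_cst.
have Ip : divides_in series_int (series_cst pi) 1 p%:R.
  have [z Oz pE] := O_p; exists (series_cst z); first exact/series_int_const/fint_cst.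
  by rewrite -(rmorph_nat series_cst) pE rmorphM rmorphXn.
elim/ltn_ind=> n IH g Ig; pose g' : fps B := fun n => g n.+1.
have Ig' : series_int g' by move=> j; apply: Ig.
set c := fps_const (g 0%N); have Ic : series_int c by apply: series_int_const.
have IX : series_int fpsX by move=> j; exact: (sub_nat SB (j == 1%N)).
have IXg : series_int (fpsX * g') by apply: (sub_mul S).
have /series_div /(_ n) := congDpn S p_pr Ip f Ic IXg.
rewrite -fps_split exprMn => d1.
rewrite (_ : _ n = fps_const (fphi FB (g 0%N) - g 0%N ^+ q) n +
   (fpsX ^+ q * (series_phi g' - g' ^+ q)) n - (g ^+ q - (c ^+ q + fpsX ^+ q * g' ^+ q)) n).
  apply: div_sub => //; apply: div_add => //; last first.
    rewrite coef_fpsXnM; case: leqP => le_qn; last exact: div_zero.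
    by apply: IH => //; have := q_gt0; lia.
  case: (n) => [|?] /=; [exact: fphiP | exact: div_zero].
have -> : fps_const (fphi FB (g 0%N) - g 0%N ^+ q) = fps_const (fphi FB (g 0%N)) - c ^+ q.
  by rewrite rmorphB rmorphXn.
rewrite -coef_fpsD -coef_fpsB (series_phi_split g) -/g'; congr (_ n).
move: (fps_const _) (g ^+ q) (c ^+ q) (fpsX ^+ q) (series_phi g') (g' ^+ q).
by move=> a b d e h j; rewrite mulrBr opprB addrC !addrA; ring.
Qed.

Lemma series_phi_fil n (g : fps B) : (0 < n)%N ->
  (forall j, FB (n - j)%N (g j)) -> forall j, FB (n.+1 - j)%N (series_phi g j).
Proof.
move=> n_gt0 Fg j; rewrite /series_phi; case: ifP => dvd_qj; last exact: fil0.
have Fj := Fg (j %/ q)%N; have := q_gt1; have := divnK dvd_qj.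
set m := (j %/ q)%N in Fj *; move=> mE q1.
case: (posnP (n - m)%N) => [nm0|nm_gt0]; last first.
  by apply: filW (fphi_fil nm_gt0 Fj); nia.
by apply: (@filW _ _ _ 0%N); [nia | apply: fil_all].
Qed.

Lemma series_phi_cst a : series_phi (series_cst a) = series_cst a.
Proof.
apply: fpsP => n; rewrite /series_phi /series_cst /=; case: (posnP n) => [->|n_gt0].
  by rewrite dvdn0 div0n /= fphi_cst.
have -> : fps_const (fcst FB a) n = 0 by case: n n_gt0.
case: ifP => // dvd_qn; have : (0 < n %/ q)%N by rewrite divn_gt0 // dvdn_leq.
by case: (n %/ q)%N => //= m _; rewrite rmorph0.
Qed.

Definition series_frobenius : frobenius_ring O pi q (fps B).
Proof.
apply: (@FrobeniusRing k O pi q (fps B) (fps_fil FB) series_cst series_int series_phi).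
- exact: series_int_sub.
- by move=> a Oa; apply/series_int_const/fint_cst.
- move=> g Ig j; apply: fint_closed => n.
  have [h Ih /(_ j)] := Ig (n + j)%N; rewrite addnK => Fgh.
  by exists (h j).
- exact: series_phi_fil.
- exact: series_phi_cst.
- exact: series_phiP.
Defined.

End SeriesFrobenius.

Section FieldFrobenius.
Variables (k : fieldType) (O : k -> Prop) (pi : k) (q : nat).
Hypothesis O_sub : is_subring O.
Hypothesis fermat : forall x, O x -> divides_in O pi 1 (x - x ^+ q).

(** The identity lifts the q-th power map because the residue field has [q] elements, which is what
    [fermat] expresses. *)
Definition field_frobenius : frobenius_ring O pi q k.
Proof.
apply: (@FrobeniusRing k O pi q k (field_fil k) idfun O idfun) => //.
- by move=> x /(_ 1%N) [y Oy /(_ isT) /eqP]; rewrite subr_eq0 => /eqP ->.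
- by move=> n x n_gt0 x0 _; apply: x0.
Defined.

End FieldFrobenius.

Section FrobeniusRingTheory.
Variables (k : fieldType) (O : k -> Prop) (pi : k) (p f : nat).
Hypotheses (O_sub : is_subring O) (O_pi : O pi) (pi_neq0 : pi != 0).
Hypotheses (p_pr : prime p) (f_gt0 : (0 < f)%N).
Hypothesis O_p : divides_in O pi 1 p%:R.
Hypothesis fermat : forall x, O x -> divides_in O pi 1 (x - x ^+ (p ^ f)).
Local Notation q := (p ^ f)%N.
Local Notation k_frob := (field_frobenius O_sub fermat).
Local Notation k1_frob := (series_frobenius O_pi p_pr f_gt0 O_p k_frob).

Local Hint Extern 0 (is_subring _) => exact: fint_sub : core.

Section Generic.
Variables (A : comNzRingType) (F : frobenius_ring O pi q A).
Local Notation c := (fcst F).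
Local Notation int := (fint F).
Local Notation div := (divides_in (fint F) (fcst F pi)).
Local Notation sbs := (subst F (fcst F)).
Local Notation intS := (fint_sub F).
Implicit Types x y z : A.

Lemma int_cst_pi : int (c pi). Proof. exact: fint_cst. Qed.
Local Hint Resolve int_cst_pi : core.

Lemma cst_piK n x : c (pi ^- n) * (c pi ^+ n * x) = x.
Proof.
by rewrite mulrA -rmorphXn -rmorphM mulVf ?rmorph1 ?mul1r // expf_neq0.
Qed.

Lemma divP n x : div n x <-> int (c (pi ^- n) * x).
Proof.
split=> [[z Iz ->]|Ix]; first by rewrite cst_piK.
exists (c (pi ^- n) * x) => //.
by rewrite mulrA -rmorphXn -rmorphM divff ?rmorph1 ?mul1r // expf_neq0.
Qed.

Lemma div_p : div 1 p%:R.
Proof.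
have [z Oz pE] := O_p; exists (c z); first exact: fint_cst.
by rewrite -(rmorph_nat c) pE rmorphM rmorphXn.
Qed.

Lemma div_closed n x : (forall N, exists2 y, div n y & F N (x - y)) -> div n x.
Proof.
move=> dx; apply/divP/fint_closed => N; have [y dy Fxy] := dx N.
exists (c (pi ^- n) * y); first exact/divP.
by rewrite -mulrBr; apply: filMl.
Qed.

Lemma div_asum n (u : nat -> A) :
  (forall i, F i (u i)) -> (forall i, div n (u i)) -> div n (asum F u).
Proof.
move=> Fu du; apply: div_closed => N; exists (\sum_(i < N) u i); last exact: asumP.
by apply: div_bigsum.
Qed.

Lemma int_asum (u : nat -> A) :
  (forall i, F i (u i)) -> (forall i, int (u i)) -> int (asum F u).
Proof.
by move=> Fu Iu; apply: (div_in intS (w := c pi)) => //;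
  apply: (div_asum (n := 0)) => // i; apply: in_div.
Qed.

Lemma int_gcomp y (h : fps A) :
  F 1%N y -> int y -> (forall n, int (h n)) -> int (gcomp F y h).
Proof.
move=> Fy Iy Ih; rewrite /gcomp /gsub; case: asboolP => // _.
apply: int_asum => n; first exact/filMl/filX.
by apply: (sub_mul intS) => //; apply: sub_exp.
Qed.

Lemma int_subst y (g : fps k) :
  F 1%N y -> int y -> (forall n, O (g n)) -> int (sbs y g).
Proof. by move=> Fy Iy Og; apply: int_gcomp => // n; apply: fint_cst. Qed.

Lemma fphi_cont n x : F n x -> F n (fphi F x).
Proof.
by case: n => [_|n Fx]; [apply: fil_all | apply/filS/fphi_fil].
Qed.

Lemma fphi_subst y g : F 1%N y -> fphi F (sbs y g) = sbs (fphi F y) g.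
Proof.
by move=> Fy; apply: rmorph_subst => //; [apply: fphi_cont | apply: fphi_cst].
Qed.

Lemma subst_fil n y (g : fps k) : F 1%N y -> k1_frob n g -> F n (sbs y g).
Proof.
move=> Fy Fg; apply: gcomp_fil => // j; rewrite /fps_map.
case: (posnP (n - j)%N) => [->|/(Fg j) ->]; first exact: fil_all.
by rewrite rmorph0; apply: fil0.
Qed.

Lemma subst_fil1 y (g : fps k) : F 1%N y -> g 0%N = 0 -> F 1%N (sbs y g).
Proof.
move=> Fy g0; apply: gcomp_fil => // -[|j]; rewrite /fps_map; last exact: fil_all.
by rewrite g0 rmorph0; apply: fil0.
Qed.

Lemma subst_assoc y (g h : fps k) : F 1%N y -> g 0%N = 0 ->
  sbs (sbs y g) h = sbs y (subst k1_frob (fcst k1_frob) g h).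
Proof.
move=> Fy g0; symmetry; apply: (rmorph_subst (s := sbs y)).
- by move=> n x; apply: subst_fil.
- exact: subst_const.
- by case=> [|j] //=; rewrite subSS.
Qed.

(** The divided difference [(g(y) - g(z)) / (y - z)], written as a convergent sum since [y - z] need
    not be invertible. The formula also shows that it is integral when [g], [y] and [z] are. *)
Definition subst_quotient y z (g : fps k) : A :=
  asum F (fun m => c (g m.+1) * \sum_(i < m.+1) y ^+ (m - i) * z ^+ i).

Section Quotient.
Variables (y z : A) (g : fps k).
Hypotheses (Fy : F 1%N y) (Fz : F 1%N z).

Lemma subst_quotient_fil m :
  F m (c (g m.+1) * \sum_(i < m.+1) y ^+ (m - i) * z ^+ i).
Proof.
apply/filMl/fil_bigsum => i _.
have le_im : (i <= m)%N by rewrite -ltnS.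
by rewrite -{1}(subnK le_im); apply: filM; apply: filX.
Qed.

Lemma subst_quotientE : sbs y g - sbs z g = (y - z) * subst_quotient y z g.
Proof.
apply: (fil_eq (F := F)) => -[|N]; first exact: fil_all.
set s := \sum_(m < N) c (g m.+1) * \sum_(i < m.+1) y ^+ (m - i) * z ^+ i.
have e : (y - z) * s =
    \sum_(m < N.+1) c (g m) * y ^+ m - \sum_(m < N.+1) c (g m) * z ^+ m.
  rewrite -sumrB big_ord_recl !mulr1 subrr add0r mulr_sumr.
  by apply: eq_bigr => m _; rewrite -mulrBr subrXX mulrCA.
apply: (fil_trans (y := (y - z) * s)); last first.
  rewrite -mulrBr -add1n; apply: filM; first exact: filB.
  by apply: filC; apply: asumP; apply: subst_quotient_fil.
have := filB (substP c g N.+1 Fy) (substP c g N.+1 Fz); congr (F _ _).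
by rewrite e; ring.
Qed.

Lemma int_subst_quotient : int y -> int z -> (forall n, O (g n)) ->
  int (subst_quotient y z g).
Proof.
move=> Iy Iz Og; apply: int_asum; first exact: subst_quotient_fil.
move=> i; apply: (sub_mul intS); first exact: fint_cst.
by apply: sub_bigsum => // j _; apply: (sub_mul intS); apply: sub_exp.
Qed.

(** The divided difference is the linear coefficient [g 1] up to an element of step 1. This is the
    Newton step of all the successive approximations below. *)
Lemma subst_linear n : F n (y - z) ->
  F n.+1 (sbs y g - sbs z g - c (g 1%N) * (y - z)).
Proof.
move=> Fyz; rewrite subst_quotientE [c _ * _]mulrC -mulrBr -addn1.
apply: filM => //; have := asumP subst_quotient_fil 1.
by rewrite big_ord1 big_ord1 !mulr1.
Qed.

End Quotient.

Lemma int_phi x : int x -> int (fphi F x).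
Proof.
move=> Ix; rewrite -[fphi F x](subrK (x ^+ q)); apply: sub_add => //.
  by apply: div_in (fphiP Ix).
exact: sub_exp.
Qed.

End Generic.

Local Notation sbs F := (subst F (fcst F)).
Local Notation div F := (divides_in (fint F) (fcst F pi)).

(** * The functional equation lemma *)

Section FunctionalEquation.
Variable l : fps k.
Hypotheses (l0 : l 0%N = 0) (l1 : l 1%N = 1).
Hypothesis l_den : forall n, O (pi ^+ logn p n * l n).
Hypothesis l_q : forall n, (0 < n)%N -> l (q * n)%N = pi^-1 * l n.
Hypothesis l_int : forall n, ~~ (q %| n)%N -> O (l n).

(** In [l(X) - pi^-1 l(X^q)] the coefficients at multiples of [q] cancel by [l_q]; the others are
    integral by [l_int]. *)
Lemma l_functional : exists2 g : fps k, (forall n, O (g n)) &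
  g = l - fps_const pi^-1 * fphi k1_frob l.
Proof.
eexists; last reflexivity; move=> n.
rewrite coef_fpsB coef_fps_constM /= /series_phi /=.
case: ifP => [/dvdnP[m ->]|]; last by rewrite mulr0 subr0 => /negbT /l_int.
rewrite mulnK ?expn_gt0 ?prime_gt0 //; case: m => [|m].
  by rewrite mul0n l0 mulr0 subr0; apply: sub_zero.
by rewrite mulnC l_q // subrr; apply: sub_zero.
Qed.

Variables (A : comNzRingType) (F : frobenius_ring O pi q A).
Local Notation c := (fcst F).
Local Notation int := (fint F).
Local Notation intS := (fint_sub F).
Implicit Types x y z : A.

Lemma fpsX_fil_k1 : k1_frob 1%N fpsX.
Proof. exact: fpsX_fil. Qed.

Lemma phi_series y (g : fps k) : F 1%N y ->
  sbs F y (fphi k1_frob g) = sbs F (y ^+ q) g.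
Proof.
move=> Fy; have q_gt0 : (0 < q)%N by rewrite expn_gt0 prime_gt0.
have -> : fphi k1_frob g = sbs k1_frob (fpsX ^+ q) g.
  transitivity (fphi k1_frob (sbs k1_frob fpsX g)).
    congr (fphi k1_frob _); symmetry.
    apply: subst_eq; first exact: fpsX_fil_k1.
    move=> N j /=; case: (ltnP j N) => [lt_jN|le_Nj]; last first.
      by rewrite -subn_gt0 in le_Nj *; lia.
    move=> _; rewrite coef_fpsB coef_fps_sum (bigD1 (Ordinal lt_jN)) //=.
    rewrite [series_cst _ _]/series_cst /= coef_fps_constM coef_fpsXn eqxx mulr1.
    rewrite big1 ?addr0 ?subrr // => i; rewrite -val_eqE /= => /negbTE ij.
    by rewrite coef_fps_constM coef_fpsXn eq_sym ij mulr0.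
  rewrite fphi_subst; last exact: fpsX_fil_k1.
  congr (sbs k1_frob _ g); apply: fpsP => n; rewrite coef_fpsXn /= /series_phi /fpsX /=.
  case: ifP => [/dvdnP[m ->]|]; first rewrite mulnK // -{2}[q]mul1n eqn_pmul2r //.
  by case: eqP => // ->; rewrite dvdnn.
rewrite -subst_assoc //; last by rewrite coef_fpsXn ltn_eqF.
by rewrite rmorphXn /= substX.
Qed.

Lemma l_subst : exists2 g : fps k, (forall n, O (g n)) &
  forall y, F 1%N y -> sbs F y l = sbs F y g + c pi^-1 * sbs F (y ^+ q) l.
Proof.
have [g Og gE] := l_functional; exists g => // y Fy.
rewrite -phi_series // -(subst_const F c y) -rmorphM -rmorphD gE.
by rewrite subrK.
Qed.

(** The denominator of [l n] is at most [pi^(logn p n)], while [x^n - y^n] is divisible by [pi] to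
    that power plus one. *)
Lemma l_cong x y : F 1%N x -> F 1%N y -> int x -> int y ->
  div F 1 (x - y) -> div F 1 (sbs F x l - sbs F y l).
Proof.
move=> Fx Fy Ix Iy dxy.
have Fu z n : F 1%N z -> F n (c (l n) * z ^+ n) by move=> Fz; apply/filMl/filX.
have -> : sbs F x l - sbs F y l = asum F (fun n => c (l n) * (x ^+ n - y ^+ n)).
  symmetry; apply: asum_eq => N.
  have := filB (substP c l N Fx) (substP c l N Fy); congr (F N _).
  under [in RHS]eq_bigr do rewrite mulrBr.
  by rewrite sumrB; ring.
apply: div_asum => n; first by rewrite mulrBr; apply: filB; apply: Fu.
case: (posnP n) => [->|n_gt0]; first by rewrite subrr mulr0; apply: div_zero.
have [z Iz ->] := congX_logn intS (int_cst_pi F) p_pr (div_p F) n_gt0 Ix Iy dxy.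
exists (c (pi ^+ logn p n * l n) * z); first by apply: (sub_mul intS) => //; apply: fint_cst.
by rewrite rmorphM rmorphXn exprS; ring.
Qed.

(** If the integral element [y] approximates [z], then so does [y + w], one step
  further, and the functional equation shows that [w] is integral. *)
Lemma int_of_log h z : F 1%N h -> int (h - c pi^-1 * fphi F h) ->
  F 1%N z -> sbs F z l = h -> int z.
Proof.
move=> Fh Ih Fz lz; have [g Og gE] := l_subst.
suff key n : exists2 y, int y & F n.+1 (z - y).
  by apply: fint_closed => n; have [y Iy /filS] := key n; exists y.
elim: n => [|n [y Iy Fzy]]; first by exists 0; [apply: sub_zero | rewrite subr0].
have Fy : F 1%N y.
  by rewrite -[y](subKr z); apply: filB => //; apply: filW Fzy.
(* As [l(y) = g(y) + pi^-1 l(y^q)] and [fphi F h = l(phi z)], this [w] is the Newton correction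
   [h - l(y)] plus [pi^-1 (l(phi y) - l(phi z))], which is negligible because [phi] raises the
   filtration. In this form the last summand is integral by [l_cong]. *)
pose w := h - c pi^-1 * fphi F h - sbs F y g +
          c pi^-1 * (sbs F (fphi F y) l - sbs F (y ^+ q) l).
have Fphi t : F 1%N t -> F 1%N (fphi F t) by apply: fphi_cont.
have FXq t : F 1%N t -> F 1%N (t ^+ q).
  by move=> Ft; apply: (filW _ (filX _ Ft)); rewrite expn_gt0 prime_gt0.
have Iphi := int_phi Iy.
exists (y + w).
  apply: sub_add => //; apply: sub_add => //.
    by apply: (sub_sub intS) => //; apply: int_subst.
  rewrite -[pi^-1](congr1 GRing.inv (expr1 pi)); apply/divP/l_cong => //;
    try exact: Fphi; try exact: FXq.
    exact: sub_exp.
  exact: fphiP.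
have lin := subst_linear l Fz Fy Fzy; rewrite l1 rmorph1 mul1r in lin.
have Fphizy : F n.+2 (fphi F z - fphi F y).
  by rewrite -rmorphB; apply: fphi_fil.
have lin2 : F n.+2 (sbs F (fphi F z) l - sbs F (fphi F y) l).
  by rewrite subst_quotientE; [apply: filMr | apply: Fphi | apply: Fphi].
have phih : fphi F h = sbs F (fphi F z) l by rewrite -lz fphi_subst.
have := filB (filMl (c pi^-1) lin2) lin; congr (F _ _).
rewrite lz (gE y Fy) /w phih; ring.
Qed.

(** A converse of [l_cong], by successive approximation of [x - y] by multiples [e] of [pi]: the
    correction [d] is the difference of logarithms that [y + e] still leaves, itself a multiple of
    [pi] by [l_cong]. *)
Lemma cong_of_log x y : F 1%N x -> F 1%N y -> int x -> int y ->
  div F 1 (sbs F x l - sbs F y l) -> div F 1 (x - y).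
Proof.
move=> Fx Fy Ix Iy dl; have cpi := int_cst_pi F.
suff key n : exists2 e, div F 1 e & F n.+1 (x - y - e).
  by apply: div_closed => n; have [e de /filS] := key n; exists e.
elim: n => [|n [e de Fe]].
  by exists 0; [apply: div_zero | rewrite subr0; apply: filB].
have Fe1 : F 1%N e.
  rewrite -[e](subKr (x - y)); apply: filB; first exact: filB.
  exact: filW Fe.
have Fye : F 1%N (y + e) by apply: filD.
have Ie : int e by apply: div_in de.
pose d := (sbs F x l - sbs F y l) - (sbs F (y + e) l - sbs F y l).
exists (e + d).
  apply: div_add => //; apply: div_sub => //.
  by apply: l_cong => //; [apply: sub_add | rewrite addrC addKr].
have Fr : F n.+1 (x - (y + e)) by rewrite opprD addrA.
have := filN (subst_linear l Fx Fye Fr); rewrite l1 rmorph1 mul1r.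
congr (F _ _); rewrite /d; ring.
Qed.

End FunctionalEquation.
End FrobeniusRingTheory.

(** * Units, logarithmic derivatives and reciprocal polynomials *)

Section FieldSeries.
Variable K : fieldType.
Local Notation FK := (fps_fil (field_fil K)).

(** The unit ring structure on series lets [all_roots_prod_XsubC] split a polynomial over [fps kb]
    whose roots have invertible differences. *)
Definition fps_unit : {pred fps K} := fun g => g 0%N != 0.

Definition fps_inv (g : fps K) : fps K :=
  if g \in fps_unit then
    fps_const (g 0%N)^-1 * gcomp FK (1 - fps_const (g 0%N)^-1 * g) (fun=> 1)
  else g.

Lemma fps_mulVr : {in fps_unit, left_inverse 1 fps_inv *%R}.
Proof.
move=> g Ug; rewrite /fps_inv Ug; set x := 1 - _.
have Fx : FK 1%N x.
  case=> [|j] /=; last by rewrite subSS.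
  by rewrite /x coef_fpsB coef_fps_constM mulVf // subrr.
by rewrite mulrAC -[X in X * _](subKr 1) -/x geometric.
Qed.

Lemma fps_unitP (g h : fps K) : h * g = 1 -> g \in fps_unit.
Proof.
move=> /(congr1 (fun e : fps K => e 0%N)); rewrite coef_fpsM0 coef_fps1 /=.
by move=> hg; rewrite unfold_in; apply: contra_eq_neq hg => ->; rewrite mulr0 eq_sym oner_eq0.
Qed.

Lemma fps_inv_out : {in [predC fps_unit], fps_inv =1 id}.
Proof. by move=> g; rewrite inE /= /fps_inv => /negbTE ->. Qed.

HB.instance Definition _ := GRing.ComNzRing_hasMulInverse.Build (fps K)
  fps_mulVr fps_unitP fps_inv_out.

End FieldSeries.

Section LogarithmicDerivative.
Variable R : comNzRingType.
Implicit Types g h : fps R.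

Definition fps_theta g : fps R := fpsX * fps_deriv g.

Lemma coef_fps_theta g n : fps_theta g n = g n *+ n.
Proof. by rewrite /fps_theta coef_fpsXM; case: n. Qed.

Lemma fps_thetaM g h : fps_theta (g * h) = fps_theta g * h + g * fps_theta h.
Proof. by rewrite /fps_theta fps_derivM mulrDr !mulrA [g * fpsX]mulrC. Qed.

Definition power_series_of x : fps R := fun n => if n is 0%N then 0 else x ^+ n.

Lemma theta_linear x :
  (1 - fps_const x * fpsX) * power_series_of x = - fps_theta (1 - fps_const x * fpsX).
Proof.
apply: fpsP => n; rewrite coef_fpsN coef_fps_theta mulrBl mul1r !coef_fpsB.
rewrite -mulrA !coef_fps_constM coef_fpsXM coef_fps1 /fpsX.
case: n => [|[|n]] /=; first by rewrite mulr0 subr0 mulr0n oppr0.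
  by rewrite !mulr0 subr0 mulr1 sub0r mulr1n opprK expr1.
by rewrite mulr0 subr0 mul0rn oppr0 -exprS subrr.
Qed.

(** Newton's identities as a logarithmic derivative: [fps_theta] is a derivation, so a product
    becomes a sum. The denominator is multiplied out, which makes this valid over any commutative
    ring. *)
Lemma theta_prod (rs : seq R) :
  (\prod_(x <- rs) (1 - fps_const x * fpsX)) * (\sum_(x <- rs) power_series_of x) =
  - fps_theta (\prod_(x <- rs) (1 - fps_const x * fpsX)).
Proof.
elim: rs => [|x rs IH]; last first.
  rewrite !big_cons fps_thetaM; have := theta_linear x; move: IH.
  move: (\prod_(x <- rs) _) (\sum_(x <- rs) _) (1 - _) (power_series_of x) => B S A L.
  move=> IH thetaA; rewrite mulrDr mulrAC thetaA -mulrA IH.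
  by rewrite mulNr mulrN opprD.
rewrite !big_nil mulr0; apply: fpsP => n.
by rewrite coef_fpsN coef_fps_theta coef_fps1; case: n => [|n] /=; rewrite ?mul0rn ?mulr0n oppr0.
Qed.

Lemma reciprocal_prod (rs : seq R) n :
  (\prod_(x <- rs) (1 - fps_const x * fpsX) : fps R) n =
  if (n <= size rs)%N then (\prod_(x <- rs) ('X - x%:P))`_(size rs - n) else 0.
Proof.
elim: rs n => [|x rs IH] n.
  by rewrite !big_nil coef_fps1; case: n => [|n]; rewrite // coefC eqxx.
rewrite !big_cons mulrBl mul1r coef_fpsB -mulrA coef_fps_constM coef_fpsXM IH.
rewrite mulrBl coefB coefCM coefXM /=.
case: n => [|n] /=.
  rewrite subn0 mulr0 subr0 [X in _ = _ - _ * X](_ : _ = 0) ?mulr0 ?subr0 //.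
  by rewrite nth_default // size_prod_XsubC.
rewrite IH subSS !ltnS; case: (ltngtP n (size rs)) => [lt_n|gt_n|->].
- by rewrite subn_eq0 leqNgt lt_n /= subnS.
- by rewrite mulr0 subr0.
- by rewrite subnn /= sub0r.
Qed.

End LogarithmicDerivative.

(** * Additive valuations *)

Section Valuation.
Variables (R : realDomainType) (K : fieldType) (v : K -> \bar R).
Hypothesis v_val : is_valuation v.
Implicit Types x y : K.
Local Open Scope ereal_scope.

Lemma val_zero : v 0%R = +oo.
Proof. by have [/(_ 0%R) [_ ->]] := v_val. Qed.

Lemma val_fin x : x != 0%R -> exists r : R, v x = r%:E.
Proof.
move=> x0; have [vinf vNinf _ _] := v_val.
case vx: (v x) => [r| |]; [by exists r| |by case: (vNinf x)].
by move/vinf: vx => /eqP; rewrite (negbTE x0).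
Qed.

Lemma valM x y : v (x * y)%R = v x + v y.
Proof. by have [_ _ ->] := v_val. Qed.

Lemma val_one : v 1%R = 0.
Proof.
have [r rE] := val_fin (oner_neq0 K).
have := valM 1%R 1%R; rewrite mulr1 rE -EFinD => -[] /eqP.
by rewrite -subr_eq0 opprD addrA subrr sub0r oppr_eq0 => /eqP ->.
Qed.

Lemma valX_fin x n (r : R) : v x = r%:E -> v (x ^+ n)%R = (r *+ n)%:E.
Proof.
move=> vx; elim: n => [|n IH]; first by rewrite expr0 val_one mulr0n.
by rewrite exprS valM vx IH -EFinD mulrS.
Qed.

Lemma valN x : v (- x)%R = v x.
Proof.
suff vN1 : v (-1)%R = 0 by rewrite -mulN1r valM vN1 add0e.
have [r rE] : exists r : R, v (-1)%R = r%:E by apply: val_fin; rewrite oppr_eq0 oner_eq0.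
have := valM (-1)%R (-1)%R; rewrite mulrNN mulr1 val_one rE -EFinD => -[] /eqP.
by rewrite eq_sym -mulr2n mulrn_eq0 /= => /eqP ->.
Qed.

Lemma valD_ge (e : \bar R) x y : e <= v x -> e <= v y -> e <= v (x + y)%R.
Proof.
by move=> ex ey; have [_ _ _ /(_ x y)] := v_val; apply: le_trans; rewrite le_min ex.
Qed.

Lemma valB_ge (e : \bar R) x y : e <= v x -> e <= v y -> e <= v (x - y)%R.
Proof. by move=> ex ey; apply: valD_ge; rewrite ?valN. Qed.

Lemma val_sum_ge (e : \bar R) (I : Type) (r : seq I) (P : pred I) (F : I -> K) :
  (forall i, P i -> e <= v (F i)) -> e <= v (\sum_(i <- r | P i) F i)%R.
Proof.
by move=> eF; elim/big_ind: _ => // [|*]; [rewrite val_zero leey | apply: valD_ge].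
Qed.

Lemma valM_ge (a b : R) x y :
  a%:E <= v x -> b%:E <= v y -> (a + b)%:E <= v (x * y)%R.
Proof. by move=> ax ey; rewrite valM EFinD; apply: leeD. Qed.

Lemma valX_ge (a : R) x n : a%:E <= v x -> (a *+ n)%:E <= v (x ^+ n)%R.
Proof.
move=> ax; elim: n => [|n IH]; first by rewrite expr0 val_one mulr0n.
by rewrite exprS mulrS; apply: valM_ge.
Qed.

Lemma valV_fin x (r : R) : v x = r%:E -> v x^-1%R = (- r)%:E.
Proof.
move=> vx; have x0 : x != 0%R by apply: contra_eq_neq vx => ->; rewrite val_zero.
have [s sE] := val_fin (invr_neq0 x0).
have := valM x x^-1%R; rewrite divff // val_one vx sE -EFinD => -[] /eqP.
by rewrite eq_sym addrC addr_eq0 => /eqP ->.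
Qed.

End Valuation.

(** * Lubin--Tate formal groups *)

Local Opaque asum gcomp subst.

Section LubinTate.
Variables (k : fieldType) (O : k -> Prop) (pi : k) (p f : nat).
Hypotheses (O_sub : is_subring O) (O_pi : O pi) (pi_neq0 : pi != 0).
Hypotheses (p_pr : prime p) (f_gt0 : (0 < f)%N).
Hypothesis O_p : divides_in O pi 1 p%:R.
Hypothesis fermat : forall x, O x -> divides_in O pi 1 (x - x ^+ (p ^ f)).
Local Notation q := (p ^ f)%N.
Local Notation F0 := (field_frobenius O_sub fermat).
Local Notation F1 := (series_frobenius O_pi p_pr f_gt0 O_p F0).
Local Notation F2 := (series_frobenius O_pi p_pr f_gt0 O_p F1).
Local Notation sbs F := (subst F (fcst F)).
Local Notation div F := (divides_in (fint F) (fcst F pi)).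
Local Hint Extern 0 (is_subring _) => exact: fint_sub : core.

Variable l : fps k.
Hypotheses (l0 : l 0%N = 0) (l1 : l 1%N = 1).
Hypothesis l_den : forall n, O (pi ^+ logn p n * l n).
Hypothesis l_q : forall n, (0 < n)%N -> l (q * n)%N = pi^-1 * l n.
Hypothesis l_int : forall n, ~~ (q %| n)%N -> O (l n).

Lemma coef_ptruncX (R : comNzRingType) n (g : fps R) m i : (i <= n)%N ->
  (ptrunc n g ^+ m)`_i = (g ^+ m) i.
Proof.
move=> le_in; elim: m => [|m IH] in i le_in *.
  by rewrite !expr0 coef1 coef_fps1.
rewrite !exprS [RHS]coef_fpsM coefM; apply: eq_bigr => j _.
by rewrite coef_ptrunc ?IH //; have := ltn_ord j; lia.
Qed.

Lemma coef_cst1M a (g : fps k) n : (fcst F1 a * g) n = a * g n.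
Proof. exact: coef_fps_constM. Qed.

Lemma fil1_k1 (g : fps k) : g 0%N = 0 -> F1 1%N g.
Proof. by move=> g0 [|j] //=; rewrite subSS. Qed.

Lemma fil_k1 n (g : fps k) : F1 n g <-> forall j, (j < n)%N -> g j = 0.
Proof.
split=> Fg j; first by move=> lt_jn; apply: Fg; rewrite subn_gt0.
by rewrite /= subn_gt0; apply: Fg.
Qed.

(** Connects the composition by truncated polynomials with filtered substitution: [h^m] vanishes
    below degree [m], so the coefficient of degree [j] only sees the terms [m <= j]. *)
Lemma scompE (g h : fps k) : h 0%N = 0 -> scomp g h = sbs F1 h g :> fps k.
Proof.
move=> h0; symmetry; apply: subst_eq; first exact: fil1_k1.
move=> N; apply/fil_k1 => j lt_jN; rewrite coef_fpsB coef_fps_sum.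
rewrite /scomp coef_strunc_comp -(big_mkord xpredT (fun m => g m * (strunc j h ^+ m)`_j)).
rewrite -(big_mkord xpredT (fun m => (fcst F1 (g m) * h ^+ m) j)).
have tail : \sum_(j.+1 <= m < N) (fcst F1 (g m) * h ^+ m) j = 0.
  rewrite big_nat_cond big1 // => m /andP[/andP[lt_jm _] _].
  rewrite coef_cst1M.
  by have /fil_k1 -> := filX m (fil1_k1 h0); rewrite ?mulr0.
rewrite (@big_cat_nat _ _ _ j.+1 0 N) // [X in _ - (_ + X)]tail addr0 -sumrB big1 // => m _.
rewrite coef_cst1M.
by rewrite (@coef_ptruncX _ _ h) ?subrr.
Qed.

Local Notation mulpi := (group_mul l pi : fps k).
Local Notation linv := (sinv l : fps k).

Lemma linv0 : linv 0%N = 0. Proof. exact: sinv0. Qed.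

Lemma pil0 : (fps_const pi * l) 0%N = 0.
Proof. by rewrite coef_fpsM0 l0 mulr0. Qed.

Lemma mulpiE : mulpi = sbs F1 (fps_const pi * l) linv.
Proof.
rewrite -(scompE _ pil0); congr scomp; apply: fpsP => n.
by rewrite coef_fps_constM.
Qed.

Lemma mulpi0 : mulpi 0%N = 0.
Proof.
have /fil_k1 -> // : F1 1%N mulpi.
rewrite mulpiE; apply: subst_fil1 => //; last exact: linv0.
by apply: fil1_k1; apply: pil0.
Qed.

Section Generic.
Variables (A : comNzRingType) (F : frobenius_ring O pi q A).

Lemma subst_linv y : F 1%N y -> sbs F (sbs F y linv) l = y.
Proof.
move=> Fy; rewrite subst_assoc ?linv0 // -[RHS](substX (fcst F) Fy); congr (sbs F y _).
rewrite -scompE ?linv0 //; apply: fpsP => n; apply: scomp_sinv => //.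
by rewrite l1 oner_eq0.
Qed.

Lemma subst_linv_fil y : F 1%N y -> F 1%N (sbs F y linv).
Proof. by move=> Fy; apply: subst_fil1 => //; apply: linv0. Qed.

Lemma subst_mulpi y : F 1%N y -> sbs F y mulpi = sbs F (fcst F pi * sbs F y l) linv.
Proof.
move=> Fy; rewrite mulpiE -subst_assoc //; last exact: pil0.
by rewrite rmorphM /= subst_const.
Qed.

Lemma log_mulpi y : F 1%N y -> sbs F (sbs F y mulpi) l = fcst F pi * sbs F y l.
Proof.
by move=> Fy; rewrite subst_mulpi // subst_linv //; apply/filMl/subst_fil1.
Qed.

Lemma log_inj x y : F 1%N x -> F 1%N y -> sbs F x l = sbs F y l -> x = y.
Proof.
move=> Fx Fy lxy; apply: (fil_eq (F := F)); elim=> [|n IH]; first exact: fil_all.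
case: n IH => [_|n IH]; first exact: filB.
have := subst_linear l Fx Fy IH; rewrite lxy subrr sub0r l1 rmorph1 mul1r.
by move/filN; rewrite opprK.
Qed.

Lemma subst_at0 (g : fps k) : sbs F 0 g = fcst F (g 0%N).
Proof.
apply: subst_eq => [|[|N]]; [exact: fil0 | exact: fil_all|].
rewrite big_ord_recl expr0 mulr1 big1 ?addr0 ?subrr; first exact: fil0.
by move=> j _; rewrite expr0n mulr0.
Qed.

Lemma subst_zero (g : fps k) : g 0%N = 0 -> sbs F 0 g = 0.
Proof. by move=> g0; rewrite subst_at0 g0 rmorph0. Qed.

Lemma subst_split0 y (g : fps k) : F 1%N y ->
  sbs F y g = fcst F (g 0%N) + y * subst_quotient F y 0 g.
Proof.
move=> Fy; have := subst_quotientE g Fy (fil0 F 1); rewrite subr0 subst_at0 => <-.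
by rewrite addrC subrK.
Qed.

(** When [phi(y) = y^q], the expression is [g(y)] for the integral series [g] of [l_subst]. The
    variables [X] and [T] satisfy this condition. *)
Lemma int_log_functional y : F 1%N y -> fint F y -> fphi F y = y ^+ q ->
  fint F (sbs F y l - fcst F pi^-1 * fphi F (sbs F y l)).
Proof.
move=> Fy Iy phiy.
have [g Og gE] := l_subst O_sub O_pi pi_neq0 p_pr f_gt0 O_p fermat l0 l_q l_int F.
by rewrite fphi_subst // phiy gE // addrK; apply: int_subst.
Qed.

End Generic.

Lemma fphi_X1 : fphi F1 fpsX = fpsX ^+ q.
Proof.
apply: fpsP => n; rewrite coef_fpsXn /= /series_phi /fpsX /=.
case: ifP => [/dvdnP[m ->]|].
  have q_gt0 : (0 < q)%N by rewrite expn_gt0 prime_gt0.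
  by rewrite mulnK // -{2}[q]mul1n eqn_pmul2r.
by case: eqP => // ->; rewrite dvdnn.
Qed.

Lemma int_fpsX : fint F1 fpsX.
Proof. by move=> n; apply: sub_nat. Qed.

Lemma fpsX_fil1 : F1 1%N fpsX. Proof. exact: fpsX_fil. Qed.
Local Hint Resolve fpsX_fil1 int_fpsX : core.

Lemma subst_X1 (g : fps k) : sbs F1 fpsX g = g.
Proof.
apply: subst_eq => // N; apply/fil_k1 => j lt_jN.
rewrite coef_fpsB coef_fps_sum.
under eq_bigr do rewrite coef_cst1M coef_fpsXn.
rewrite (bigD1 (Ordinal lt_jN)) //= eqxx mulr1 big1 ?addr0 ?subrr // => i.
by rewrite -val_eqE /= eq_sym => /negbTE ->; rewrite mulr0.
Qed.

Lemma mulpi_fil : F1 1%N mulpi. Proof. exact/fil1_k1/mulpi0. Qed.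
Local Hint Resolve mulpi_fil : core.

Lemma log_mulpi1 : sbs F1 mulpi l = fcst F1 pi * l.
Proof. by rewrite -{1}[mulpi]subst_X1 log_mulpi // subst_X1. Qed.

Lemma int_mulpi : fint F1 mulpi.
Proof.
have Ipi := int_cst_pi O_pi F1.
apply: (int_of_log O_sub O_pi pi_neq0 p_pr f_gt0 O_p fermat l0 l1 l_den l_q l_int
  (h := fcst F1 pi * l)) => //; last exact: log_mulpi1.
  by apply/filMl/fil1_k1.
rewrite rmorphM fphi_cst mulrCA -mulrBr; apply: (sub_mul (fint_sub F1)) => //.
by rewrite -[l]subst_X1; apply: int_log_functional => //; apply: fphi_X1.
Qed.

(** The logarithms of the two sides are [pi l] and [l(X^q)], whose difference is [pi] times the
    integral series [l - pi^-1 l(X^q)]; [cong_of_log] then applies. *)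
Lemma mulpi_cong : div F1 1 (mulpi - fpsX ^+ q).
Proof.
have Ipi := int_cst_pi O_pi F1.
have q_gt0 : (0 < q)%N by rewrite expn_gt0 prime_gt0.
apply: (cong_of_log O_pi pi_neq0 p_pr O_p l1 l_den) => //.
- by apply: (filW q_gt0); apply: filX.
- exact: int_mulpi.
- exact: (sub_exp (fint_sub F1)).
exists (l - fcst F1 pi^-1 * fphi F1 l).
  by rewrite -[l]subst_X1; apply: int_log_functional => //; apply: fphi_X1.
rewrite log_mulpi1 -fphi_X1 -fphi_subst // subst_X1 expr1 mulrBr mulrA -rmorphM.
by rewrite divff // rmorph1 mul1r.
Qed.

(** * The formal group law as a series in two variables *)

Local Notation X2 := (fps_const fpsX : fps (fps k)).
Local Notation T2 := (fpsX : fps (fps k)).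

Lemma X2_fil : F2 1%N X2.
Proof. by apply: fps_const_fil; apply: fpsX_fil1. Qed.

Lemma T2_fil : F2 1%N T2. Proof. exact: fpsX_fil. Qed.
Local Hint Resolve X2_fil T2_fil : core.

Lemma int_X2 : fint F2 X2.
Proof. by move=> [|n]; [apply: int_fpsX | apply: sub_zero]. Qed.

Lemma int_T2 : fint F2 T2.
Proof. by move=> n; apply: (sub_nat (fint_sub F1)). Qed.
Local Hint Resolve int_X2 int_T2 : core.

Lemma fphi_X2 : fphi F2 X2 = X2 ^+ q.
Proof.
rewrite -rmorphXn -fphi_X1; apply: fpsP => -[|n].
  by rewrite /= /series_phi dvdn0 div0n.
rewrite [LHS]/= /series_phi; case: ifP => // dvd_qn.
have : (0 < n.+1 %/ q)%N by rewrite divn_gt0 ?expn_gt0 ?prime_gt0 // dvdn_leq.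
by case: (n.+1 %/ q)%N => // m _; rewrite [fps_const _ _]/= rmorph0.
Qed.

Lemma fphi_T2 : fphi F2 T2 = T2 ^+ q.
Proof.
apply: fpsP => n; rewrite coef_fpsXn [LHS]/= {1}/series_phi.
case: ifP => [/dvdnP[m ->]|].
  have q_gt0 : (0 < q)%N by rewrite expn_gt0 prime_gt0.
  have -> : (m * q == q)%N = (m == 1)%N by rewrite -{2}[q]mul1n eqn_pmul2r.
  by rewrite mulnK // [fpsX _]/fpsX rmorph_nat.
by case: eqP => // ->; rewrite dvdnn.
Qed.

Definition formal_group : fps (fps k) :=
  sbs F2 (sbs F2 X2 l + sbs F2 T2 l) linv.
Local Notation G2 := formal_group.

Lemma log_sum_fil : F2 1%N (sbs F2 X2 l + sbs F2 T2 l).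
Proof. by apply: filD; [exact: (subst_fil1 X2_fil l0) | exact: (subst_fil1 T2_fil l0)]. Qed.
Local Hint Resolve log_sum_fil : core.

Lemma formal_group_fil : F2 1%N G2.
Proof. exact: subst_linv_fil. Qed.
Local Hint Resolve formal_group_fil : core.

Lemma log_formal_group : sbs F2 G2 l = sbs F2 X2 l + sbs F2 T2 l.
Proof. exact: subst_linv. Qed.

Lemma int_formal_group : fint F2 G2.
Proof.
apply: (int_of_log O_sub O_pi pi_neq0 p_pr f_gt0 O_p fermat l0 l1 l_den l_q l_int
  (h := sbs F2 X2 l + sbs F2 T2 l)) => //; last exact: log_formal_group.
rewrite rmorphD mulrDr opprD addrACA; apply: (sub_add (fint_sub F2)).
  by apply: int_log_functional => //; apply: fphi_X2.
by apply: int_log_functional => //; apply: fphi_T2.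
Qed.

Local Notation const_coef := (@fps_coef0 k).

Lemma formal_groupX0 : fps_map const_coef G2 = fpsX.
Proof.
have s_fil n h : F2 n h -> F1 n (fps_map const_coef h).
  by move=> Fh; apply/fil_k1 => j lt_jn; apply: (Fh j 0%N); rewrite subn0 subn_gt0.
have s_subst h g : F2 1%N h ->
    fps_map const_coef (sbs F2 h g) = sbs F1 (fps_map const_coef h) g.
  move=> Fh; apply: (rmorph_subst (s := fps_map const_coef) s_fil _ g Fh) => a.
  by apply: fpsP => -[|n].
apply: (log_inj (s_fil _ _ formal_group_fil) fpsX_fil1).
rewrite -(s_subst _ l formal_group_fil) log_formal_group.
have eX := s_subst X2 l X2_fil; have eT := s_subst T2 l T2_fil.
move: (sbs F2 X2 l) (sbs F2 T2 l) eX eT => LX LT eX eT.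
rewrite rmorphD [X in X + _]eX [X in _ + X]eT.
have -> : fps_map const_coef X2 = 0 by apply: fpsP => -[|n].
have -> : fps_map const_coef T2 = fpsX by apply: fpsP => -[|[|n]].
rewrite (subst_zero F1 l0); exact: add0r.
Qed.

Lemma formal_groupT0 : formal_group 0%N = fpsX.
Proof.
have s_fil n h : F2 n h -> F1 n (fps_coef0 h) by move=> /(_ 0%N); rewrite subn0.
have s_subst h g : F2 1%N h -> fps_coef0 (sbs F2 h g) = sbs F1 (fps_coef0 h) g.
  by move=> Fh; apply: (rmorph_subst (s := @fps_coef0 (fps k)) s_fil _ g Fh).
apply: (log_inj (s_fil _ _ formal_group_fil) fpsX_fil1).
rewrite -(s_subst _ l formal_group_fil) log_formal_group.
have eX := s_subst X2 l X2_fil; have eT := s_subst T2 l T2_fil.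
move: (sbs F2 X2 l) (sbs F2 T2 l) eX eT => LX LT eX eT.
rewrite rmorphD [X in X + _]eX [X in _ + X]eT.
have -> : fps_coef0 T2 = 0 by [].
rewrite (subst_zero F1 l0); exact: addr0.
Qed.

Definition formal_group_quotient : fps (fps k) := fun n i => G2 n i.+1.

Lemma formal_group_split : G2 = T2 + X2 * formal_group_quotient.
Proof.
apply: fpsP => n; rewrite coef_fpsD coef_fps_constM; apply: fpsP => i.
rewrite coef_fpsD coef_fpsXM; case: i => [|i].
  have e : G2 n 0%N = fpsX n := congr1 (fun h : fps k => h n) formal_groupX0.
  by rewrite e addr0 /fpsX; case: eqP.
by rewrite /fpsX /formal_group_quotient; case: eqP => _; rewrite add0r.
Qed.

Section BivariateSubstitution.
Variables u y : fps (fps k).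
Hypotheses (Fu : F2 1%N u) (Fy : F2 1%N y).

Definition bisubst : fps (fps k) -> fps (fps k) :=
  gcomp F2 y \o fps_map (sbs F2 u).
HB.instance Definition _ :=
  GRing.RMorphism.copy bisubst (gcomp F2 y \o fps_map (sbs F2 u)).

Lemma bisubst_const (g : fps k) : bisubst (fps_const g) = sbs F2 u g.
Proof.
rewrite /bisubst /= -[RHS](gcomp_const F2 y); congr gcomp.
by apply: fpsP => -[|n]; rewrite /fps_map // [fps_const _ _]/= rmorph0.
Qed.

Lemma bisubstT : bisubst T2 = y.
Proof.
rewrite /bisubst /= -[RHS](gcompX Fy); congr gcomp.
by apply: fpsP => n; rewrite /fps_map /fpsX rmorph_nat.
Qed.

Lemma bisubst_fil n h : F2 n h -> F2 n (bisubst h).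
Proof. by move=> Fh; apply: (gcomp_fil Fy) => j; exact: (subst_fil Fu (Fh j)). Qed.

Lemma bisubst_subst h (g : fps k) : F2 1%N h ->
  bisubst (sbs F2 h g) = sbs F2 (bisubst h) g.
Proof.
move=> Fh; apply: (rmorph_subst (s := bisubst) bisubst_fil _ g Fh) => a.
rewrite [LHS]bisubst_const; exact: subst_const.
Qed.

Lemma int_bisubst h : fint F2 u -> fint F2 y -> fint F2 h -> fint F2 (bisubst h).
Proof.
move=> Iu Iy Ih; apply: (int_gcomp O_pi pi_neq0 Fy Iy) => n.
exact: (int_subst O_pi pi_neq0 Fu Iu (Ih n)).
Qed.

Lemma bisubstX : bisubst X2 = u.
Proof. by rewrite bisubst_const substX. Qed.

Lemma bisubst_formal_group :
  bisubst G2 = y + u * bisubst formal_group_quotient.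
Proof. by rewrite {1}formal_group_split rmorphD rmorphM /= bisubstT bisubstX. Qed.

Lemma log_bisubst : sbs F2 (bisubst G2) l = sbs F2 u l + sbs F2 y l.
Proof.
rewrite -(bisubst_subst l formal_group_fil) log_formal_group.
have eX := bisubst_subst l X2_fil; have eT := bisubst_subst l T2_fil.
rewrite bisubstX in eX; rewrite bisubstT in eT.
exact: etrans (rmorphD bisubst _ _) (congr2 +%R eX eT).
Qed.

End BivariateSubstitution.

(** [[pi]] is an endomorphism, so [[pi](F(X,T))] is [F([pi](X), [pi](T))], and [F(u,y) - y] is a
    multiple of [u]. Thus translation by [X] preserves [[pi](T)] modulo [[pi](X)], which vanishes
    once [X] is a torsion point. *)
Lemma mulpi_formal_group : exists2 h, fint F2 h &
  sbs F2 G2 mulpi = sbs F2 T2 mulpi + sbs F2 X2 mulpi * h.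
Proof.
have FU := subst_fil1 X2_fil mulpi0.
have FY := subst_fil1 T2_fil mulpi0.
have IU := int_subst O_pi pi_neq0 X2_fil int_X2 int_mulpi.
have IY := int_subst O_pi pi_neq0 T2_fil int_T2 int_mulpi.
have lU := log_mulpi X2_fil; have lY := log_mulpi T2_fil.
have lG := log_mulpi formal_group_fil; have FG := subst_fil1 formal_group_fil mulpi0.
move: (sbs F2 X2 mulpi) (sbs F2 T2 mulpi) FU FY IU IY lU lY => u y Fu Fy Iu Iy lu ly.
exists (bisubst u y formal_group_quotient).
  by apply: (int_bisubst Fu Fy Iu Iy) => n i; apply: int_formal_group.
rewrite -(bisubst_formal_group Fu Fy).
apply: (log_inj FG (bisubst_fil Fu Fy formal_group_fil)).
apply: etrans lG _; symmetry; apply: etrans (log_bisubst Fu Fy) _.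
apply: etrans (congr2 +%R lu ly) _.
by apply: etrans (esym (mulrDr _ _ _)) _; congr (_ * _); apply: esym log_formal_group.
Qed.

(** * Weierstrass division by the multiplication by [pi] *)

Hypothesis O_complete : forall x : nat -> k, (forall j, O (x j)) ->
  exists2 s, O s & forall J, divides_in O pi J (s - \sum_(j < J) pi ^+ j * x j).
Hypothesis O_separated : forall x, (forall J, divides_in O pi J x) -> x = 0.

Let q_gt0 : (0 < q)%N. Proof. by rewrite expn_gt0 prime_gt0. Qed.

Lemma subst_Xq (g : fps k) n :
  sbs F1 (fpsX ^+ q) g n = if (q %| n)%N then g (n %/ q)%N else 0.
Proof.
rewrite -(phi_series O_sub O_pi pi_neq0 p_pr f_gt0 O_p fermat g
  (fpsX_fil1)).
by rewrite subst_X1.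
Qed.

Lemma series_residues (g : fps k) :
  g = \sum_(i < q) sbs F1 (fpsX ^+ q) (fun n => g (n * q + i)%N) * fpsX ^+ i.
Proof.
apply: fpsP => n; rewrite coef_fps_sum.
have tE (i : nat) : (sbs F1 (fpsX ^+ q) (fun n => g (n * q + i)%N) * fpsX ^+ i) n =
    if (i <= n)%N && (q %| n - i)%N then g ((n - i) %/ q * q + i)%N else 0.
  apply: etrans (congr1 (fun h : fps k => h n) (mulrC _ _)) _.
  by rewrite coef_fpsXnM; case: leqP => //= _; apply: subst_Xq.
under eq_bigr do rewrite tE.
have sub_n : (n - n %% q)%N = (n %/ q * q)%N by rewrite {1}(divn_eq n q) addnK.
rewrite (bigD1 (Ordinal (ltn_pmod n q_gt0))) //= leq_mod sub_n dvdn_mull //=.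
rewrite mulnK ?q_gt0 // -divn_eq big1 ?addr0 // => i.
rewrite -val_eqE /= => neq_i; case: ifP => // /andP[le_in /dvdnP[m nE]].
by case/eqP: neq_i; rewrite -[n](subnK le_in) nE modnMDl modn_small.
Qed.

(** [mulpi] is congruent to [X^q], and for [X^q] in place of [mulpi] the series
  [g] is decomposed by sorting the exponents by their residues modulo [q]. *)
Lemma weierstrass_step (g : fps k) : fint F1 g ->
  exists e : nat -> fps k, exists2 r : fps k, fint F1 r &
    (forall i, fint F1 (e i)) /\
    g = \sum_(i < q) sbs F1 mulpi (e i) * fpsX ^+ i + fcst F1 pi * r.
Proof.
move=> Ig; pose e i : fps k := fun n => g (n * q + i)%N.
have Ie i : fint F1 (e i) by move=> n; apply: Ig.
have FX := fpsX_fil1.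
have IX := int_fpsX.
have Fg := mulpi_fil.
have Igp := int_mulpi.
have FXq : F1 1%N (fpsX ^+ q) by apply: (filW q_gt0); apply: filX.
have IXq : fint F1 (fpsX ^+ q) by apply: (sub_exp (fint_sub F1)).
have [d Id dE] := mulpi_cong.
exists e; exists (- \sum_(i < q) d * subst_quotient F1 mulpi (fpsX ^+ q) (e i) * fpsX ^+ i).
  apply: (sub_opp (fint_sub F1)); apply: (sub_bigsum (fint_sub F1)) => i _.
  apply: (sub_mul (fint_sub F1)); last exact: (sub_exp (fint_sub F1)).
  apply: (sub_mul (fint_sub F1)) => //.
  exact: (int_subst_quotient O_pi pi_neq0 Fg FXq Igp IXq (Ie i)).
split=> //; rewrite {1}(series_residues g) mulrN mulr_sumr -sumrB.
apply: eq_bigr => i _.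
have := subst_quotientE (e i) Fg FXq; rewrite dE expr1.
move: (sbs F1 mulpi _) (sbs F1 (fpsX ^+ q) _) (subst_quotient _ _ _ _) => a b h abh.
have -> : b = a - (a - b) by rewrite subKr.
by rewrite abh mulrBl !mulrA.
Qed.

(** Iterating the step produces [pi]-adic digits [E j i] of the quotients and a remainder divisible
    by [pi^J]. The digits are summed coefficientwise by [O_complete], and [O_separated] removes the
    remainder. *)
Lemma weierstrass_division (g : fps k) : fint F1 g ->
  exists2 e : nat -> fps k, (forall i, fint F1 (e i)) &
    g = \sum_(i < q) sbs F1 mulpi (e i) * fpsX ^+ i.
Proof.
pose P (h : fps k) (er : (nat -> fps k) * fps k) := fint F1 h ->
  [/\ fint F1 er.2, forall i, fint F1 (er.1 i) &
   h = \sum_(i < q) sbs F1 mulpi (er.1 i) * fpsX ^+ i + fcst F1 pi * er.2].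
have [ER ERP] : {ER & forall h, P h (ER h)}.
  apply: (@choice _ _ P) => h; case: (pselect (fint F1 h)) => [Ih|nIh]; last first.
    by exists (fun=> 0, 0) => /nIh.
  by have [e [r Ir [Ie hE]]] := weierstrass_step Ih; exists (e, r) => _; split.
move=> Ig; pose fs j := iter j (fun h => (ER h).2) g.
have Ifs j : fint F1 (fs j).
  by elim: j => //= j IH; have [] := ERP _ IH.
pose E j i : fps k := (ER (fs j)).1 i.
have IE j i : fint F1 (E j i) by have [_ + _] := ERP _ (Ifs j); apply.
have fsE j : fs j = \sum_(i < q) sbs F1 mulpi (E j i) * fpsX ^+ i + fcst F1 pi * fs j.+1.
  by have [] := ERP _ (Ifs j).
have /choice [e eP] (i : nat) : exists h : fps k, fint F1 h /\
    forall J, div F1 J (h - \sum_(j < J) fcst F1 pi ^+ j * E j i).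
  have /choice [h hP] (n : nat) : exists s, O s /\
      forall J, divides_in O pi J (s - \sum_(j < J) pi ^+ j * E j i n).
    by have [j|s Os sP] := O_complete (x := fun j => E j i n); [apply: IE | exists s].
  exists h; split=> [n|J]; first by case: (hP n).
  apply/series_div => n; have [_ /(_ J)] := hP n; congr (divides_in _ _ _ _).
  rewrite coef_fpsB coef_fps_sum; congr (_ - _); apply: eq_bigr => j _.
  by rewrite coef_series_cstXM.
exists e => [i|]; first by case: (eP i).
apply/eqP; rewrite -subr_eq0; apply/eqP.
suff dD J : div F1 J (g - \sum_(i < q) sbs F1 mulpi (e i) * fpsX ^+ i).
  by apply: fpsP => n; apply: O_separated => J; have /series_div /(_ n) := dD J.
have gE : g = \sum_(j < J) fcst F1 pi ^+ j *
    (\sum_(i < q) sbs F1 mulpi (E j i) * fpsX ^+ i) + fcst F1 pi ^+ J * fs J.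
  elim: J => [|J IH]; first by rewrite big_ord0 add0r expr0 mul1r.
  by rewrite big_ord_recr /= {1}IH {1}(fsE J) mulrDr addrA mulrA -exprSr.
have /choice [t tP] (i : nat) : exists t, fint F1 t /\
    e i = \sum_(j < J) fcst F1 pi ^+ j * E j i + fcst F1 pi ^+ J * t.
  by have [_ /(_ J) [t It tE]] := eP i; exists t; split=> //; rewrite -tE addrC subrK.
have Fg := mulpi_fil.
have Igp := int_mulpi.
have IX := int_fpsX.
have sE (i : nat) : sbs F1 mulpi (e i) =
    \sum_(j < J) fcst F1 pi ^+ j * sbs F1 mulpi (E j i) + fcst F1 pi ^+ J * sbs F1 mulpi (t i).
  have sc m : sbs F1 mulpi (fcst F1 pi ^+ m) = fcst F1 pi ^+ m.
    by rewrite -!rmorphXn; apply: subst_const.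
  have [_ ->] := tP i; rewrite rmorphD rmorph_sum; congr (_ + _).
    by apply: eq_bigr => j _; apply: etrans (rmorphM _ _ _) _; congr (_ * _); apply: sc.
  by apply: etrans (rmorphM _ _ _) _; congr (_ * _); apply: sc.
exists (fs J - \sum_(i < q) sbs F1 mulpi (t i) * fpsX ^+ i).
  apply: (sub_sub (fint_sub F1)) => //; apply: (sub_bigsum (fint_sub F1)) => i _.
  apply: (sub_mul (fint_sub F1)); last exact: (sub_exp (fint_sub F1)).
  by apply: (int_subst O_pi pi_neq0 Fg Igp); case: (tP i).
rewrite {1}gE mulrBr.
under [in LHS]eq_bigr do rewrite mulr_sumr.
rewrite exchange_big /= mulr_sumr [X in X - _]addrC -!addrA; congr (_ + _).
rewrite -!sumrB -sumrN; apply: eq_bigr => i _.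
rewrite sE mulrDl mulr_suml opprD addrA.
under [X in _ - X - _]eq_bigr do rewrite -mulrA.
by rewrite subrr sub0r mulrA.
Qed.

(** Let [[pi] = X^q + pi d]. Dividing [- d] by [[pi]] with quotients [e i] gives [X^q = [pi] + pi]
    times a combination of the [e i], so [b i] is [pi e i], plus [S] for [i = 0]. *)
Lemma weierstrass_preparation :
  exists2 b : nat -> fps k,
    forall i, div F1 1 (b i - (i == 0)%N%:R * fpsX) &
    fpsX ^+ q = \sum_(i < q) sbs F1 mulpi (b i) * fpsX ^+ i.
Proof.
have [d Id dE] := mulpi_cong.
have [e Ie eE] := weierstrass_division (sub_opp (fint_sub F1) Id).
have Fg := mulpi_fil.
exists (fun i => (i == 0)%N%:R * fpsX + fcst F1 pi * e i) => [i|].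
  by rewrite addrC addKr; exists (e i).
have XqE : fpsX ^+ q = mulpi - fcst F1 pi * d.
  by rewrite -[fcst F1 pi]expr1 -dE subKr.
rewrite XqE -mulrN eE mulr_sumr.
have sE (i : nat) : sbs F1 mulpi ((i == 0)%N%:R * fpsX + fcst F1 pi * e i) =
    (i == 0)%N%:R * mulpi + fcst F1 pi * sbs F1 mulpi (e i).
  rewrite rmorphD; congr (_ + _); apply: etrans (rmorphM _ _ _) _.
    by congr (_ * _); [apply: rmorph_nat | apply: (substX (fcst F1) Fg)].
  by congr (_ * _); apply: subst_const.
under [RHS]eq_bigr do rewrite sE mulrDl.
rewrite big_split /=; congr (_ + _); last by apply: eq_bigr => i _; rewrite mulrA.
rewrite (bigD1 (Ordinal q_gt0)) //= mul1r expr0 mulr1 big1 ?addr0 // => i.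
by rewrite -val_eqE /= => /negbTE ->; rewrite !mul0r.
Qed.

(** * Comparison with the truncated group law *)

Lemma subst_X2 (g : fps k) : sbs F2 X2 g = fps_const g.
Proof.
have h := @rmorph_subst _ _ _ F1 F2 (fcst F1) (fcst F2) (@fps_const (fps k)).
rewrite -(h (fun n x => @fps_const_fil _ F1 n x) (fun=> erefl) _ _ fpsX_fil1).
by rewrite subst_X1.
Qed.

Lemma subst_T2 (g : fps k) : sbs F2 T2 g = fps_map (@fps_const k) g.
Proof.
pose s := fps_map (@fps_const k).
have s_fil n x : F1 n x -> F2 n (s x).
  by move=> Fx j; apply: (@fps_const_fil _ F0); apply: Fx.
have s_c a : s (fcst F1 a) = fcst F2 a by apply: fpsP => -[|n] //; apply: rmorph0.
have sX : s fpsX = T2 by apply: fpsP => n; apply: rmorph_nat.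
rewrite -sX; apply: etrans (esym (rmorph_subst s_fil s_c g fpsX_fil1)) _.
by rewrite subst_X1.
Qed.

Lemma coef_biM_agree N (P Q : {poly {poly k}}) (g h : fps (fps k)) :
  (forall a b, (a + b <= N)%N -> P`_a`_b = g a b) ->
  (forall a b, (a + b <= N)%N -> Q`_a`_b = h a b) ->
  forall a b, (a + b <= N)%N -> (P * Q)`_a`_b = (g * h) a b.
Proof.
move=> Pg Qh a b le_abN; rewrite coefM coef_sum coef_fpsM coef_fps_sum.
apply: eq_bigr => i _; rewrite coefM coef_fpsM; apply: eq_bigr => j _.
by have := ltn_ord i; have := ltn_ord j; rewrite !ltnS => le_jb le_ia;
  rewrite Pg ?Qh //; lia.
Qed.

Lemma coef_biX_agree N (P : {poly {poly k}}) (g : fps (fps k)) m :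
  (forall a b, (a + b <= N)%N -> P`_a`_b = g a b) ->
  forall a b, (a + b <= N)%N -> (P ^+ m)`_a`_b = (g ^+ m) a b.
Proof.
move=> Pg; elim: m => [|m IH] a b le_abN; last first.
  by rewrite !exprS; apply: (coef_biM_agree (N := N)).
rewrite !expr0 coef1 coef_fps1; case: (a == 0)%N; last by rewrite coef0.
by rewrite [LHS]coef1 [RHS]coef_fps1.
Qed.

Lemma coef_fil2 N (h : fps (fps k)) : F2 N h ->
  forall a b, (a + b < N)%N -> h a b = 0.
Proof. by move=> Fh a b lt_abN; apply: (Fh a b); rewrite !subn_gt0 ltn_subRL. Qed.

(** The outer index of [formal_group] is the exponent of the second variable, hence the exchanged
    indices. Both sides depend only on the series up to total degree [i + n]. *)
Lemma formal_groupE n i : formal_group n i = group_law l i n.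
Proof.
rewrite /group_law; set N := (i + n)%N.
set Q := (X in _ \Po X).
have QE a b : (a + b <= N)%N -> Q`_a`_b = (fps_const l + fps_map (@fps_const k) l) a b.
  move=> le_abN; rewrite coefD coefC coef_map coef_fpsD coef_fpsD coefD coefC.
  rewrite [(strunc N l)`_a]coef_poly ltnS (leq_trans (leq_addr _ _) le_abN).
  congr (_ + _); last by case: b le_abN.
  case: a le_abN => [|a] le_abN; last by rewrite coef0.
  by rewrite coef_poly ltnS le_abN.
have -> : (map_poly polyC (strunc N linv) \Po Q)`_n`_i =
    \sum_(m < N.+1) linv m * (Q ^+ m)`_n`_i.
  rewrite /strunc poly_def rmorph_sum linear_sum coef_sum coef_sum.
  apply: eq_bigr => m _ /=.
  by rewrite map_polyZ map_polyXn comp_polyZ comp_Xn_poly coefZ coefCM.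
have := substP (fcst F2) linv N.+1 log_sum_fil.
move=> /coef_fil2 /(_ n i); rewrite ltnS addnC leqnn => /(_ isT) /eqP.
rewrite subr_eq0 => /eqP e; apply: etrans e _.
rewrite coef_fps_sum coef_fps_sum; apply: eq_bigr => m _.
have -> : (fcst F2 (linv m) * (sbs F2 X2 l + sbs F2 T2 l) ^+ m) n i =
    linv m * ((sbs F2 X2 l + sbs F2 T2 l) ^+ m) n i.
  apply: etrans (congr1 (fun h : fps k => h i) (coef_fps_constM _ _ _)) _.
  exact: coef_fps_constM.
rewrite subst_X2 subst_T2; congr (_ * _); symmetry.
by apply: (coef_biX_agree m QE); rewrite /N addnC.
Qed.

(** Substitute [F(X,T)] for [X] in the relation for [X^q]: by [mulpi_formal_group] and the divided
    difference of [b i], replacing [[pi](F(X,T))] by [[pi](T)] in the coefficients costs a multiple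
    of [[pi](X)]. *)
Lemma formal_group_root (b : nat -> fps k) : (forall i, fint F1 (b i)) ->
  fpsX ^+ q = \sum_(i < q) sbs F1 mulpi (b i) * fpsX ^+ i ->
  exists2 h, fint F2 h & formal_group ^+ q =
    \sum_(i < q) fps_map (@fps_const k) (sbs F1 mulpi (b i)) * formal_group ^+ i +
    fps_const mulpi * h.
Proof.
move=> Ib XqE; have [h Ih zE] := mulpi_formal_group.
have FG := formal_group_fil; have IG := int_formal_group.
have FZ := subst_fil1 FG mulpi0; have IZ := int_subst O_pi pi_neq0 FG IG int_mulpi.
have FY := subst_fil1 T2_fil mulpi0.
have IY := int_subst O_pi pi_neq0 T2_fil int_T2 int_mulpi.
have bE (i : nat) : sbs F2 formal_group (sbs F1 mulpi (b i)) =
    fps_map (@fps_const k) (sbs F1 mulpi (b i)) +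
    fps_const mulpi * (h * subst_quotient F2 (sbs F2 formal_group mulpi)
                                        (sbs F2 T2 mulpi) (b i)).
  apply: etrans (esym (subst_assoc O_sub O_pi p_pr f_gt0 O_p fermat (b i) FG mulpi0)) _.
  have e := etrans (subst_assoc O_sub O_pi p_pr f_gt0 O_p fermat (b i) T2_fil mulpi0)
                   (subst_T2 _).
  have /eqP := subst_quotientE (b i) FZ FY; rewrite subr_eq => /eqP dE.
  apply: etrans dE _; apply: etrans (addrC _ _) _; apply: (congr2 +%R e).
  apply: etrans _ (esym (mulrA _ _ _)); apply: (congr2 *%R _ erefl).
  by rewrite zE addrC addKr subst_X2.
exists (\sum_(i < q) h * subst_quotient F2 (sbs F2 formal_group mulpi)
            (sbs F2 T2 mulpi) (b i) * formal_group ^+ i).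
  apply: (sub_bigsum (fint_sub F2)) => i _.
  apply: (sub_mul (fint_sub F2)); last exact: (sub_exp (fint_sub F2)).
  apply: (sub_mul (fint_sub F2) Ih).
  exact: (int_subst_quotient O_pi pi_neq0 FZ FY IZ IY (Ib i)).
have XnE n : sbs F2 formal_group (fpsX ^+ n) = formal_group ^+ n.
  apply: etrans (rmorphXn (sbs F2 formal_group) n fpsX) _.
  exact: (congr1 (fun z => z ^+ n) (substX (fcst F2) FG)).
apply: etrans (esym (XnE q)) _; rewrite {1}XqE.
apply: etrans (rmorph_sum (sbs F2 formal_group) _ _ _) _.
rewrite mulr_sumr -big_split; apply: eq_bigr => i _.
apply: etrans (rmorphM (sbs F2 formal_group) _ _) _.
apply: etrans (congr2 *%R (bE i) (XnE i)) _.
by rewrite mulrDl !mulrA.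
Qed.

(** * Derivative of the logarithm and of the multiplication by [pi] *)

Lemma fps_deriv_fil n (g : fps k) : F1 n.+1 g -> F1 n (fps_deriv g).
Proof.
move=> /fil_k1 Fg; apply/fil_k1 => j lt_jn.
by rewrite /fps_deriv Fg ?mul0rn // ltnS.
Qed.

Lemma fps_deriv_subst (y g : fps k) : F1 1%N y ->
  fps_deriv (sbs F1 y g) = sbs F1 y (fps_deriv g) * fps_deriv y.
Proof.
move=> Fy; apply: (fil_eq (F := F1)) => N.
apply: (fil_trans (y := fps_deriv (\sum_(m < N.+1) fcst F1 (g m) * y ^+ m))).
  rewrite -raddfB; apply: fps_deriv_fil; exact: substP.
have dE : fps_deriv (\sum_(m < N.+1) fcst F1 (g m) * y ^+ m) =
    (\sum_(m < N) fcst F1 (fps_deriv g m) * y ^+ m) * fps_deriv y.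
  have tE m : fps_deriv (fcst F1 (g m) * y ^+ m) =
      fcst F1 (g m) * (y ^+ m.-1 * fps_deriv y *+ m).
    apply: etrans (fps_derivM _ _) _; rewrite -fps_deriv_exp.
    have -> : fps_deriv (fcst F1 (g m)) = 0 := fps_deriv_const _.
    by rewrite mul0r add0r.
  rewrite raddf_sum mulr_suml.
  transitivity (\sum_(m < N.+1) fcst F1 (g m) * (y ^+ m.-1 * fps_deriv y *+ m)).
    by apply: eq_bigr => m _; apply: tE.
  rewrite big_ord_recl mulr0n mulr0 add0r; apply: eq_bigr => m _.
  have -> : fcst F1 (fps_deriv g m) = fcst F1 (g m.+1) *+ m.+1 by apply: rmorphMn.
  by rewrite mulrnAl mulrnAr mulrnAl mulrA.
rewrite dE -mulrBl; apply: filMr; apply: filC; exact: substP.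
Qed.

Lemma p_logn_natmul n : divides_in O pi (logn p n) n%:R.
Proof.
have : divides_in O pi (logn p n) (p ^ logn p n)%:R.
  have [z Oz pE] := O_p; exists (z ^+ logn p n); first exact: (sub_exp O_sub).
  by rewrite natrX pE expr1 exprMn.
have := pfactor_dvdnn p n; move: (logn p n) => e /dvdnP [m ->] d.
rewrite mulnC natrM; apply: (div_mulr O_sub d); exact: (sub_nat O_sub).
Qed.

Lemma int_deriv_log : fint F1 (fps_deriv l).
Proof.
move=> n; rewrite /fps_deriv -mulr_natl.
have [z Oz ->] := p_logn_natmul n.+1; rewrite mulrAC.
by apply: (sub_mul O_sub) => //; apply: l_den.
Qed.

(** This is the derivative of [l([pi](X)) = pi l(X)]. Since [l'] is invertible among integral
    series, it prevents [[pi]'] from vanishing at torsion points. *)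
Lemma deriv_mulpi :
  sbs F1 mulpi (fps_deriv l) * fps_deriv mulpi = fcst F1 pi * fps_deriv l.
Proof.
rewrite -(fps_deriv_subst _ mulpi_fil) log_mulpi1; apply: etrans (fps_derivM _ _) _.
have -> : fps_deriv (fcst F1 pi) = 0 := fps_deriv_const _.
by rewrite mul0r add0r.
Qed.

Lemma int_inverse (g : fps k) : fint F1 g -> g 0%N != 0 -> O (g 0%N)^-1 ->
  exists2 h, fint F1 h & g * h = 1.
Proof.
move=> Ig g0 Og; pose x : fps k := 1 - fcst F1 (g 0%N)^-1 * g.
have Fx : F1 1%N x.
  by apply: fil1_k1; rewrite /x coef_fpsB coef_cst1M mulVf // subrr.
have Iinv : fint F1 (fcst F1 (g 0%N)^-1) by apply: (fint_cst F1).
have Ix : fint F1 x.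
  by apply: (sub_sub (fint_sub F1) (sub_one (fint_sub F1))); apply: (sub_mul (fint_sub F1)).
exists (fcst F1 (g 0%N)^-1 * gcomp F1 x (fun=> 1)).
  apply: (sub_mul (fint_sub F1) Iinv); apply: (int_gcomp O_pi pi_neq0 Fx Ix) => _.
  exact: (sub_one (fint_sub F1)).
have := geometric Fx; have -> : 1 - x = fcst F1 (g 0%N)^-1 * g by rewrite subKr.
by rewrite -mulrA mulrCA.
Qed.

Hypothesis O_unit : forall x, divides_in O pi 1 (x - 1) -> x != 0 /\ O x^-1.

Lemma subst0_coef (y g : fps k) : F1 1%N y -> sbs F1 y g 0%N = g 0%N.
Proof.
move=> Fy; have /fil_k1 /(_ 0%N isT) := substP (fcst F1) g 1 Fy.
rewrite big_ord1 expr0 mulr1 coef_fpsB => /eqP; rewrite subr_eq0 => /eqP ->.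
by [].
Qed.

(** * The distinguished polynomial of the multiplication by [pi] *)

Section Distinguished.
Variable b : nat -> fps k.
Hypothesis b_cong : forall i, div F1 1 (b i - (i == 0)%N%:R * fpsX).
Hypothesis b_root : fpsX ^+ q = \sum_(i < q) sbs F1 mulpi (b i) * fpsX ^+ i.

Lemma int_b i : fint F1 (b i).
Proof.
rewrite -[b i](subrK ((i == 0)%N%:R * fpsX)).
apply: (sub_add (fint_sub F1)).
  exact: (div_in (fint_sub F1) (int_cst_pi O_pi F1) (b_cong i)).
apply: (sub_mul (fint_sub F1) _ int_fpsX); exact: (sub_nat (fint_sub F1)).
Qed.

Lemma b_coef i n : divides_in O pi 1 (b i n - ((i == 0)%N && (n == 1)%N)%:R).
Proof.
have /series_div /(_ n) := b_cong i; rewrite coef_fpsB.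
suff -> : ((i == 0)%N%:R * fpsX : fps k) n = ((i == 0)%N && (n == 1)%N)%:R by [].
by case: (i == 0)%N; rewrite ?mul1r ?mul0r.
Qed.

(** Read off from [b_root] at [X = 0]. The congruence modulo [pi] would only give the constant term
    of [b 0] weight [q - 1], whereas the weight estimate asks for [q]. *)
Lemma b00 : b 0%N 0%N = 0.
Proof.
have : (fpsX ^+ q : fps k) 0%N = \sum_(i < q) (if i == 0%N :> nat then b i 0%N else 0).
  apply: etrans (congr1 (fun g : fps k => g 0%N) b_root) _.
  apply: etrans (coef_fps_sum _ _ _ _) _; apply: eq_bigr => i _.
  apply: etrans (coef_fpsM0 _ _) _; rewrite (subst0_coef _ mulpi_fil) coef_fpsXn eq_sym.
  by case: eqP => _; rewrite ?mulr1 ?mulr0.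
rewrite coef_fpsXn ltn_eqF ?q_gt0 // (bigD1 (Ordinal q_gt0)) //= big1 ?addr0 // => i.
by rewrite -val_eqE /= => /negbTE ->.
Qed.

Definition distinguished : {poly k} := 'X^q - \poly_(i < q) b i 0%N.
Definition poly_series (R : comNzRingType) (P : {poly R}) : fps R := fun n => P`_n.

Lemma size_distinguished : size distinguished = q.+1.
Proof.
by rewrite size_polyDl size_polyXn // size_polyN ltnS size_poly.
Qed.

Lemma distinguished_monic : distinguished \is monic.
Proof.
apply/monicP; rewrite lead_coefDl ?lead_coefXn //.
by rewrite size_polyXn size_polyN ltnS size_poly.
Qed.

Lemma distinguished_series : poly_series distinguished =
  fpsX ^+ q - \sum_(i < q) fcst F1 (b i 0%N) * fpsX ^+ i.
Proof.
apply: fpsP => n; rewrite coef_fpsB coef_fpsXn coef_fps_sum /poly_series.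
rewrite coefB coefXn coef_poly; congr (_ - _).
under eq_bigr do rewrite coef_cst1M coef_fpsXn.
case: ltnP => [lt_nq|le_qn].
  rewrite (bigD1 (Ordinal lt_nq)) //= eqxx mulr1 big1 ?addr0 // => i.
  by rewrite -val_eqE eq_sym /= => /negbTE ->; rewrite mulr0.
by rewrite big1 // => i _; rewrite gtn_eqF ?mulr0 // (leq_trans (ltn_ord i)).
Qed.

(** Each [b i ([pi](X)) - b i (0)] is a multiple of [[pi]]. The total cofactor [g] has constant term
    [b 0 1], congruent to 1 modulo [pi], and is therefore invertible among integral series. *)
Lemma distinguished_factor : exists g h : fps k, [/\ fint F1 g, fint F1 h,
  poly_series distinguished = mulpi * g, mulpi = poly_series distinguished * h & g * h = 1].
Proof.
have F_0 : F1 1%N 0 := fil0 F1 1.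
pose g : fps k := \sum_(i < q) subst_quotient F1 mulpi 0 (b i) * fpsX ^+ i.
have Ig : fint F1 g.
  apply: (sub_bigsum (fint_sub F1)) => i _.
  apply: (sub_mul (fint_sub F1)); last exact: (sub_exp (fint_sub F1) _ int_fpsX).
  apply: (int_subst_quotient O_pi pi_neq0 mulpi_fil F_0 int_mulpi _ (int_b i)).
  exact: (sub_zero (fint_sub F1)).
have PE : poly_series distinguished = mulpi * g.
  rewrite distinguished_series {1}b_root -sumrB mulr_sumr; apply: eq_bigr => i _.
  rewrite -mulrBl mulrA; congr (_ * _).
  by rewrite (subst_split0 (b i) mulpi_fil) addrC addKr.
have g0 : g 0%N = b 0%N 1%N.
  pose s i := subst_quotient F1 mulpi 0 (b i).
  have sE i : s i 0%N = b i 1%N.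
    have /fil_k1 /(_ 0%N isT) := asumP (subst_quotient_fil (b i) mulpi_fil F_0) 1.
    rewrite big_ord1 big_ord1 !expr0 !mulr1 coef_fpsB => /eqP; rewrite subr_eq0 => /eqP e.
    exact: e.
  transitivity (\sum_(i < q) (if i == 0%N :> nat then b i 1%N else 0)).
    apply: etrans (coef_fps_sum _ _ _ _) _; apply: eq_bigr => i _.
    apply: etrans (coef_fpsM0 _ _) _; rewrite -/(s i) sE coef_fpsXn eq_sym.
    by case: eqP => _; rewrite ?mulr1 ?mulr0.
  rewrite (bigD1 (Ordinal q_gt0)) //= big1 ?addr0 // => i.
  by rewrite -val_eqE /= => /negbTE ->.
have [g0_neq0 Og0] : g 0%N != 0 /\ O (g 0%N)^-1.
  by rewrite g0; apply: O_unit; have := b_coef 0 1.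
have [h Ih gh] := int_inverse Ig g0_neq0 Og0.
by exists g, h; split; rewrite // PE -mulrA gh mulr1.
Qed.

End Distinguished.

(** * Evaluation at torsion points *)

Section Evaluation.
Variables (kb : closedFieldType) (io : {rmorphism k -> kb}) (w : kb -> \bar rat).
Hypothesis w_val : is_valuation w.
Hypothesis w_int : forall x, O x -> (0 <= w (io x))%E.
Hypothesis w_pi : w (io pi) = 1%:E.

Lemma vcvg_unique (u : nat -> kb) x y : vcvg w u x -> vcvg w u y -> x = y.
Proof.
move=> ux uy; apply/eqP; rewrite -subr_eq0; apply/negPn/negP => xy_neq0.
have [r rE] := val_fin w_val xy_neq0.
have [nx hx] := ux (r + 1); have [ny hy] := uy (r + 1).
have := valB_ge w_val (hy _ (leq_maxr nx ny)) (hx _ (leq_maxl nx ny)).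
have -> : u (maxn nx ny) - y - (u (maxn nx ny) - x) = x - y by ring.
by rewrite rE lee_fin gerDl leNgt ltr01.
Qed.

Lemma vsum_eq (u : nat -> kb) x : vcvg w (fun n => \sum_(j < n) u j) x -> vsum w u = x.
Proof.
move=> ux; apply: (vcvg_unique _ ux).
exact: (@xgetPex _ 0 [set l | vcvg w (fun n => \sum_(j < n) u j) l] (ex_intro _ x ux)).
Qed.

Section AtPoint.
Variable a : kb.
Hypothesis w_a : (0 < w a)%E.

Definition partial_eval (g : fps k) (n : nat) : kb := \sum_(j < n) io (g j) * a ^+ j.
Definition evalto (g : fps k) (x : kb) : Prop := vcvg w (partial_eval g) x.

Lemma w_a_fin : exists2 r : rat, 0 < r & (r%:E <= w a)%E.
Proof.
by case wa: (w a) w_a => [r| |] // h; [exists r | exists 1; rewrite ?leey].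
Qed.

Lemma w_horner_ge0 (P : {poly kb}) : (forall j, (0 <= w P`_j)%E) -> (0 <= w P.[a])%E.
Proof.
move=> P0; rewrite horner_coef; apply: (val_sum_ge w_val) => j _.
rewrite -[0%E]/((0 + 0)%:E); apply: (valM_ge w_val) => //.
by rewrite -(mul0rn _ j); apply: (valX_ge w_val); apply: ltW.
Qed.

(** The rank [n0] serves all polynomials at once; [partial_evalM] relies on this, since its
    polynomial varies with [n]. *)
Lemma w_horner_tail (M : rat) : exists n0, forall (P : {poly kb}) n, (n0 <= n)%N ->
  (forall j, (0 <= w P`_j)%E) -> (forall j, (j < n)%N -> P`_j = 0) -> (M%:E <= w P.[a])%E.
Proof.
have [r r_gt0 ra] := w_a_fin.
exists (Num.trunc (M / r)).+1 => P n le_n P0 Pz.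
rewrite horner_coef; apply: (val_sum_ge w_val) => j _.
case: (ltnP j n) => [lt_jn|le_nj]; first by rewrite Pz // mul0r (val_zero w_val) leey.
apply: (le_trans (y := (0 + r *+ j)%:E)); last first.
  by apply: (valM_ge w_val) => //; apply: (valX_ge w_val).
rewrite lee_fin add0r; apply: (le_trans (y := (Num.trunc (M / r)).+1%:R * r)).
  by rewrite -ler_pdivrMr //; apply: ltW; apply: truncnS_gt.
rewrite mulrC -[r *+ j]mulr_natr ler_wpM2l ?ler_nat ?ltW //.
exact: leq_trans le_nj.
Qed.

Lemma partial_eval_horner g n : partial_eval g n = (\poly_(j < n) io (g j)).[a].
Proof. by rewrite horner_poly. Qed.

Lemma w_coef_int (g : fps k) n j : fint F1 g -> (0 <= w (\poly_(j < n) io (g j))`_j)%E.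
Proof.
move=> Ig; rewrite coef_poly; case: ifP => _; first exact/w_int/Ig.
by rewrite (val_zero w_val) leey.
Qed.

Lemma partial_eval_ge0 g n : fint F1 g -> (0 <= w (partial_eval g n))%E.
Proof.
by move=> Ig; rewrite partial_eval_horner; apply: w_horner_ge0 => j; apply: w_coef_int.
Qed.

Lemma partial_evalM (M : rat) : exists n0, forall g h n, (n0 <= n)%N ->
  fint F1 g -> fint F1 h ->
  (M%:E <= w (partial_eval (g * h) n - partial_eval g n * partial_eval h n)%R)%E.
Proof.
have [n0 n0P] := w_horner_tail M; exists n0 => g h n le_n Ig Ih.
rewrite !partial_eval_horner -hornerM -hornerN -hornerD; apply: n0P le_n _ _ => j.
  rewrite coefB; apply: (valB_ge w_val).
    exact/w_coef_int/(sub_mul (fint_sub F1)).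
  rewrite coefM; apply: (val_sum_ge w_val) => t _.
  by rewrite -[0%E]/((0 + 0)%:E); apply: (valM_ge w_val); apply: w_coef_int.
move=> lt_jn; rewrite coefB coef_poly lt_jn coefM coef_fpsM rmorph_sum -sumrB big1 // => t _.
have := ltn_ord t => lt_tj; rewrite !coef_poly (leq_ltn_trans _ lt_jn) //.
by rewrite (leq_ltn_trans (leq_subr _ _) lt_jn) rmorphM subrr.
Qed.

Lemma evaltoB g h x y : evalto g x -> evalto h y -> evalto (g - h) (x - y).
Proof.
move=> gx hy M; have [n1 P1] := gx M; have [n2 P2] := hy M.
exists (maxn n1 n2) => n; rewrite geq_max => /andP[le1 le2].
have := valB_ge w_val (P1 n le1) (P2 n le2); congr (_ <= w _)%E.
rewrite /partial_eval; under [in RHS]eq_bigr do rewrite coef_fpsB rmorphB mulrBl.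
by rewrite sumrB; ring.
Qed.

Lemma evalto_ge0 g x : fint F1 g -> evalto g x -> (0 <= w x)%E.
Proof.
move=> Ig gx; have [n /(_ n (leqnn n)) gxn] := gx 0.
by rewrite -[x](subKr (partial_eval g n)); apply: (valB_ge w_val) => //;
  apply: partial_eval_ge0.
Qed.

(** When [g] takes the value 0, boundedness of the partial sums of [h] is enough. This breaks a
    circle: [evalto_exists] treats a multiple of [[pi]] whose cofactor is not yet known to converge
    at [a]. *)
Lemma evaltoM_bound g h x y : fint F1 g -> fint F1 h -> evalto g x ->
  (x = 0 \/ evalto h y) -> evalto (g * h) (x * y).
Proof.
move=> Ig Ih gx hy M; have [n1 P1] := partial_evalM M; have [n2 P2] := gx M.
have [n3 P3] : exists n3, forall n, (n3 <= n)%N ->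
    (M%:E <= w (x * (partial_eval h n - y))%R)%E.
  case: hy => [->|hy].
    by exists 0%N => n _; rewrite mul0r (val_zero w_val) leey.
  have [n3 P3] := hy M; exists n3 => n le_n; rewrite -[M]add0r.
  by apply: (valM_ge w_val); [apply: evalto_ge0 gx | apply: P3].
exists (maxn n1 (maxn n2 n3)) => n; rewrite !geq_max => /and3P[le1 le2 le3].
have -> : partial_eval (g * h) n - x * y =
   (partial_eval (g * h) n - partial_eval g n * partial_eval h n) +
   ((partial_eval g n - x) * partial_eval h n + x * (partial_eval h n - y)) by ring.
apply: (valD_ge w_val); first exact: P1.
apply: (valD_ge w_val); last exact: P3.
rewrite -[M]addr0; apply: (valM_ge w_val); first exact: P2.
exact: partial_eval_ge0.
Qed.

Lemma evaltoM g h x y : fint F1 g -> fint F1 h -> evalto g x -> evalto h y ->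
  evalto (g * h) (x * y).
Proof. by move=> Ig Ih gx hy; apply: evaltoM_bound => //; right. Qed.

Lemma evaltoM0 g h : fint F1 g -> fint F1 h -> evalto g 0 -> evalto (g * h) 0.
Proof.
by move=> Ig Ih g0; rewrite -(mul0r 0); apply: evaltoM_bound => //; left.
Qed.

Lemma evalto_poly (P : {poly k}) : evalto (poly_series P) (map_poly io P).[a].
Proof.
move=> M; exists (size P) => n le_n.
rewrite (horner_coef_wide _ (leq_trans (size_poly _ _) le_n)).
rewrite /partial_eval -sumrB big1 ?(val_zero w_val) ?leey // => j _.
by rewrite coef_map subrr.
Qed.

Lemma poly_seriesC (c : k) : poly_series c%:P = fps_const c.
Proof. by apply: fpsP => n; rewrite /poly_series coefC; case: n. Qed.

Lemma poly_seriesX : poly_series 'X = fpsX :> fps k.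
Proof. by apply: fpsP => n; rewrite /poly_series coefX. Qed.

Section Torsion.
Hypothesis a_torsion : evalto mulpi 0.

(** Weierstrass division gives [g = r + [pi] h], where the polynomial [r] collects the constant
    terms of the quotients [e j]. At a torsion point the second term tends to 0, so the value is
    [r(a)]. *)
Lemma evalto_exists g : fint F1 g -> exists x, evalto g x.
Proof.
move=> Ig; have [e Ie gE] := weierstrass_division Ig.
have F_0 : F1 1%N 0 := fil0 F1 1.
pose r : {poly k} := \poly_(j < q) e j 0%N.
pose h : fps k := \sum_(j < q) subst_quotient F1 mulpi 0 (e j) * fpsX ^+ j.
have Ih : fint F1 h.
  apply: (sub_bigsum (fint_sub F1)) => j _.
  apply: (sub_mul (fint_sub F1)); last exact: (sub_exp (fint_sub F1) _ int_fpsX).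
  apply: (int_subst_quotient O_pi pi_neq0 mulpi_fil F_0 int_mulpi _ (Ie j)).
  exact: (sub_zero (fint_sub F1)).
exists ((map_poly io r).[a] - 0).
have -> : g = poly_series r - mulpi * (- h); last first.
  apply: evaltoB; first exact: evalto_poly.
  apply: evaltoM0 a_torsion; first exact: int_mulpi.
  exact: (sub_opp (fint_sub F1)).
rewrite mulrN opprK.
have -> : poly_series r = \sum_(j < q) fcst F1 (e j 0%N) * fpsX ^+ j.
  apply: fpsP => n; rewrite coef_fps_sum /poly_series coef_poly.
  under eq_bigr do rewrite coef_cst1M coef_fpsXn.
  case: ltnP => [lt_nq|le_qn].
    rewrite (bigD1 (Ordinal lt_nq)) //= eqxx mulr1 big1 ?addr0 // => j.
    by rewrite -val_eqE eq_sym /= => /negbTE ->; rewrite mulr0.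
  by rewrite big1 // => j _; rewrite gtn_eqF ?mulr0 // (leq_trans (ltn_ord j)).
rewrite mulr_sumr -big_split {1}gE; apply: eq_bigr => j _.
rewrite mulrA -[RHS]mulrDl; congr (_ * _); exact: (subst_split0 (e j) mulpi_fil).
Qed.

Definition eval (g : fps k) : kb := vsum w (fun j => io (g j) * a ^+ j).

Lemma evalP g : fint F1 g -> evalto g (eval g).
Proof. by move=> /evalto_exists [x gx]; rewrite /eval (vsum_eq gx). Qed.

Lemma eval_eq g x : evalto g x -> eval g = x.
Proof. by move=> gx; apply: vsum_eq. Qed.

Lemma eval_poly (P : {poly k}) : eval (poly_series P) = (map_poly io P).[a].
Proof. exact/eval_eq/evalto_poly. Qed.

Lemma eval_const c : eval (fps_const c) = io c.
Proof. by rewrite -poly_seriesC eval_poly map_polyC hornerC. Qed.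

Lemma eval_X : eval fpsX = a.
Proof. by rewrite -poly_seriesX eval_poly map_polyX hornerX. Qed.

Lemma eval_mulpi : eval mulpi = 0. Proof. exact: eval_eq. Qed.

Lemma evalM g h : fint F1 g -> fint F1 h -> eval (g * h) = eval g * eval h.
Proof. by move=> Ig Ih; apply: eval_eq; apply: evaltoM => //; apply: evalP. Qed.

Lemma evalB g h : fint F1 g -> fint F1 h -> eval (g - h) = eval g - eval h.
Proof. by move=> Ig Ih; apply: eval_eq; apply: evaltoB => //; apply: evalP. Qed.

Lemma eval0 : eval 0 = 0.
Proof. by rewrite -(rmorph0 (@fps_const k)) eval_const rmorph0. Qed.

Lemma evalD g h : fint F1 g -> fint F1 h -> eval (g + h) = eval g + eval h.
Proof.
move=> Ig Ih; have INh : fint F1 (- h) := sub_opp (fint_sub F1) Ih.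
have I_0 : fint F1 0 := sub_zero (fint_sub F1).
by rewrite -[h in LHS]opprK evalB // -sub0r evalB // eval0 sub0r opprK.
Qed.

Definition eval2 (h : fps (fps k)) : fps kb := fun n => eval (h n).

Lemma eval2D g h : fint F2 g -> fint F2 h -> eval2 (g + h) = eval2 g + eval2 h.
Proof. by move=> Ig Ih; apply: fpsP => n; apply: evalD; [apply: Ig | apply: Ih]. Qed.

Lemma eval_sum n (u : 'I_n -> fps k) : (forall j, fint F1 (u j)) ->
  eval (\sum_j u j) = \sum_j eval (u j).
Proof.
elim: n u => [|n IH] u Iu; first by rewrite !big_ord0 eval0.
rewrite !big_ord_recl evalD ?IH //.
exact: (sub_bigsum (fint_sub F1)).
Qed.

Lemma eval2M g h : fint F2 g -> fint F2 h -> eval2 (g * h) = eval2 g * eval2 h.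
Proof.
move=> Ig Ih; apply: fpsP => n; rewrite [RHS]coef_fpsM /eval2 coef_fpsM eval_sum.
  by apply: eq_bigr => j _; apply: evalM; [apply: Ig | apply: Ih].
by move=> j; apply: (sub_mul (fint_sub F1)); [apply: Ig | apply: Ih].
Qed.

Lemma eval2_const (g : fps k) : eval2 (fps_const g) = fps_const (eval g).
Proof. by apply: fpsP => -[|n] //; apply: eval0. Qed.

Lemma eval2_map (g : fps k) : eval2 (fps_map (@fps_const k) g) = fps_map io g.
Proof. by apply: fpsP => n; apply: eval_const. Qed.

End Torsion.
End AtPoint.

(** Over [k] the series [[pi]] has the compositional inverse [m = l^-1(pi^-1 l)]. *)
Lemma mulpi_inj (g h : fps k) : sbs F1 mulpi g = sbs F1 mulpi h -> g = h.
Proof.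
have Fl : F1 1%N l by apply: fil1_k1.
have lX : sbs F1 l linv = fpsX.
  apply: (log_inj (subst_linv_fil Fl) fpsX_fil1).
  by apply: etrans (subst_linv Fl) _; rewrite subst_X1.
have Fpl : F1 1%N (fcst F1 pi^-1 * l) := filMl _ Fl.
pose m := sbs F1 (fcst F1 pi^-1 * l) linv.
have Fm : F1 1%N m := subst_linv_fil Fpl.
have mulm : sbs F1 m mulpi = fpsX.
  apply: etrans (subst_mulpi Fm) _.
  apply: etrans (congr1 (fun z => sbs F1 (fcst F1 pi * z) linv) (subst_linv Fpl)) _.
  have -> : fcst F1 pi * (fcst F1 pi^-1 * l) = l; last exact: lX.
  by rewrite mulrA -rmorphM divff // rmorph1 mul1r.
have mK (e : fps k) : sbs F1 m (sbs F1 mulpi e) = e.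
  apply: etrans (esym (subst_assoc O_sub O_pi p_pr f_gt0 O_p fermat e Fm mulpi0)) _.
  by apply: etrans (congr1 (fun z => sbs F1 z e) mulm) _; apply: subst_X1.
by move=> gh; apply: etrans (esym (mK g)) _; rewrite gh; apply: mK.
Qed.

(** [T^n P(1 / T)] for the polynomial [P = X^n - \sum_(i < n) c_i X^i]. *)
Definition reciprocal (R : comNzRingType) (n : nat) (c : nat -> R) : fps R :=
  fun j => if j == 0%N then 1 else if (j <= n)%N then - c (n - j)%N else 0.

(** * Torsion points, their translates and power sums *)

Section Roots.
Variable b : nat -> fps k.
Hypothesis b_cong : forall i, div F1 1 (b i - (i == 0)%N%:R * fpsX).
Hypothesis b_root : fpsX ^+ q = \sum_(i < q) sbs F1 mulpi (b i) * fpsX ^+ i.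
Local Notation P0 := (map_poly io (distinguished b)).

(** The reciprocal polynomial has constant term 1, so its inverse, and with it the generating series
    of the power sums, is integral. *)
Lemma series_reciprocal : exists2 L : fps (fps k), fint F2 L &
  reciprocal q b * L = - fps_theta (reciprocal q b).
Proof.
have Ir : fint F2 (reciprocal q b).
  move=> j; rewrite /reciprocal; case: ifP => _; first exact: (sub_one (fint_sub F1)).
  case: ifP => _; last exact: (sub_zero (fint_sub F1)).
  exact: (sub_opp (fint_sub F1) (int_b b_cong _)).
pose x := 1 - reciprocal q b.
have Fx : F2 1%N x.
  case=> [|j]; last by rewrite subSS; apply: fil_all.
  have -> : x 0%N = 0 by apply: subrr.
  exact: (fil0 F1).
have Ix : fint F2 x := sub_sub (fint_sub F2) (sub_one (fint_sub F2)) Ir.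
exists (- fps_theta (reciprocal q b) * gcomp F2 x (fun=> 1)).
  apply: (sub_mul (fint_sub F2)); last first.
    apply: (int_gcomp O_pi pi_neq0 Fx Ix) => _; exact: (sub_one (fint_sub F2)).
  apply: (sub_opp (fint_sub F2)) => n; rewrite coef_fps_theta.
  exact: (sub_natmul (fint_sub F1) _ (Ir n)).
have := geometric Fx; rewrite /x subKr.
move: (reciprocal q b) (gcomp _ _ _) => r s rs.
by rewrite mulrCA rs mulr1.
Qed.

(** The lower coefficients are divisible by [pi]. If [w a = r <= 0], each term of the sum equal to
    [a^q] has valuation at least [1 + r j], hence at least [1 + r q], against [w (a^q) = r q]. *)
Lemma w_root a : root P0 a -> (0 < w a)%E.
Proof.
move=> /rootP; rewrite rmorphB /= map_polyXn hornerD hornerN hornerXn => /eqP.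
rewrite subr_eq0 => /eqP aE; rewrite ltNge; apply/negP => wa.
have a_neq0 : a != 0 by apply: contraTneq wa => ->; rewrite (val_zero w_val).
have [r rE] := val_fin w_val a_neq0; rewrite rE lee_fin in wa.
have := valX_fin w_val q rE.
have : ((1 + r *+ q)%:E <= w (a ^+ q))%E.
  rewrite aE horner_coef; apply: (val_sum_ge w_val) => j _.
  have lt_jq : (j < q)%N.
    apply: leq_trans (ltn_ord j) _; apply: leq_trans (size_poly _ _) _.
    exact: size_poly.
  apply: (le_trans (y := (1 + r *+ j)%:E)).
    rewrite lee_fin lerD2l -subr_ge0 -opprB oppr_ge0 -mulrnBr 1?ltnW //.
    by rewrite mulrn_wle0.
  rewrite coef_map coef_poly lt_jq; apply: (valM_ge w_val); last first.
    by apply: (valX_ge w_val); rewrite rE.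
  have [z Oz] := b_coef b_cong j 0; rewrite andbF subr0 => ->.
  rewrite [X in w X](_ : _ = io pi * io z); last exact: (rmorphM io pi z).
  rewrite -[1%:E]/((1 + 0)%:E); apply: (valM_ge w_val) => //.
    by rewrite w_pi.
  exact: w_int.
by move=> + e; rewrite e lee_fin -subr_ge0 opprD addrA addrAC subrr add0r oppr_ge0 leNgt ltr01.
Qed.

(** [[pi]] and the distinguished polynomial divide each other among integral series, so they vanish
    at the same points of the maximal ideal; by [w_root] all roots of the polynomial lie there. *)
Lemma torsionE : torsion io w mulpi = [set a | root P0 a].
Proof.
have [g [h [Ig Ih PE mE _]]] := distinguished_factor b_cong b_root.
rewrite predeqE => a; split=> [[wa a_tor]|ra].
  apply/rootP; rewrite -(eval_poly a) PE.
  by rewrite (evalM wa a_tor int_mulpi Ig) (eval_mulpi a_tor) mul0r.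
have wa := w_root ra; split=> //.
rewrite -/(evalto a mulpi 0) mE; apply: (evaltoM0 wa _ Ih).
  rewrite PE; exact: (sub_mul (fint_sub F1) int_mulpi Ig).
by rewrite -(rootP ra); apply: evalto_poly.
Qed.

Lemma deriv_poly_series (P : {poly k}) : fps_deriv (poly_series P) = poly_series P^`().
Proof. by apply: fpsP => n; rewrite /poly_series coef_deriv. Qed.

Lemma int_deriv (g : fps k) : fint F1 g -> fint F1 (fps_deriv g).
Proof. by move=> Ig n; apply: (sub_natmul O_sub); apply: Ig. Qed.

(** Write the polynomial as [[pi] g]. At a root its derivative is [[pi]'(a) g(a)]; the first factor
    is nonzero by [deriv_mulpi], the second because [g] is invertible. *)
Lemma separable_distinguished : separable_poly P0.
Proof.
have [g [h [Ig Ih PE mE gh]]] := distinguished_factor b_cong b_root.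
rewrite unlock; apply: Pdiv.ClosedField.root_coprimep => a ra.
have [wa a_tor] : torsion io w mulpi a by rewrite torsionE.
have Ig' := int_deriv Ig; have Iu := int_deriv int_mulpi.
rewrite deriv_map -(eval_poly a) -deriv_poly_series PE fps_derivM.
rewrite (evalD wa a_tor); [|exact: (sub_mul (fint_sub F1))|
  exact: (sub_mul (fint_sub F1) int_mulpi)].
rewrite (evalM wa a_tor Iu Ig) (evalM wa a_tor int_mulpi Ig') (eval_mulpi a_tor).
rewrite mul0r addr0 mulf_neq0 //.
  have [e Ie le] : exists2 e, fint F1 e & fps_deriv l * e = 1.
    have l1' : fps_deriv l 0%N = 1 by rewrite /fps_deriv l1.
    apply: int_inverse; [exact: int_deriv_log | by rewrite l1' oner_eq0 |].
    rewrite l1' invr1; exact: (sub_one O_sub).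
  have Il := int_deriv_log.
  have := congr1 (fun z => eval a (z * e)) deriv_mulpi; rewrite -!mulrA le mulr1.
  have -> : eval a (fcst F1 pi) = io pi := eval_const a pi.
  have Is : fint F1 (sbs F1 mulpi (fps_deriv l)).
    exact: (int_subst O_pi pi_neq0 mulpi_fil int_mulpi Il).
  rewrite (evalM wa a_tor Is); last exact: (sub_mul (fint_sub F1)).
  rewrite (evalM wa a_tor Iu Ie).
  by apply: contra_eq_neq => ->; rewrite mul0r mulr0 eq_sym fmorph_eq0.
have := eval_const a 1; rewrite rmorph1 rmorph1 -gh (evalM wa a_tor Ig Ih).
by apply: contra_eq_neq => ->; rewrite mul0r eq_sym oner_eq0.
Qed.

Lemma torsion_seq : exists rs : seq kb,
  [/\ uniq rs, size rs = q, torsion io w mulpi = [set` rs] & P0 = \prod_(a <- rs) ('X - a%:P)].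
Proof.
have [rs PE] := closed_field_poly_normal P0; exists rs.
have P0_monic : P0 \is monic by rewrite map_monic distinguished_monic.
rewrite (monicP P0_monic) scale1r in PE; split=> //.
- by rewrite -separable_prod_XsubC -PE separable_distinguished.
- have := size_prod_XsubC rs id; rewrite -PE size_map_poly size_distinguished.
  by case.
by rewrite torsionE predeqE => a /=; rewrite PE root_prod_XsubC.
Qed.

(** A series in [S] is read in [kb[[T]]] through [S = [pi](T)], where the translates by torsion
    points live. *)
Definition pull (g : fps k) : fps kb := fps_map io (sbs F1 mulpi g).

HB.instance Definition _ := GRing.RMorphism.copy pull (fps_map io \o sbs F1 mulpi).

Lemma pull_inj (g h : fps k) : pull g = pull h -> g = h.
Proof.
move=> gh; apply: mulpi_inj; apply: fpsP => n; apply: (fmorph_inj io).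
exact: (congr1 (fun e : fps kb => e n) gh).
Qed.

Definition translated (a : kb) : fps kb := eval2 a formal_group.

Lemma coef0_translated a : translated a 0%N = a.
Proof. by rewrite /translated /eval2 formal_groupT0; apply: eval_X. Qed.

Lemma eval2_expr a (h : fps (fps k)) n : (0 < w a)%E -> evalto a mulpi 0 ->
  fint F2 h -> eval2 a (h ^+ n) = eval2 a h ^+ n.
Proof.
move=> wa a_tor Ih; elim: n => [|n IH].
  rewrite !expr0; apply: etrans (eval2_const a (1 : fps k)) _.
  rewrite (_ : eval a 1 = 1) ?rmorph1 //.
  by have := eval_const a 1; rewrite !rmorph1.
rewrite !exprS -IH; apply: (eval2M wa a_tor Ih); exact: (sub_exp (fint_sub F2) _ Ih).
Qed.

Lemma eval2_sum a n (u : 'I_n -> fps (fps k)) : (0 < w a)%E -> evalto a mulpi 0 ->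
  (forall j, fint F2 (u j)) -> eval2 a (\sum_j u j) = \sum_j eval2 a (u j).
Proof.
move=> wa a_tor; elim: n u => [|n IH] u Iu.
  by rewrite !big_ord0; apply: fpsP => j; apply: eval0.
rewrite !big_ord_recl -(IH (fun j => u (lift ord0 j)) (fun j => Iu _)).
apply: (eval2D wa a_tor (Iu _)); exact: (sub_bigsum (fint_sub F2)).
Qed.

(** At [X = a] the multiple of [[pi](X)] in [formal_group_root] vanishes. *)
Lemma translated_root a : torsion io w mulpi a ->
  translated a ^+ q = \sum_(j < q) pull (b j) * translated a ^+ j.
Proof.
move=> [wa a_tor]; have [h Ih GE] := formal_group_root (int_b b_cong) b_root.
have IG := int_formal_group; have Im : fint F2 (fps_const mulpi).
  by move=> [|n]; [apply: int_mulpi | apply: (sub_zero (fint_sub F1))].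
have Imb j : fint F2 (fps_map (@fps_const k) (sbs F1 mulpi (b j))).
  have Isb := int_subst O_pi pi_neq0 mulpi_fil int_mulpi (int_b b_cong j).
  by move=> n [|m]; [apply: Isb | apply: (sub_zero O_sub)].
have It j := sub_mul (fint_sub F2) (Imb j) (sub_exp (fint_sub F2) j IG).
rewrite -(eval2_expr q wa a_tor IG) GE.
have Imh := sub_mul (fint_sub F2) Im Ih.
pose u (j : 'I_q) := fps_map (@fps_const k) (sbs F1 mulpi (b j)) * formal_group ^+ j.
have Iu j : fint F2 (u j) := It j.
have Isum : fint F2 (\sum_j u j) := sub_bigsum (fint_sub F2) _ (fun j _ => Iu j).
apply: etrans (eval2D wa a_tor Isum Imh) _.
have -> : eval2 a (fps_const mulpi * h) = 0.
  apply: etrans (eval2M wa a_tor Im Ih) _.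
  by rewrite eval2_const (eval_mulpi a_tor) rmorph0 mul0r.
rewrite addr0; apply: etrans (eval2_sum wa a_tor Iu) _.
apply: eq_bigr => j _.
apply: etrans (eval2M wa a_tor (Imb j) (sub_exp (fint_sub F2) j IG)) _.
by rewrite eval2_map (eval2_expr j wa a_tor IG).
Qed.

Definition pulled_poly : {poly fps kb} := 'X^q - \poly_(j < q) pull (b j).

(** Distinct torsion points have translates with distinct constant terms, since [F(a,0) = a]; the
    differences are then invertible series, and [q] such roots exhaust the polynomial. *)
Lemma pulled_poly_split (rs : seq kb) : uniq rs -> size rs = q ->
  torsion io w mulpi = [set` rs] ->
  pulled_poly = \prod_(x <- [seq translated a | a <- rs]) ('X - x%:P).
Proof.
move=> rs_uniq rs_size rsE.
have sz : size pulled_poly = q.+1.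
  by rewrite size_polyDl size_polyXn // size_polyN ltnS size_poly.
have lc : lead_coef pulled_poly = 1.
  by rewrite lead_coefDl ?lead_coefXn // size_polyXn size_polyN ltnS size_poly.
rewrite -[RHS]scale1r -lc; apply: all_roots_prod_XsubC.
- by rewrite sz size_map rs_size.
- apply/allP => _ /mapP[a a_rs ->]; apply/rootP.
  rewrite hornerD hornerN hornerXn horner_poly translated_root ?subrr //.
  by rewrite rsE.
elim: rs rs_uniq {rs_size rsE} => //= a rs IH /andP[a_rs rs_uniq].
rewrite IH // andbT; apply/allP => _ /mapP[c c_rs ->].
rewrite /diff_roots mulrC eqxx /=; change ((translated c - translated a) 0%N != 0).
rewrite coef_fpsB !coef0_translated subr_eq0.
by apply: contraNneq a_rs => <-.
Qed.

Lemma reciprocal_pull (rs : seq kb) : uniq rs -> size rs = q ->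
  torsion io w mulpi = [set` rs] ->
  fps_map pull (reciprocal q b) =
    \prod_(x <- [seq translated a | a <- rs]) (1 - fps_const x * fpsX).
Proof.
move=> rs_uniq rs_size rsE; apply: fpsP => n.
rewrite reciprocal_prod size_map rs_size -pulled_poly_split // /fps_map /reciprocal.
case: (posnP n) => [->|n_gt0].
  by rewrite leq0n subn0 coefB coefXn eqxx coef_poly ltnn subr0 rmorph1.
case: leqP => [le_nq|]; last by rewrite rmorph0.
rewrite coefB coefXn coef_poly.
have [-> ->] : (q - n == q)%N = false /\ (q - n < q)%N by split; lia.
by rewrite sub0r rmorphN.
Qed.

(** Both sides solve the same Newton identity, whose coefficient series is invertible. The index 0
    is excluded: there the power sum is [q], while [L 0] is 0. *)
Lemma power_sums (rs : seq kb) (L : fps (fps k)) : uniq rs -> size rs = q ->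
  torsion io w mulpi = [set` rs] ->
  reciprocal q b * L = - fps_theta (reciprocal q b) ->
  forall m, (0 < m)%N -> pull (L m) = \sum_(a <- rs) translated a ^+ m.
Proof.
move=> rs_uniq rs_size rsE LE m m_gt0.
pose xs := [seq translated a | a <- rs].
pose r := \prod_(x <- xs) (1 - fps_const x * fpsX).
have rE : fps_map pull (reciprocal q b) = r by apply: reciprocal_pull.
have rL : r * fps_map pull L = - fps_theta r.
  rewrite -rE -rmorphM LE rmorphN; congr (- _); apply: fpsP => n.
  rewrite [RHS]coef_fps_theta; apply: etrans (congr1 pull (coef_fps_theta _ _)) _.
  exact: rmorphMn.
have r_inv : exists s, r * s = 1.
  pose FB := fps_fil (fps_fil (field_fil kb)).
  exists (gcomp FB (1 - r) (fun=> 1)); have : FB 1%N (1 - r).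
    case=> [|n]; last by rewrite subSS; apply: fil_all.
    suff -> : (1 - r) 0%N = 0 by apply: fil0.
    rewrite -rE coef_fpsB; apply/eqP; rewrite subr_eq0 eq_sym; apply/eqP.
    exact: rmorph1.
  by move/geometric; rewrite subKr.
have [s rs1] := r_inv.
have LE' : fps_map pull L = \sum_(x <- xs) power_series_of x.
  have := theta_prod xs; rewrite -/r -rL => e.
  rewrite -[LHS]mul1r -[RHS]mul1r -rs1 ![r * s]mulrC -!mulrA; congr (_ * _).
  exact: esym e.
have := congr1 (fun e : fps (fps kb) => e m) LE'; rewrite coef_fps_sum big_map => e.
by apply: etrans e _; apply: eq_bigr => a _; case: m m_gt0.
Qed.

Lemma stranslate_monom (a : kb) m n :
  stranslate io w (group_law l) (smonom k m) a n = (translated a ^+ m) n.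
Proof.
have trE : translate io w (group_law l) a = translated a.
  apply: funext => j; rewrite /translate /translated /eval2 /eval; congr vsum.
  by apply: funext => t; rewrite formal_groupE.
rewrite /stranslate trE; apply: vsum_eq => M; exists m.+1 => t lt_mt.
rewrite (bigD1 (Ordinal lt_mt)) //= big1 ?addr0 => [|j]; last first.
  by rewrite -val_eqE /smonom /= => /negbTE ->; rewrite rmorph0 mul0r.
rewrite /smonom eqxx rmorph1 mul1r.
by rewrite [X in X - _](coef_ptruncX _ _ (leqnn n)) subrr (val_zero w_val) leey.
Qed.

(** The characterization of the trace is an equality of images under [pull], and [pull] is
    injective. *)
Lemma coleman_trace_monom (Tr : series k -> series k) (L : fps (fps k)) m :
  (forall n, io (scomp (Tr (smonom k m)) (group_mul l pi) n) =
     (io pi)^-1 * \sum_(a \in torsion io w mulpi)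
                     stranslate io w (group_law l) (smonom k m) a n) ->
  reciprocal q b * L = - fps_theta (reciprocal q b) ->
  (0 < m)%N -> forall n, Tr (smonom k m) n = pi^-1 * L m n.
Proof.
move=> TrE LE m_gt0 n; have [rs [rs_uniq rs_size rsE _]] := torsion_seq.
suff e : (Tr (smonom k m) : fps k) = fps_const pi^-1 * L m.
  by rewrite -coef_fps_constM -e.
apply: pull_inj; apply: fpsP => j.
have -> : pull (fps_const pi^-1 * L m) j = (io pi)^-1 * pull (L m) j.
  have pE : pull (fps_const pi^-1) = fps_const (io pi^-1).
    rewrite /pull; have -> : sbs F1 mulpi (fps_const pi^-1) = fps_const pi^-1.
      exact: subst_const.
    by apply: fpsP => -[|t] //; apply: rmorph0.
  apply: etrans (congr1 (fun g : fps kb => g j) (rmorphM pull _ _)) _.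
  apply: etrans (congr1 (fun z : fps kb => (z * pull (L m)) j) pE) _.
  by rewrite coef_fps_constM fmorphV.
rewrite (power_sums rs_uniq rs_size rsE LE m_gt0) coef_fps_sum.
rewrite {1}/pull /fps_map -(scompE _ mulpi0) TrE rsE -fsbig_seq //.
by congr (_ * _); apply: eq_bigr => a _; apply: stranslate_monom.
Qed.

End Roots.
End Evaluation.

(** * Divisibility of the power sums *)

Section Bounds.
Variable b : nat -> fps k.
Hypothesis b_cong : forall i, div F1 1 (b i - (i == 0)%N%:R * fpsX).
Hypothesis b_root : fpsX ^+ q = \sum_(i < q) sbs F1 mulpi (b i) * fpsX ^+ i.
Variable L : fps (fps k).
Hypothesis L_int : fint F2 L.
Hypothesis LE : reciprocal q b * L = - fps_theta (reciprocal q b).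
Local Notation rc := (reciprocal q b).

(** The least number of factors [pi], each of weight [q - 1], whose total weight reaches [x]. *)
Definition ceil_div (x : nat) : nat := ((x + q.-2) %/ q.-1)%N.

Lemma ceil_div_le x y : (x <= y)%N -> (ceil_div x <= ceil_div y)%N.
Proof. by move=> le_xy; apply: leq_div2r; rewrite leq_add2r. Qed.

Hypothesis q_gt2 : (2 < q)%N.

Lemma ceil_divD x y : (ceil_div (x + y) <= ceil_div x + ceil_div y)%N.
Proof.
rewrite /ceil_div; have q1 : (0 < q.-1)%N by lia.
rewrite -ltnS ltn_divLR //.
have := ltn_ceil (x + q.-2) q1; have := ltn_ceil (y + q.-2) q1.
move: ((x + q.-2) %/ q.-1)%N ((y + q.-2) %/ q.-1)%N => a c; nia.
Qed.

(** The monomials [pi^a X^n] of [g] satisfy [(q - 1) a + q n >= A]. *)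
Definition weight (A : nat) (g : fps k) : Prop :=
  forall n, divides_in O pi (ceil_div (A - q * n)) (g n).

Lemma weightM A B g h : weight A g -> weight B h -> weight (A + B) (g * h).
Proof.
move=> gA hB n; rewrite coef_fpsM; apply: (div_bigsum O_sub) => i _.
apply: (div_le O_sub O_pi) (div_mul O_sub (gA i) (hB (n - i)%N)).
apply: leq_trans (ceil_divD _ _); apply: ceil_div_le.
by have := ltn_ord i; nia.
Qed.

Lemma weightB A g h : weight A g -> weight A h -> weight A (g - h).
Proof. by move=> gA hA n; apply: (div_sub O_sub). Qed.

Lemma weight_sum A (I : Type) (r : seq I) (P : pred I) (u : I -> fps k) :
  (forall i, P i -> weight A (u i)) -> weight A (\sum_(i <- r | P i) u i).
Proof.
by move=> uA n; rewrite coef_fps_sum; apply: (div_bigsum O_sub) => i /uA.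
Qed.

(** For [0 < j < q] one factor [pi] has weight [q - 1 >= j]. For [j = q] the coefficient is [- b 0],
    where [b00] guarantees a factor [S], of weight [q]. *)
Lemma weight_reciprocal j : weight j (rc j).
Proof.
move=> n; rewrite /reciprocal; case: eqP => [->|/eqP j_neq0].
  rewrite sub0n [ceil_div 0](divn_small) ?add0n; last by lia.
  by apply: in_div; rewrite coef_fps1; apply: sub_nat.
case: leqP => [le_jq|_]; last exact: div_zero.
rewrite coef_fpsN; apply: (div_opp O_sub); have bn := b_coef b_cong (q - j) n.
case: (ltngtP j q) le_jq => // [lt_jq|->] _.
  have qj : (q - j == 0)%N = false by apply/eqP; lia.
  rewrite qj subr0 in bn; apply: (div_le O_sub O_pi) bn.
  apply: (leq_trans (ceil_div_le (leq_subr _ _))).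
  apply: (leq_trans (ceil_div_le (_ : j <= q.-1)%N)); first by lia.
  by rewrite /ceil_div divnDl ?dvdnn // divnn divn_small; lia.
rewrite subnn; case: n {bn} => [|n]; first by rewrite (b00 b_root); apply: div_zero.
have -> : (q - q * n.+1 = 0)%N by nia.
rewrite [ceil_div 0](divn_small) ?add0n; last by lia.
exact/in_div/(int_b b_cong).
Qed.

(** Newton's recursion expresses [L m] by [rc] and the earlier [L] without division, [rc] having
    constant term 1. *)
Lemma weight_bound m : weight m (L m).
Proof.
elim/ltn_ind: m => m IH.
have := congr1 (fun e : fps (fps k) => e m) LE.
rewrite coef_fpsN coef_fps_theta coef_fpsM big_ord_recl [rc ord0]/= mul1r subn0.
set s := \sum_(i < m) _ => e; rewrite -[L m](addrK s) e.
apply: weightB; last first.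
  apply: weight_sum => i _; have lt_im := ltn_ord i.
  rewrite -{1}(@subnKC (bump 0 i) m); last by rewrite /bump; lia.
  by apply: weightM; [apply: weight_reciprocal | apply: IH; rewrite /bump; lia].
move=> n; have rn := weight_reciprocal m n; rewrite coef_fpsN coef_fpsMn.
apply: (div_opp O_sub); rewrite -mulr_natr.
by apply: (div_mulr O_sub rn); apply: (sub_nat O_sub).
Qed.

(** * Witt coordinates and the ghost congruence *)

Definition witt_factor (d : nat) (y : fps k) : fps (fps k) := 1 - fps_const y * fpsX ^+ d.
Definition witt_inverse (d : nat) (y : fps k) : fps (fps k) :=
  fun n => if (d %| n)%N then y ^+ (n %/ d) else 0.
Definition witt_ghost (d : nat) (y : fps k) : fps (fps k) :=
  fun n => if (d %| n)%N && (0 < n)%N then y ^+ (n %/ d) *+ d else 0.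

Lemma witt_factorM d y (h : fps (fps k)) n :
  (witt_factor d y * h) n = h n - y * (if (d <= n)%N then h (n - d)%N else 0).
Proof.
by rewrite mulrBl mul1r coef_fpsB -mulrA coef_fps_constM coef_fpsXnM.
Qed.

Lemma witt_factorV d y : (0 < d)%N -> witt_factor d y * witt_inverse d y = 1.
Proof.
move=> d_gt0; apply: fpsP => n; rewrite witt_factorM coef_fps1 /witt_inverse.
case: leqP => [le_dn|lt_nd] /=.
  rewrite gtn_eqF; last by lia.
  rewrite dvdn_subl //; case: ifP => [dn|_]; last by rewrite mulr0 subrr.
  have [m ->] : exists m, n = (m + d)%N by exists (n - d)%N; rewrite subnK.
  by rewrite addnK divnDr // divnn d_gt0 addn1 -exprS subrr.
rewrite mulr0 subr0; case: (posnP n) => [->|n_gt0]; first by rewrite dvdn0 div0n expr0.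
by rewrite gtnNdvd.
Qed.

Lemma witt_ghostE d y : (0 < d)%N ->
  witt_factor d y * witt_ghost d y = - fps_theta (witt_factor d y).
Proof.
move=> d_gt0; apply: fpsP => n; rewrite witt_factorM coef_fpsN coef_fps_theta.
rewrite /witt_factor coef_fpsB coef_fps1 coef_fps_constM coef_fpsXn /witt_ghost.
case: (leqP d n) => [le_dn|lt_nd]; last first.
  rewrite (ltn_eqF lt_nd) /= ?mulr0n !mulr0 !subr0.
  case: (posnP n) => [->|n_gt0]; first by rewrite andbF oppr0.
  by rewrite gtnNdvd //= mul0rn oppr0.
have [m ->] : exists m, n = (m + d)%N by exists (n - d)%N; rewrite subnK.
rewrite addnK dvdn_addl // divnDr // divnn d_gt0 addn1 addn_gt0 d_gt0 orbT andbT.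
have -> : (m + d == d)%N = (m == 0)%N by rewrite -{2}[d]add0n eqn_add2r.
rewrite addn_eq0 (gtn_eqF d_gt0) andbF sub0r.
case: (posnP m) => [->|m_gt0].
  by rewrite dvdn0 div0n andbF mulr0 subr0 mulr1 expr1 add0n mulNrn opprK.
rewrite andbT mulr0 oppr0 mul0rn oppr0; case: ifP => _; last by rewrite mulr0 subrr.
by rewrite mulrnAr -exprS subrr.
Qed.

Lemma theta_witt_inverse d y : (0 < d)%N ->
  fps_theta (witt_inverse d y) = witt_inverse d y * witt_ghost d y.
Proof.
move=> d_gt0; have gE := witt_ghostE y d_gt0; have sE := witt_factorV y d_gt0.
have : fps_theta (witt_factor d y * witt_inverse d y) = 0.
  rewrite sE; apply: fpsP => n; rewrite coef_fps_theta coef_fps1.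
  by case: n => [|n] /=; rewrite ?mulr0n // mul0rn.
rewrite fps_thetaM -[fps_theta (witt_factor d y)]opprK -gE.
move: (witt_factor d y) (witt_inverse d y) (witt_ghost d y) (fps_theta _) sE {gE}.
move=> a s g t as1 /eqP; rewrite mulNr addrC subr_eq0 => /eqP e.
rewrite -[t]mul1r -as1 mulrAC e.
by rewrite (_ : a * g * s * s = a * s * (s * g)); [rewrite as1 mul1r | ring].
Qed.

Lemma int_witt_inverse d y : fint F1 y -> fint F2 (witt_inverse d y).
Proof.
move=> Iy n; rewrite /witt_inverse; case: ifP => _; last exact: (sub_zero (fint_sub F1)).
exact: (sub_exp (fint_sub F1) _ Iy).
Qed.

(** The ghost components of the Witt vector [(y_1, y_2, ...)] with
  [Q = \prod_d (1 - y_d T^d)]. *)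
Lemma witt_coordinates N : exists2 y : nat -> fps k, (forall d, fint F1 (y d)) &
  forall m, (0 < m <= N)%N ->
    L m = \sum_(1 <= d < N.+1 | (d %| m)%N) y d ^+ (m %/ d) *+ d.
Proof.
(* [R] is what remains of the reciprocal polynomial after division by the first [N] factors, hence 1
   up to degree [N], and [M] is minus its logarithmic derivative. *)
suff [y [R [M [Iy IR R0 [Rj RM LM]]]]] : exists y : nat -> fps k, exists R M : fps (fps k),
    [/\ forall d, fint F1 (y d), fint F2 R, R 0%N = 1 &
     [/\ forall j, (0 < j <= N)%N -> R j = 0, R * M = - fps_theta R &
      forall m, (0 < m)%N -> L m =
        \sum_(1 <= d < N.+1 | (d %| m)%N) y d ^+ (m %/ d) *+ d + M m]].
  exists y => // m mN; rewrite LM; last by case/andP: mN.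
  suff -> : M m = 0 by rewrite addr0.
  have := congr1 (fun e : fps (fps k) => e m) RM.
  rewrite coef_fpsN coef_fps_theta (Rj m mN) mul0rn oppr0 coef_fpsM big_ord_recl R0 mul1r.
  rewrite subn0 big1 ?addr0 // => i _; rewrite Rj ?mul0r //.
  by have := ltn_ord i; rewrite lift0; lia.
elim: N => [|N [y [R [M [Iy IR R0 [Rj RM LM]]]]]].
  exists (fun=> 0), rc, L; split=> [d||//|]; first exact: (sub_zero (fint_sub F1)).
    move=> j; rewrite /reciprocal; case: ifP => _; first exact: (sub_one (fint_sub F1)).
    case: ifP => _; last exact: (sub_zero (fint_sub F1)).
    exact: (sub_opp (fint_sub F1) (int_b b_cong _)).
  split=> // [j|m _]; first by lia.
  by rewrite big_geq // add0r.
(* Dividing by [1 - z T^N.+1] adds [z] to the coefficient of degree [N.+1], which determines the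
   next coordinate. *)
have [z Iz zE] : exists2 z, fint F1 z & R N.+1 + z = 0.
  by exists (- R N.+1); [exact: (sub_opp (fint_sub F1) (IR _)) | exact: subrr].
pose s := witt_inverse N.+1 z; pose g := witt_ghost N.+1 z.
have R'E j : (R * s) j = R j + (if (N.+1 <= j)%N then z * (R * s) (j - N.+1)%N else 0).
  have := congr1 (fun e => (R * e) j) (witt_factorV z (ltn0Sn N)).
  rewrite /= mulr1 => <-; rewrite mulrCA witt_factorM -/s.
  by case: leqP => _; rewrite ?mulr0 ?subr0 ?addr0 // subrK.
have R'0 : (R * s) 0%N = 1 by rewrite R'E /= addr0.
exists (fun d => if d == N.+1 then z else y d), (R * s), (M - g); split.
- by move=> d; case: eqP => _; [exact: Iz | exact: Iy].
- exact: (sub_mul (fint_sub F2) IR (int_witt_inverse _ Iz)).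
- exact: R'0.
split.
- move=> j /andP[j_gt0 le_jN]; rewrite R'E; move: le_jN.
  rewrite leq_eqVlt => /orP[/eqP ->|lt_jN]; last by rewrite ltnNge -ltnS lt_jN addr0 Rj ?j_gt0.
  by rewrite leqnn subnn R'0 mulr1 zE.
- rewrite fps_thetaM theta_witt_inverse // -/s -/g mulrBr mulrAC RM.
  by rewrite mulNr opprD mulrA.
move=> m m_gt0; rewrite LM // big_mkcond [in RHS]big_mkcond [in RHS]big_nat_recr //=.
rewrite eqxx coef_fpsB /g /witt_ghost m_gt0 andbT -addrA.
apply: (congr2 +%R); last by rewrite addrC subrK.
by apply: eq_big_nat => d /andP[_ lt_dN]; have -> : (d == N.+1) = false by lia.
Qed.

(** Every [d] contributes at least [logn p m - f + 1] factors [pi], and [logn p m %/ f] is no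
    larger. If [d] divides [m / q = h d], then [y_d^q] and [phi(y_d)] agree modulo [pi], the h-th
    power adds [logn p h] and the factor [d] adds [logn p d]. If [d] divides only [m], then
    [logn p (m / d) < f], so the factor [d] suffices alone. *)
Lemma ghost_congruence m : (0 < m)%N -> (q %| m)%N ->
  div F1 (logn p m %/ f) (L m - fphi F1 (L (m %/ q)%N)).
Proof.
move=> m_gt0 qm; have [y Iy yE] := witt_coordinates m.
have mq_gt0 : (0 < m %/ q)%N by rewrite divn_gt0 ?q_gt0 // dvdn_leq.
rewrite (yE m) ?m_gt0 ?leqnn // (yE (m %/ q)%N) ?mq_gt0 ?leq_div //.
rewrite rmorph_sum big_mkcond [X in _ - X]big_mkcond -sumrB.
have Ipi := int_cst_pi O_pi F1; have S := fint_sub F1.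
have dnat d : div F1 (logn p d) (d%:R : fps k).
  have [u Ou dE] := p_logn_natmul d; exists (fcst F1 u); first exact: (fint_cst F1).
  by rewrite -(rmorph_nat (fcst F1)) dE rmorphM rmorphXn.
have lm : logn p m = (f + logn p (m %/ q))%N.
  by rewrite -{1}(divnK qm) lognM ?q_gt0 // pfactorK // addnC.
have f0 : (0 < f)%N by [].
rewrite big_nat_cond; apply: (div_bigsum S) => d /andP[/andP[d_gt0 _] _].
case: ifP => [dm|ndm]; last first.
  case: ifP => [dmq|_]; last by rewrite subrr; apply: (div_zero S).
  by rewrite (dvdn_trans dmq) // dvdn_div in ndm.
case: ifP => [dmq|ndmq].
  have [h hE] : exists h, (m %/ q = h * d)%N by apply/dvdnP.
  have mE : m = (h * q * d)%N by rewrite -(divnK qm) hE mulnAC.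
  have h_gt0 : (0 < h)%N by move: mq_gt0; rewrite hE; case: h {hE mE}.
  rewrite rmorphMn rmorphXn hE mulnK // mE mulnK // -mE -mulrnBl -mulr_natr.
  have yq : div F1 1 (y d ^+ q - fphi F1 (y d)).
    by apply: (div_sym S); apply: (fphiP (Iy d)).
  have Iyq : fint F1 (y d ^+ q) := sub_exp S _ (Iy d).
  have := congX_logn S Ipi p_pr (div_p O_p F1) h_gt0 Iyq (int_phi O_pi (Iy d)) yq.
  rewrite -exprM [(q * h)%N]mulnC => dh.
  apply: (div_le S Ipi) (div_mul S dh (dnat d)).
  have -> : logn p m = (f + (logn p h + logn p d))%N by rewrite lm hE lognM.
  by rewrite divnDl // divnn f0 add1n addSn ltnS leq_div.
rewrite subr0 -mulr_natl.
apply: (div_le S Ipi) (div_mulr S (dnat d) (sub_exp S _ (Iy d))).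
have mE : m = (m %/ d * d)%N by rewrite divnK.
have md_gt0 : (0 < m %/ d)%N by rewrite divn_gt0 // dvdn_leq.
have lmd : (logn p (m %/ d) < f)%N.
  rewrite ltnNge; apply: contraFN ndmq => le_f.
  have : (q %| m %/ d)%N by rewrite pfactor_dvdn.
  by move=> /dvdnP[h hE]; rewrite mE hE -mulnA mulnCA mulKn ?q_gt0 // dvdn_mull.
have : logn p m = (logn p (m %/ d) + logn p d)%N by rewrite {1}mE lognM.
move: lmd; rewrite lm; move: (logn p (m %/ q)) (logn p (m %/ d)) (logn p d) => u t r lt_tf e.
rewrite divnDl // divnn f0 add1n.
have := leq_div u f; have := leq_trunc_div u f; nia.
Qed.

End Bounds.

Theorem coleman_trace_coefficients (kb : closedFieldType) (io : {rmorphism k -> kb})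
  (w : kb -> \bar rat) (Tr : series k -> series k) :
  is_valuation w -> (forall x, O x -> (0 <= w (io x))%E) -> w (io pi) = 1%:E ->
  (forall m n, io (scomp (Tr (smonom k m)) (group_mul l pi) n) =
     (io pi)^-1 * \sum_(a \in torsion io w (group_mul l pi))
                     stranslate io w (group_law l) (smonom k m) a n) ->
  (2 < q)%N ->
  exists L : nat -> nat -> k,
    [/\ forall m n, (0 < m)%N -> Tr (smonom k m) n = pi^-1 * L m n,
        forall m n, O (L m n),
        forall m n, divides_in O pi (ceil_div (m - q * n)) (L m n) &
        forall m n, (0 < m)%N -> (q %| m)%N -> divides_in O pi (logn p m %/ f)
          (L m n - if (q %| n)%N then L (m %/ q)%N (n %/ q)%N else 0)].
Proof.
move=> w_val w_int w_pi TrE q_gt2.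
have [b b_cong b_root] := weierstrass_preparation.
have [L IL LE] := series_reciprocal b_cong.
exists L; split=> [m n m_gt0|m n|m n|m n m_gt0 qm].
- exact: (coleman_trace_monom w_val w_int w_pi b_cong b_root (TrE m) LE m_gt0).
- exact: IL.
- exact: (weight_bound b_cong b_root LE q_gt2).
have /series_div /(_ n) := ghost_congruence b_cong LE q_gt2 m_gt0 qm.
by rewrite coef_fpsB.
Qed.
End LubinTate.

(** * The valuation ring of a p-adic field *)

Section LocalField.
Variables (p : nat) (p_pr : prime p).
Variables (Qp : fieldType) (vp : Qp -> \bar int).
Hypothesis hQp : is_padic_field p vp.
Variables (k : fieldExtType Qp) (v : k -> \bar int).
Hypothesis hv : valuation_above vp v.
Variable pi : k.
Hypothesis hpi : v pi = 1%:E.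
Variable f : nat.
Hypothesis f_gt0 : (0 < f)%N.
Local Notation q := (p ^ f)%N.
Hypothesis hres : residue_field v #= `I_q.

Definition v_int (x : k) : Prop := (0 <= v x)%E.
Local Notation O := v_int.
Local Notation div := (divides_in v_int pi).

Let v_val : is_valuation v. Proof. by case: hv. Qed.
Let vp_val : is_valuation vp. Proof. by case: hQp. Qed.

Lemma pi_neq0 : pi != 0.
Proof. by apply/eqP => pi0; have := hpi; rewrite pi0 (val_zero v_val). Qed.

Lemma v_int_sub : is_subring O.
Proof.
split=> [|x y Ox Oy|x y Ox Oy]; first by rewrite /v_int (val_one v_val).
  exact: (valB_ge v_val).
by rewrite /v_int -[0%E]/((0 + 0)%:E); apply: (valM_ge v_val).
Qed.

Lemma v_int_pi : O pi. Proof. by rewrite /v_int hpi. Qed.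

Lemma v_piX n : v (pi ^+ n) = n%:Z%:E.
Proof. by rewrite (valX_fin v_val n hpi) -mulrz_nat intz natz. Qed.

Lemma divE n x : div n x <-> (n%:Z%:E <= v x)%E.
Proof.
split=> [[z Oz ->]|nx].
  by rewrite -[n%:Z]addr0; apply: (valM_ge v_val) => //; rewrite v_piX.
exists (pi ^- n * x); last by rewrite mulrA divff ?mul1r // expf_neq0 // pi_neq0.
rewrite /v_int -[0%E]/((0 : int)%:E) -(addNr n%:Z).
by apply: (valM_ge v_val) => //; rewrite (valV_fin v_val (v_piX n)).
Qed.

Lemma div1E x : div 1 x <-> (0 < v x)%E.
Proof. by rewrite divE; case: (v x) => [r| |] //=; rewrite lee_fin lte_fin. Qed.

Lemma v_separated x : (forall n, div n x) -> x = 0.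
Proof.
move=> dx; apply/eqP; apply/negPn/negP => /(val_fin v_val) [r rE].
by have /divE := dx `|r|.+1; rewrite rE lee_fin; lia.
Qed.

Lemma v_unit x : div 1 (x - 1) -> x != 0 /\ O x^-1.
Proof.
move=> /divE dx; have x0 : x != 0.
  by apply: contraTneq dx => ->; rewrite sub0r (valN v_val) (val_one v_val) lee_fin.
split=> //; have [r rE] := val_fin v_val x0.
rewrite /v_int (valV_fin v_val rE) lee_fin oppr_ge0 leNgt; apply/negP => r_gt0.
have : (1%:E <= v (x - (x - 1)))%E.
  by apply: (valB_ge v_val) => //; rewrite rE lee_fin; lia.
by rewrite subKr (val_one v_val) lee_fin.
Qed.

Lemma ramification : exists2 e : nat, (0 < e)%N &
  forall x : Qp, v x%:A = (e%:Z%:E * vp x)%E.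
Proof. by have [_ [[e|//] e_gt0 eE]] := hv; exists e. Qed.

Lemma v_natE : exists2 e : nat, (0 < e)%N &
  forall n, (0 < n)%N -> v n%:R = (e * logn p n)%N%:Z%:E.
Proof.
have [e e_gt0 eE] := ramification; exists e => // n n_gt0.
have [_ vpn _ _] := hQp; have := eE n%:R; rewrite vpn //.
by rewrite scaler_nat -EFinM -PoszM.
Qed.

Lemma v_int_p : div 1 p%:R.
Proof.
have [e e_gt0 eE] := v_natE; apply/divE.
by rewrite eE ?prime_gt0 // logn_prime // eqxx muln1 lee_fin; lia.
Qed.

Lemma representatives : exists rep : 'I_q -> k,
  [/\ forall i, O (rep i), forall i j, div 1 (rep i - rep j) -> i = j &
      forall x, O x -> exists i, div 1 (x - rep i)].
Proof.
have /card_set_bijP [F [Ffun Finj Fsurj]] := hres.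
pose cl (x : k) : set k := [set y | (0 < v (y - x)%R)%E].
have clP x : O x -> residue_field v (cl x) by exists x.
have cl_refl x : cl x x by rewrite /cl /= subrr (val_zero v_val).
have cl_eq x y : div 1 (x - y) -> cl x = cl y.
  move=> /div1E xy; rewrite predeqE => z; rewrite /cl /=; split=> zx.
    by rewrite -[z](subrK x) -addrA; apply/div1E/(div_add v_int_sub); apply/div1E.
  rewrite -[z](subrK y) -addrA; apply/div1E/(div_add v_int_sub); apply/div1E => //.
  by rewrite -opprB (valN v_val).
have /choice [rep repP] (i : 'I_q) : exists x, O x /\ F (cl x) = i :> nat.
  have [C [x Ox <-] FC] := Fsurj i (ltn_ord i).
  by exists x.
exists rep; split=> [i|i j ij|x Ox]; first by case: (repP i).
  apply: ord_inj; have [_ Fi] := repP i; have [_ Fj] := repP j.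
  by rewrite -Fi (cl_eq _ _ ij) Fj.
have lt_F : (F (cl x) < q)%N by apply: Ffun; apply: clP.
exists (Ordinal lt_F); have [Oi Fi] := repP (Ordinal lt_F).
apply/div1E; have : cl (rep (Ordinal lt_F)) x; last by [].
rewrite (Finj _ _ _ _ Fi) //; apply/mem_set; exact: clP.
Qed.

(** The residue field is only a set of cosets here, so the classical argument is run on
    representatives: a unit [x] permutes the nonzero classes, and comparing the products over them
    gives [x^(q-1)] congruent to 1. *)
Lemma fermat x : O x -> div 1 (x - x ^+ q).
Proof.
move=> Ox; have S := v_int_sub; have Opi := v_int_pi.
have q_gt0 : (0 < q)%N by rewrite expn_gt0 prime_gt0.
case: (pselect (div 1 x)) => [dx|ndx].
  apply: (div_sub S) => //; rewrite -(prednK q_gt0) exprS.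
  by apply: (div_mulr S dx); apply: (sub_exp S).
have vx : v x = 0%E.
  move: Ox ndx; rewrite /v_int div1E; case: (v x) => [r| |] //=.
  by rewrite lee_fin lte_fin => r0 r1; congr (_%:E); lia.
have cancelx y : div 1 (x * y) -> div 1 y by rewrite !div1E (valM v_val) vx add0e.
have [rep [Orep rep_inj rep_surj]] := representatives.
have /choice [s sP] (i : 'I_q) : exists j, div 1 (x * rep i - rep j).
  by apply: rep_surj; apply: (sub_mul S).
have s_inj : injective s.
  move=> i j sij; apply: rep_inj; apply: cancelx; rewrite mulrBr.
  by apply: (div_trans S (sP i)); rewrite sij; apply: (div_sym S).
have [i0 i0P] := rep_surj 0 (sub_zero S).
have d0 : div 1 (rep i0) by have := div_opp S i0P; rewrite sub0r opprK.
have s_i0 : s i0 = i0.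
  apply: rep_inj; apply: (div_sub S) => //; rewrite -[rep (s i0)](subKr (x * rep i0)).
  by apply: (div_sub S) (sP i0); apply: (div_mull S).
have prod_cong : div 1 (\prod_(i | i != i0) (x * rep i) - \prod_(i | i != i0) rep (s i)).
  suff: [/\ O (\prod_(i | i != i0) (x * rep i)), O (\prod_(i | i != i0) rep (s i)) &
    div 1 (\prod_(i | i != i0) (x * rep i) - \prod_(i | i != i0) rep (s i))] by case.
  elim/big_rec2: _ => [|i a c _ [Oa Oc dac]].
    by split; rewrite ?subrr; [apply: (sub_one S) | apply: (sub_one S) | apply: (div_zero S)].
  by split; [apply: (sub_mul S) => //; apply: (sub_mul S) | apply: (sub_mul S) |
    apply: (congM S) => //; apply: (sub_mul S)].
have s_reindex : \prod_(i | i != i0) rep (s i) = \prod_(i | i != i0) rep i.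
  rewrite [RHS](reindex_inj s_inj); apply: eq_bigl => i.
  by rewrite -{2}s_i0 (inj_eq s_inj).
have prod_unit : v (\prod_(i | i != i0) rep i) = 0%E.
  elim/big_rec: _ => [|i a i_neq va]; first exact: (val_one v_val).
  rewrite (valM v_val) va adde0; have := Orep i; rewrite /v_int le_eqVlt => /orP[/eqP <- //|].
  move=> /div1E di; case/eqP: i_neq; apply: rep_inj; exact: (div_sub S).
rewrite s_reindex big_split /= prodr_const in prod_cong.
have card_q : #|[pred i : 'I_q | i != i0]| = q.-1.
  by have := cardC1 i0; rewrite card_ord => <-; apply: eq_card.
rewrite card_q -[X in _ - X]mul1r -mulrBl in prod_cong.
have dx1 : div 1 (x ^+ q.-1 - 1).
  by move: prod_cong; rewrite !div1E (valM v_val) prod_unit adde0.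
rewrite -(prednK q_gt0) exprS -[X in X - _]mulr1 -mulrBr.
by apply: (div_mull S Ox); apply: (div_sym S).
Qed.

Lemma padic_series (u : nat -> Qp) : (forall j, (0 <= vp (u j))%E) ->
  exists s, forall J, (J%:Z%:E <= vp (s - \sum_(j < J) p%:R ^+ j * u j)%R)%E.
Proof.
move=> Ou; have [_ vpn _ complete] := hQp.
have vpp : vp p%:R = 1%:E by rewrite vpn ?prime_gt0 // logn_prime // eqxx.
pose S J := \sum_(j < J) p%:R ^+ j * u j.
have Sdiff J m : (J <= m)%N -> (J%:Z%:E <= vp (S m - S J)%R)%E.
  move=> /subnKC <-; elim: (m - J)%N => [|d IH].
    by rewrite addn0 subrr (val_zero vp_val) leey.
  rewrite addnS [S _.+1]/S big_ord_recr /= addrAC; apply: (valD_ge vp_val IH).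
  apply: (le_trans (y := ((J + d)%N%:Z + 0)%:E)); first by rewrite lee_fin; lia.
  apply: (valM_ge vp_val) => //; rewrite (valX_fin vp_val _ vpp) lee_fin.
  by rewrite -mulrz_nat intz natz.
have [|s sP] := complete S.
  move=> M; exists `|M|%N => i j le_i le_j.
  apply: (le_trans (y := (`|M|%N%:Z)%:E)); first by rewrite lee_fin; lia.
  have -> : S i - S j = (S i - S `|M|%N) - (S j - S `|M|%N) by ring.
  by apply: (valB_ge vp_val); apply: Sdiff.
exists s => J; have [n0 n0P] := sP J%:Z.
rewrite -/(S J) (_ : s - S J = (S (maxn n0 J) - S J) - (S (maxn n0 J) - s)); last by ring.
by apply: (valB_ge vp_val); [apply: Sdiff; apply: leq_maxr | apply: n0P; apply: leq_maxl].
Qed.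

(** Completeness is inherited from [Qp]: in terms of [pi]-adic digits, a series in
  [pi] is a combination of the finitely many [pi^i rep r], for [i < e], whose
  coefficients are series in [p] over [Qp]. *)
Lemma v_complete (x : nat -> k) : (forall j, O (x j)) ->
  exists2 s, O s & forall J, div J (s - \sum_(j < J) pi ^+ j * x j).
Proof.
move=> Ox; have S := v_int_sub; have Opi := v_int_pi.
have [e e_gt0 eE] := ramification.
have vpp : vp p%:R = 1%:E.
  by have [_ vpn _ _] := hQp; rewrite vpn ?prime_gt0 // logn_prime // eqxx.
have vkp : v p%:R = e%:Z%:E.
  by have := eE p%:R; rewrite vpp scaler_nat -EFinM mulr1.
have p_neq0 : (p%:R : k) != 0.
  by apply: contra_eq_neq vkp => ->; rewrite (val_zero v_val).
have div_pX J y : O y -> div (e * J) (p%:R ^+ J * y).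
  move=> Oy; apply/divE; rewrite -[(e * J)%N%:Z]addr0.
  apply: (valM_ge v_val) => //; rewrite (valX_fin v_val _ vkp) lee_fin.
  by rewrite -mulr_natr natz PoszM.
have e_div y : div e y -> O (y / p%:R).
  move=> /divE dy; rewrite /v_int -[0%E]/((0 : int)%:E) -(subrr e%:Z).
  by apply: (valM_ge v_val) => //; rewrite (valV_fin v_val vkp).
have [rep [Orep _ rep_surj]] := representatives.
have digit y : exists n : 'I_q, O y -> div 1 (y - rep n).
  case: (pselect (O y)) => [Oy|nOy]; last by have [n0 _] := rep_surj 0 (sub_zero S); exists n0.
  by have [n yn] := rep_surj y Oy; exists n.
have digits E y : O y -> exists n : nat -> 'I_q, exists2 z, O z &
    y = \sum_(i < E) pi ^+ i * rep (n i) + pi ^+ E * z.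
  move=> Oy; elim: E => [|E [n [z Oz ->]]].
    have [n _] := digit 0; exists (fun=> n), y => //.
    by rewrite big_ord0 add0r expr0 mul1r.
  have [m /(_ Oz) [t Ot tE]] := digit z.
  exists (fun i => if i == E then m else n i), t => //.
  rewrite big_ord_recr /= eqxx -addrA exprSr -mulrA -mulrDr.
  congr (_ + _ * _); last by rewrite -[pi]expr1 -tE addrC subrK.
  by apply: eq_bigr => i _; rewrite ltn_eqF.
have step y : exists nz : (nat -> 'I_q) * k, O y ->
    O nz.2 /\ y = \sum_(i < e) pi ^+ i * rep (nz.1 i) + p%:R * nz.2.
  case: (pselect (O y)) => [Oy|nOy]; last by have [n _] := digit 0; exists (fun=> n, 0).
  have [n [z Oz yE]] := digits e y Oy; exists (n, pi ^+ e * z / p%:R) => _ /=.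
  split; first by apply: e_div; exists z.
  by rewrite mulrC divfK.
have [D DP] := choice step.
(* The terms of index [e * J + i] with [i < e] form one block, rescaled from [pi^(e J)] to [p^J],
   which has the same valuation. *)
pose X J := \sum_(i < e) pi ^+ i * x (e * J + i)%N * (pi ^+ (e * J) / p%:R ^+ J).
have OX J : O (X J).
  apply: (sub_bigsum S) => i _; apply: (sub_mul S).
    by apply: (sub_mul S) => //; apply: (sub_exp S).
  have vpJ := valX_fin v_val J vkp.
  rewrite /v_int -[0%E]/((0 : int)%:E) -(subrr ((e * J)%N%:Z)).
  apply: (valM_ge v_val); first by rewrite v_piX.
  by rewrite (valV_fin v_val vpJ) lee_fin -[e%:Z *+ J]mulr_natr natz PoszM.
have XE J : \sum_(j < J) p%:R ^+ j * X j = \sum_(j < e * J) pi ^+ j * x j.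
  elim: J => [|J IH]; first by rewrite muln0 !big_ord0.
  rewrite big_ord_recr IH mulnS addnC big_split_ord /=; congr (_ + _).
  rewrite /X mulr_sumr; apply: eq_bigr => i _.
  have : (p%:R : k) ^+ J != 0 by rewrite expf_neq0.
  rewrite exprD; move: (p%:R ^+ J) (pi ^+ (e * J)) (pi ^+ i) (x _) => a c d y a_neq0.
  by rewrite mulrCA [a * _]mulrCA divff // mulr1 mulrC mulrA.
(* [R j] is the block [X j] plus the carry from the preceding one; [D] splits it into [e] digits and
   [p] times a new carry. *)
pose R := fix R j := if j is j'.+1 then (D (R j')).2 + X j else X 0%N.
have OR j : O (R j).
  by elim: j => [|j IH] /=; [apply: OX | apply: (sub_add S); [case: (DP _ IH) | apply: OX]].
pose n j i : 'I_q := (D (R j)).1 i.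
have RE J : \sum_(j < J) p%:R ^+ j * X j =
    \sum_(j < J) p%:R ^+ j * (\sum_(i < e) pi ^+ i * rep (n j i)) + p%:R ^+ J * (R J - X J).
  elim: J => [|J IH]; first by rewrite !big_ord0 add0r subrr mulr0.
  rewrite !big_ord_recr /= IH addrK exprSr.
  have [_ RJ] := DP _ (OR J); rewrite -/(n J) in RJ *.
  rewrite -!addrA; congr (_ + _); rewrite mulrBr subrK {1}RJ mulrDr mulrA.
  by [].
(* For each position [i] and digit [r], the powers [p^j] for which [r] is the digit at position [i]
   of the j-th block are summed in [Qp]. *)
have /choice [al alP] (ir : nat * 'I_q) : exists s : Qp, forall J,
    (J%:Z%:E <= vp (s - \sum_(j < J) p%:R ^+ j * (n j ir.1 == ir.2)%:R)%R)%E.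
  apply: (@padic_series (fun j => (n j ir.1 == ir.2)%:R)) => j.
  have [_ vpn _ _] := hQp; case: (_ == _).
    by rewrite vpn // logn1.
  by rewrite (val_zero vp_val) leey.
pose s := \sum_(i < e) \sum_(r < q) (al (i : nat, r))%:A * (pi ^+ i * rep r) : k.
have sP J : div (e * J) (s - \sum_(j < e * J) pi ^+ j * x j).
  rewrite -XE RE opprD addrA; apply: (div_sub S); last first.
    by apply: div_pX; apply: (sub_sub S).
  have -> : \sum_(j < J) p%:R ^+ j * (\sum_(i < e) pi ^+ i * rep (n j i)) =
    \sum_(i < e) \sum_(r < q)
      (\sum_(j < J) p%:R ^+ j * (n j i == r)%:R : Qp)%:A * (pi ^+ i * rep r).
    under eq_bigr do rewrite mulr_sumr.
    rewrite exchange_big; apply: eq_bigr => i _ /=.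
    under [RHS]eq_bigr do rewrite -in_algE rmorph_sum mulr_suml.
    rewrite exchange_big; apply: eq_bigr => j _ /=.
    rewrite (bigD1 (n j i)) //= eqxx mulr1 -in_algE rmorphXn rmorph_nat big1 ?addr0 // => r.
    by rewrite eq_sym => /negbTE ->; rewrite mulr0 scale0r mul0r.
  rewrite -sumrB; apply: (div_bigsum S) => i _.
  rewrite -sumrB; apply: (div_bigsum S) => r _.
  rewrite -mulrBl -scalerBl; apply: (div_mulr S); last first.
    by apply: (sub_mul S) => //; apply: (sub_exp S).
  apply/divE; rewrite eE PoszM; have := alP (i : nat, r) J.
  by case: (vp _) => [z| |] //=; rewrite ?lee_fin -?EFinM ?lee_fin;
    [move=> h; rewrite ler_pM2l // ltz_nat | rewrite gt0_muley ?leey // lte_fin ltz_nat].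
exists s => [|J].
  have := sP 0%N; rewrite muln0 big_ord0 subr0; exact: (div_in S Opi).
have le_J : (J <= e * J)%N by rewrite leq_pmull.
rewrite -[s](subrK (\sum_(j < e * J) pi ^+ j * x j)) -addrA.
apply: (div_add S); first exact: (div_le S Opi le_J).
rewrite -!(big_mkord xpredT (fun j => pi ^+ j * x j)).
rewrite (@big_cat_nat _ _ _ J 0 (e * J)) //= addrC addKr big_nat_cond.
apply: (div_bigsum S) => j /andP[/andP[le_Jj _] _].
by apply: (div_le S Opi le_Jj); exists (x j).
Qed.

End LocalField.

(** * The monoid and the logarithm *)

Lemma divisors_shift (V : nmodType) (q n : nat) (G : nat -> V) : (0 < q)%N -> (0 < n)%N ->
  \sum_(d <- divisors n | (q %| d)%N) G d =
  \sum_(d <- divisors n | (q %| n %/ d)%N) G (q * d)%N.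
Proof.
move=> q_gt0 n_gt0; rewrite -!(big_filter _ (fun d => (q %| _)%N)).
rewrite -(big_map (muln q) xpredT G); apply: perm_big; apply: uniq_perm.
- by rewrite filter_uniq // divisors_uniq.
- rewrite map_inj_uniq ?filter_uniq ?divisors_uniq // => x y /eqP.
  by rewrite eqn_pmul2l // => /eqP.
move=> d; rewrite mem_filter -dvdn_divisors //; apply/andP/mapP => [[/dvdnP[e ->] en]|[e]].
  exists e; last by rewrite mulnC.
  have e_n : (e %| n)%N := dvdn_trans (dvdn_mulr _ (dvdnn e)) en.
  have e_gt0 : (0 < e)%N := dvdn_gt0 n_gt0 e_n.
  by rewrite mem_filter -dvdn_divisors // e_n andbT dvdn_divRL // mulnC.
rewrite mem_filter -dvdn_divisors // => /andP[qne e_n] ->.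
by split; [apply: dvdn_mulr | rewrite -dvdn_divRL].
Qed.

(** * Dirichlet convolution with an Euler factor at [q] *)

Section ExtractFactor.
Variables (K : fieldType) (c : K) (q : nat) (eta : nat -> K).
Hypothesis q_gt1 : (1 < q)%N.

(** Solves [eta0 d = eta d + c eta0 (d / q)] by iteration, that is, sums [c^i eta (d / q^i)]. The
    fuel [N] is sufficient as soon as [d <= N]. *)
Fixpoint unfold_shift (N d : nat) : K :=
  eta d + if N is N'.+1 then
            if (q %| d)%N then c * unfold_shift N' (d %/ q) else 0
          else 0.

Lemma unfold_shift_stable N M d : (0 < d <= N)%N -> (d <= M)%N ->
  unfold_shift N d = unfold_shift M d.
Proof.
elim: N M d => [|N IH] [|M] d /=; try by lia.
move=> /andP[d_gt0 le_dN] le_dM; case: ifP => // qd; congr (_ + _ * _).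
have lt_d : (d %/ q < d)%N by rewrite ltn_Pdiv.
by apply: IH; [rewrite divn_gt0 ?(ltnW q_gt1) // dvdn_leq //; lia | lia].
Qed.

(** [eta] is the Dirichlet product of [eta0] with [1 - c q^(-s)]. *)
Lemma extract_factor : exists eta0 : nat -> K, forall d, (0 < d)%N ->
  eta d = eta0 d - if (q %| d)%N then c * eta0 (d %/ q)%N else 0.
Proof.
exists (fun d => unfold_shift d d) => -[//|d] _ /=; case: ifP => qd; last first.
  by rewrite addr0 subr0.
have lt_d : (d.+1 %/ q < d.+1)%N by rewrite ltn_Pdiv.
have d0 : (0 < d.+1 %/ q)%N by rewrite divn_gt0 ?(ltnW q_gt1) // dvdn_leq.
by rewrite (@unfold_shift_stable d (d.+1 %/ q)) ?addrK // d0 -ltnS.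
Qed.

(** Reindexing the divisors that are multiples of [q] moves the factor [1 - c q^-s] from [eta] onto
    [G]. *)
Lemma sum_extract_factor (eta0 : nat -> K) (G : nat -> K) n :
  (forall d, (0 < d)%N -> eta d = eta0 d - if (q %| d)%N then c * eta0 (d %/ q)%N else 0) ->
  (0 < n)%N ->
  \sum_(d <- divisors n) eta d * G d =
  \sum_(d <- divisors n) eta0 d *
    (G d - if (q %| n %/ d)%N then c * G (q * d)%N else 0).
Proof.
move=> etaE n_gt0.
transitivity (\sum_(d <- divisors n)
   (eta0 d * G d - (if (q %| d)%N then c * eta0 (d %/ q)%N * G d else 0))).
  rewrite !big_seq; apply: eq_bigr => d; rewrite -dvdn_divisors // => dn.
  rewrite etaE ?(dvdn_gt0 n_gt0 dn) // mulrBl; congr (_ - _).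
  by case: ifP; rewrite ?mul0r.
rewrite sumrB -big_mkcond /= divisors_shift ?(ltnW q_gt1) //.
rewrite [X in _ - X]big_mkcond -sumrB.
apply: eq_bigr => d _; rewrite mulrBr; congr (_ - _).
case: ifP => _; last by rewrite mulr0.
by rewrite mulKn ?(ltnW q_gt1) // [RHS]mulrCA mulrA.
Qed.

End ExtractFactor.

(** * The monoid of indices, its coefficients and the logarithm *)

Section Monoid.
Variables (p fk fF fkF : nat) (Np : set nat).
Hypotheses (p_pr : prime p) (fF_gt0 : (0 < fF)%N) (fkF_gt0 : (0 < fkF)%N).
Hypothesis hf : (fF * fkF)%N = fk.
Hypothesis hNp : monus_closed_submonoid p Np.
Local Notation q := (p ^ fk)%N.
Local Notation N := (gen_monoid p fF Np).
Local Notation vq n := (logn p n %/ fk)%N.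

Let p_gt0 : (0 < p)%N. Proof. exact: prime_gt0. Qed.
Let fk_gt0 : (0 < fk)%N. Proof. by rewrite -hf muln_gt0 fF_gt0. Qed.
Let q_gt0 : (0 < q)%N. Proof. by rewrite expn_gt0 p_gt0. Qed.

Lemma Np_gt0 m : Np m -> (0 < m)%N.
Proof. by case: hNp => H _ _ _ /H[]. Qed.

Lemma Np_coprime m : Np m -> coprime p m.
Proof. by case: hNp => H _ _ _ /H[]. Qed.

(** The lcm is [m / (m, n)] times [n], so monus-closedness applies. It makes the lcm of all divisors
    of a number in [Np] the largest such divisor. *)
Lemma Np_lcm m n : Np m -> Np n -> Np (lcmn m n).
Proof.
move=> Nm Nn; have [_ _ NM Nquo] := hNp.
rewrite /lcmn -divn_mulAC ?dvdn_gcdl //; apply: NM => //; exact: Nquo.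
Qed.

Definition Np_part (n : nat) : nat :=
  \big[lcmn/1%N]_(i < n.+1 | `[< Np i >] && (i %| n)%N) i.

Lemma Np_part_Np n : Np (Np_part n).
Proof.
have [_ N1 _ _] := hNp; rewrite /Np_part; elim/big_ind: _ => // [|i].
  exact: Np_lcm.
by case/andP => /asboolP.
Qed.

Lemma Np_part_dvd n : (Np_part n %| n)%N.
Proof. by apply/dvdn_biglcmP => i /andP[]. Qed.

Lemma Np_part_max n e : (0 < n)%N -> Np e -> (e %| n)%N -> (e %| Np_part n)%N.
Proof.
move=> n_gt0 Ne en; have lt_en : (e < n.+1)%N by rewrite ltnS dvdn_leq.
apply: (@biglcmn_sup _ (Ordinal lt_en)) => //=.
by rewrite en andbT; apply/asboolP.
Qed.

Lemma coprime_pX a m : Np m -> coprime (p ^ a) m.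
Proof. by move=> Nm; rewrite coprimeXl // Np_coprime. Qed.

Lemma Np_part_q n : (0 < n)%N -> Np_part (q * n) = Np_part n.
Proof.
move=> n_gt0; apply/eqP; rewrite eqn_dvd; apply/andP; split; apply: Np_part_max => //.
- exact: Np_part_Np.
- have := Np_part_dvd (q * n); rewrite Gauss_dvdr // coprime_sym.
  by apply: coprime_pX; apply: Np_part_Np.
- by rewrite muln_gt0 q_gt0.
- exact: Np_part_Np.
exact: dvdn_mull (Np_part_dvd n).
Qed.

Lemma gen_monoidP n : N n <-> exists a m, Np m /\ n = (p ^ (fF * a) * m)%N.
Proof.
split=> [[a _ [m Nm <-]]|[a [m [Nm ->]]]]; first by exists a, m.
by exists a => //; exists m.
Qed.

Lemma NbarE n : (0 < n)%N ->
  Nbar N n = (p ^ (fF * (logn p n %/ fF)) * Np_part n)%N.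
Proof.
move=> n_gt0; set D := (_ * _)%N.
have DP : [/\ N D, (D %| n)%N & forall e, N e -> (e %| n)%N -> (e %| D)%N].
  split.
  - by apply/gen_monoidP; exists (logn p n %/ fF)%N, (Np_part n); split=> //; apply: Np_part_Np.
  - rewrite Gauss_dvd; last by apply: coprime_pX; apply: Np_part_Np.
    by rewrite Np_part_dvd andbT pfactor_dvdn // mulnC leq_trunc_div.
  move=> e /gen_monoidP[a [m [Nm ->]]]; rewrite Gauss_dvd ?coprime_pX // => /andP[pa mn].
  apply: dvdn_mul; last exact: Np_part_max.
  rewrite pfactor_dvdn // in pa; rewrite dvdn_exp2l // leq_mul2l leq_divRL //.
  by rewrite [(a * fF)%N]mulnC pa orbT.
have [N1 D1 max1] := @xgetPex _ 1%N
  [set d | [/\ N d, (d %| n)%N & forall e, N e -> (e %| n)%N -> (e %| d)%N]]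
  (ex_intro _ D DP).
have [N2 D2 max2] := DP.
by apply/eqP; rewrite eqn_dvd; apply/andP; split; [apply: max2 | apply: max1].
Qed.

Lemma Nbar_id n : N n -> Nbar N n = n.
Proof.
move=> Nn; have [a [m [Nm nE]]] := (gen_monoidP n).1 Nn.
have n_gt0 : (0 < n)%N by rewrite nE muln_gt0 expn_gt0 p_gt0 Np_gt0.
have ln : logn p n = (fF * a)%N.
  rewrite nE lognM ?expn_gt0 ?p_gt0 // ?Np_gt0 // pfactorK // logn_coprime ?addn0 //.
  exact: Np_coprime.
rewrite NbarE // ln mulKn //; rewrite {2}nE; congr (_ * _)%N.
apply/eqP; rewrite eqn_dvd; apply/andP; split.
  have := Np_part_dvd n; rewrite {2}nE Gauss_dvdr // coprime_sym coprime_pX //.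
  exact: Np_part_Np.
by apply: Np_part_max => //; rewrite nE dvdn_mull.
Qed.

Lemma gen_monoid_gt0 n : N n -> (0 < n)%N.
Proof. by move=> /gen_monoidP[a [m [Nm ->]]]; rewrite muln_gt0 expn_gt0 p_gt0 Np_gt0. Qed.

Lemma gen_monoid_q n : N (q * n)%N <-> N n.
Proof.
rewrite !gen_monoidP; split=> -[a [m [Nm nE]]]; last first.
  by exists (fkF + a)%N, m; split=> //; rewrite nE mulnDr hf expnD mulnA.
have qn_gt0 : (0 < q * n)%N by rewrite nE muln_gt0 expn_gt0 p_gt0 Np_gt0.
have le_a : (fkF <= a)%N.
  have : (q %| p ^ (fF * a) * m)%N by rewrite -nE dvdn_mulr.
  rewrite Gauss_dvdl ?coprime_pX // dvdn_Pexp2l ?prime_gt1 // -hf leq_mul2l.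
  by rewrite gtn_eqF.
exists (a - fkF)%N, m; split=> //; apply/eqP; rewrite -(eqn_pmul2l q_gt0) nE mulnA -expnD.
by rewrite -hf -mulnDr subnKC.
Qed.

Variables (k : fieldType) (v : k -> \bar int) (pi : k) (rho nu c : nat -> k).
Hypothesis v_val : is_valuation v.
Hypothesis hpi : v pi = 1%:E.
Hypothesis rho_unit : forall m : nat, Np m -> v (rho m) = 0%:E.
Hypothesis rhoM : forall m m' : nat, Np m -> Np m' -> rho (m * m')%N = rho m * rho m'.
Hypothesis nu0 : nu 0%N = 1.
Hypothesis nu_unit : forall j : nat, (j < fkF)%N -> v (nu j) = 0%:E.
Hypothesis hc : forall j a m : nat, (j < fkF)%N -> Np m ->
  c (p ^ (fF * j) * (p ^ fk) ^ a * m)%N = pi ^+ a * nu j * rho m.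

(** The exponent of [p^fF] in the largest divisor is [logn p n %/ fF]; its division by [fkF] has
    quotient [vq n], the exponent of [pi], and its remainder is the index of [nu]. *)
Lemma c_Nbar n : (0 < n)%N -> c (Nbar N n) =
  pi ^+ vq n * nu (logn p n %/ fF %% fkF)%N * rho (Np_part n).
Proof.
move=> n_gt0; rewrite NbarE // -(hc _ _ _) ?ltn_mod //; last exact: Np_part_Np.
congr (c (_ * _)%N); rewrite -expnM -expnD; congr (p ^ _)%N.
by rewrite -{1}hf -mulnA -mulnDr addnC -hf divnMA [(fkF * _)%N]mulnC -divn_eq.
Qed.

Lemma v_c_Nbar n : (0 < n)%N -> v (c (Nbar N n)) = (vq n)%:Z%:E.
Proof.
move=> n_gt0; rewrite c_Nbar // !(valM v_val) nu_unit ?ltn_mod // rho_unit; last first.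
  exact: Np_part_Np.
by rewrite !adde0 (valX_fin v_val _ hpi) -mulrz_nat intz natz.
Qed.

Lemma logn_q n : (0 < n)%N -> logn p (q * n) = (fk + logn p n)%N.
Proof. by move=> n_gt0; rewrite lognM // pfactorK. Qed.

Lemma vq_q n : (0 < n)%N -> vq (q * n) = (vq n).+1.
Proof. by move=> n_gt0; rewrite logn_q // divnDl // divnn fk_gt0. Qed.

Lemma c_Nbar_q n : (0 < n)%N -> c (Nbar N (q * n)) = pi * c (Nbar N n).
Proof.
move=> n_gt0; rewrite !c_Nbar ?muln_gt0 ?q_gt0 // vq_q // Np_part_q // logn_q // exprS.
have -> : ((fk + logn p n) %/ fF %% fkF = logn p n %/ fF %% fkF)%N.
  by rewrite -hf mulnC divnMDl // modnDl.
by rewrite !mulrA.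
Qed.

Lemma rho1 : rho 1%N = 1.
Proof.
have [_ N1 _ _] := hNp; have := rhoM N1 N1; rewrite mul1n => /eqP.
have r0 : rho 1%N != 0.
  by apply: contra_eq_neq (rho_unit N1) => ->; rewrite (val_zero v_val).
by rewrite -{1}[rho 1%N]mulr1 (inj_eq (mulfI r0)) eq_sym => /eqP.
Qed.

Lemma c_one : c 1%N = 1.
Proof.
have [_ N1 _ _] := hNp; have := hc 0 fkF_gt0 N1.
by rewrite !muln0 !expn0 !muln1 nu0 rho1 expr0 !mulr1.
Qed.

Lemma gen_monoid1 : N 1%N.
Proof.
by apply/gen_monoidP; exists 0%N, 1%N; split; [case: hNp | rewrite muln0 expn0].
Qed.

Local Notation l := (lt_log N c).

Lemma lt_logE n : N n -> l n = (-1) ^+ n.-1 / c n.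
Proof. by move=> Nn; rewrite /lt_log mem_set. Qed.

Lemma lt_log_out n : ~ N n -> l n = 0.
Proof. by move=> Nn; rewrite /lt_log memNset. Qed.

Lemma lt_log0 : l 0%N = 0.
Proof. by apply: lt_log_out => /gen_monoid_gt0. Qed.

Lemma lt_log1 : l 1%N = 1.
Proof. by rewrite lt_logE; [rewrite c_one expr0 divr1 | exact: gen_monoid1]. Qed.

Lemma v_c n : N n -> v (c n) = (vq n)%:Z%:E.
Proof. by move=> Nn; rewrite -{1}(Nbar_id Nn) v_c_Nbar // gen_monoid_gt0. Qed.

Lemma v_lt_log n : ((- (vq n)%:Z)%:E <= v (l n))%E.
Proof.
case: (pselect (N n)) => [Nn|/lt_log_out ->]; last by rewrite (val_zero v_val) leey.
have vV := valV_fin v_val (v_c Nn).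
have vs : v ((-1) ^+ n.-1) = 0%E.
  by rewrite -signr_odd; case: odd; rewrite ?expr1 ?(valN v_val) (val_one v_val).
by rewrite lt_logE // (valM v_val) vV vs add0e.
Qed.

Hypothesis p_odd : odd p.

(** As [q] is odd, [n] and [q n] have the same parity, so the signs agree and only the factor [pi]
    of [c (q n)] remains. *)
Lemma lt_log_q n : (0 < n)%N -> l (q * n)%N = pi^-1 * l n.
Proof.
move=> n_gt0; case: (pselect (N n)) => [Nn|nNn]; last first.
  by rewrite !lt_log_out ?mulr0 // => /gen_monoid_q.
have Nqn : N (q * n)%N by apply/gen_monoid_q.
have qn_gt0 : (0 < q * n)%N by rewrite muln_gt0 q_gt0.
have cE : c (q * n)%N = pi * c n by rewrite -{1}(Nbar_id Nqn) c_Nbar_q // Nbar_id.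
rewrite !lt_logE // cE invfM mulrCA.
rewrite -signr_odd -[in RHS]signr_odd; congr (_ * (_ * _)).
have odd_pred m : (0 < m)%N -> odd m.-1 = ~~ odd m by case: m => //= m _; rewrite negbK.
by rewrite !odd_pred // oddM oddX p_odd orbT.
Qed.

End Monoid.

(** * The estimates *)

Section Estimates.
Variables (p fk : nat) (p_pr : prime p) (fk_gt0 : (0 < fk)%N).
Local Notation q := (p ^ fk)%N.
Local Notation vq n := (logn p n %/ fk)%N.
Variables (k : fieldType) (v : k -> \bar int) (v_val : is_valuation v).
Variables (pi : k) (hpi : v pi = 1%:E).
Variables (cb eta : nat -> k) (L : nat -> nat -> k).
Hypothesis v_cb : forall n, (0 < n)%N -> v (cb n) = (vq n)%:Z%:E.
Hypothesis cb_q : forall n, (0 < n)%N -> cb (q * n)%N = pi * cb n.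
Hypothesis cb1 : cb 1%N = 1.
Hypothesis heta : is_dirichlet_inverse (fun n => 1 / cb n) eta.
Hypothesis L_int : forall m n, (0 <= v (L m n))%E.
Hypothesis L_weight : forall m n, ((ceil_div p fk (m - q * n))%:Z%:E <= v (L m n))%E.
Hypothesis L_ghost : forall m n, (0 < m)%N -> (q %| m)%N ->
  ((vq m)%:Z%:E <= v (L m n - if (q %| n)%N then L (m %/ q)%N (n %/ q)%N else 0)%R)%E.

Let q_gt1 : (1 < q)%N. Proof. by rewrite -(exp1n fk) ltn_exp2r // prime_gt1. Qed.
Let q_gt0 : (0 < q)%N. Proof. exact: ltnW. Qed.

Lemma vq_div n : (0 < n)%N -> (q %| n)%N -> vq n = (vq (n %/ q)).+1.
Proof.
move=> n_gt0 qn; have m_gt0 : (0 < n %/ q)%N by rewrite divn_gt0 // dvdn_leq.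
rewrite -{1}(divnK qn); move: (n %/ q)%N m_gt0 => m m_gt0.
by rewrite (lognM _ m_gt0 q_gt0) pfactorK // divnDr // divnn fk_gt0 addn1.
Qed.

Lemma vq_ndiv n : ~~ (q %| n)%N -> vq n = 0%N.
Proof.
case: (posnP n) => [-> //|n_gt0]; first by rewrite dvdn0.
by rewrite pfactor_dvdn // -ltnNge => /divn_small.
Qed.

Lemma L_bound m n : (0 < m)%N -> (0 < n)%N ->
  (((vq m)%:Z - (vq n)%:Z)%:E <= v (L m n))%E.
Proof.
elim/ltn_ind: m n => m IH n m_gt0 n_gt0.
case: (boolP (q %| m)%N) => [qm|/vq_ndiv ->]; last first.
  by apply: le_trans (L_int m n); rewrite lee_fin sub0r oppr_le0.
set x := if (q %| n)%N then L (m %/ q)%N (n %/ q)%N else 0.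
rewrite -[L m n](subrK x); apply: (valD_ge v_val).
  by apply: le_trans (L_ghost n m_gt0 qm); rewrite lee_fin gerBl.
rewrite /x; case: ifP => qn; last by rewrite (val_zero v_val) leey.
have mq0 : (0 < m %/ q)%N by rewrite divn_gt0 // dvdn_leq.
have nq0 : (0 < n %/ q)%N by rewrite divn_gt0 // dvdn_leq.
apply: le_trans (IH (m %/ q)%N _ (n %/ q)%N mq0 nq0); last by rewrite ltn_Pdiv.
rewrite lee_fin (vq_div m_gt0 qm) (vq_div n_gt0 qn).
by move: (logn p (m %/ q) %/ fk)%N (logn p (n %/ q) %/ fk)%N => a c; lia.
Qed.

Lemma v_cbV n : (0 < n)%N -> v (1 / cb n) = (- (vq n)%:Z)%:E.
Proof. by move=> n_gt0; rewrite div1r; apply: (valV_fin v_val); apply: v_cb. Qed.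

Lemma cbV_q n : (0 < n)%N -> (q %| n)%N -> pi^-1 * (1 / cb (n %/ q)%N) = 1 / cb n.
Proof.
move=> n_gt0 qn; have nq0 : (0 < n %/ q)%N by rewrite divn_gt0 // dvdn_leq.
by rewrite -{2}(divnK qn) mulnC cb_q // !div1r invfM.
Qed.

(** As [cb (q n) = pi cb n], the Dirichlet series of [1 / cb] is the product of
  [1 / (1 - pi^-1 q^-s)] and of one with integral coefficients. *)
Lemma eta_decomposition : exists2 eta0 : nat -> k,
  forall d, (0 < d)%N -> (0 <= v (eta0 d))%E &
  forall d, (0 < d)%N ->
    eta d = eta0 d - if (q %| d)%N then pi^-1 * eta0 (d %/ q)%N else 0.
Proof.
have [eta0 etaE] := extract_factor pi^-1 eta q_gt1; exists eta0 => //.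
elim/ltn_ind=> n IH n_gt0.
have := heta n_gt0; rewrite (sum_extract_factor q_gt1 (fun d => 1 / cb (n %/ d)%N) etaE n_gt0).
have -> : \sum_(d <- divisors n) eta0 d * (1 / cb (n %/ d)%N -
      (if (q %| n %/ d)%N then pi^-1 * (1 / cb (n %/ (q * d))%N) else 0)) =
    \sum_(d <- divisors n) eta0 d * (if (q %| n %/ d)%N then 0 else 1 / cb (n %/ d)%N).
  rewrite !big_seq; apply: eq_bigr => d; rewrite -dvdn_divisors // => dn.
  congr (_ * _); case: ifP => qnd; last by rewrite subr0.
  have nd_gt0 : (0 < n %/ d)%N by rewrite divn_gt0 ?(dvdn_leq n_gt0 dn) // (dvdn_gt0 n_gt0 dn).
  by rewrite mulnC divnMA cbV_q // subrr.
(* What is left is an integral recursion: the term [d = n] is [eta0 n] because [cb 1 = 1], and in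
   the other surviving terms [q] does not divide [n / d], so that [1 / cb (n / d)] has valuation
   0. *)
have n_div : n \in divisors n by rewrite -dvdn_divisors.
rewrite (big_rem n) //= divnn n_gt0 dvdn1 (gtn_eqF q_gt1) cb1 divr1 mulr1.
move=> /eqP; rewrite eq_sym -subr_eq => /eqP <-.
apply: (valB_ge v_val).
  by case: eqP => _; rewrite ?(val_one v_val) // (val_zero v_val) leey.
rewrite big_seq; apply: (val_sum_ge v_val) => d; rewrite mem_rem_uniq ?divisors_uniq //.
rewrite inE -dvdn_divisors // => /andP[dn_neq dn].
case: ifP => qnd; first by rewrite mulr0 (val_zero v_val) leey.
have d_gt0 := dvdn_gt0 n_gt0 dn.
have nd_gt0 : (0 < n %/ d)%N by rewrite divn_gt0 // dvdn_leq.
rewrite (valM v_val) v_cbV // (vq_ndiv (negbT qnd)) oppr0 adde0; apply: IH => //.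
by rewrite ltn_neqAle dn_neq dvdn_leq.
Qed.

Lemma eta_bound d : (0 < d)%N -> ((-1)%:E <= v (eta d))%E.
Proof.
have [eta0 eta0_int etaE] := eta_decomposition => d_gt0; rewrite etaE //.
have le_N1 x : (0 <= v x -> (-1)%:E <= v x)%E by apply: le_trans; rewrite lee_fin.
apply: (valB_ge v_val); first exact/le_N1/eta0_int.
case: ifP => qd; last by rewrite (val_zero v_val) leey.
rewrite -[-1]addr0; apply: (valM_ge v_val); first by rewrite (valV_fin v_val hpi).
by apply: eta0_int; rewrite divn_gt0 // dvdn_leq.
Qed.

Local Notation sigma m n := (\sum_(d <- divisors (gcdn m n))
  eta d * (L (n %/ d)%N (m %/ d)%N * (1 / cb (n %/ d)%N))).

(** With the Euler factor moved from [eta] onto the rest, and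
    [pi^-1 / cb (n / (q d)) = 1 / cb (n / d)], each term contains the difference bounded in
    [L_ghost], whose valuation [vq (n / d)] at least offsets the denominator. If [q] does not divide
    [n / d], that denominator is a unit. *)
Lemma sigma_int m n : (0 < m)%N -> (0 < n)%N -> (0 <= v (sigma m n))%E.
Proof.
move=> m_gt0 n_gt0; have g_gt0 : (0 < gcdn m n)%N by rewrite gcdn_gt0 m_gt0.
have [eta0 eta0_int etaE] := eta_decomposition.
rewrite (sum_extract_factor q_gt1 (fun d => L (n %/ d)%N (m %/ d)%N * (1 / cb (n %/ d)%N))
  etaE g_gt0).
rewrite big_seq; apply: (val_sum_ge v_val) => d; rewrite -dvdn_divisors // => dg.
have d_gt0 := dvdn_gt0 g_gt0 dg.
rewrite -[0%E]/((0 + 0)%:E); apply: (valM_ge v_val); first exact: eta0_int.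
have dm : (d %| m)%N := dvdn_trans dg (dvdn_gcdl m n).
have dn : (d %| n)%N := dvdn_trans dg (dvdn_gcdr m n).
have nd_gt0 : (0 < n %/ d)%N by rewrite divn_gt0 // dvdn_leq.
have -> : (q %| gcdn m n %/ d)%N = (q %| m %/ d)%N && (q %| n %/ d)%N.
  by rewrite -dvdn_gcd; congr (_ %| _)%N; rewrite -{1}(divnK dm) -{1}(divnK dn) -muln_gcdl mulnK.
rewrite [(q * d)%N]mulnC !divnMA.
case: (boolP (q %| n %/ d)%N) => [qn|qn]; last first.
  rewrite andbF subr0 -[0]addr0; apply: (valM_ge v_val); first exact: L_int.
  by rewrite v_cbV // (vq_ndiv qn) oppr0.
rewrite andbT; set x := if _ then _ else _.
have -> : L (n %/ d)%N (m %/ d)%N * (1 / cb (n %/ d)%N) - x =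
    (L (n %/ d)%N (m %/ d)%N - if (q %| m %/ d)%N then L (n %/ d %/ q)%N (m %/ d %/ q)%N else 0)
     * (1 / cb (n %/ d)%N).
  rewrite mulrBl /x; congr (_ - _); case: ifP => _; last by rewrite mul0r.
  by rewrite mulrCA cbV_q.
rewrite -(subrr (vq (n %/ d))%:Z); apply: (valM_ge v_val); first exact: L_ghost.
by rewrite v_cbV.
Qed.

Lemma ceil_divE x : (0 < x)%N -> ceil_div p fk x = ((x - 1) %/ q.-1).+1.
Proof.
move=> x_gt0; rewrite /ceil_div; have q1 : (0 < q.-1)%N by lia.
have -> : (x + q.-2 = q.-1 + (x - 1))%N by lia.
by rewrite divnDl // divnn q1.
Qed.

(** For [x = n - q m > 0], the integer part of [(x - 1) / (q - 1)] is the ceiling of [x / (q - 1)]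
    minus one. That one pays for the factor [pi^-1] in [eta]. *)
Lemma floor_bound m n : (q * m < n)%N ->
  Num.max 0 (Num.floor (1 / (q%:R - 1) * (n%:R - 1 - (m * q)%:R) : rat)) <=
    (ceil_div p fk (n - q * m))%:Z - 1.
Proof.
move=> lt_mn; rewrite ceil_divE ?subn_gt0 // -addn1 PoszD addrK ge_max lez_nat /=.
have q1 : (0 : rat) < q%:R - 1 by rewrite subr_gt0 ltr1n.
rewrite -ltzD1 -[X in _ < X]PoszD addn1 floor_lt_int -pmulrn div1r mulrC ltr_pdivrMr //.
have -> : n%:R - 1 - (m * q)%:R = (n - q * m - 1)%N%:R :> rat.
  by rewrite !natrB ?(ltnW lt_mn) ?subn_gt0 // mulnC; ring.
have -> : q%:R - 1 = q.-1%:R :> rat by rewrite -subn1 natrB.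
by rewrite -natrM ltr_nat ltn_ceil //; lia.
Qed.

Lemma bigmin_le_mem (T : eqType) (r : seq T) (F : T -> \bar int) x : x \in r ->
  (\big[Order.min/+oo]_(d <- r) F d <= F x)%E.
Proof. by move=> xr; rewrite (big_rem x) //= ge_min lexx. Qed.

(** If [q m < n], each term is bounded separately by [eta_bound], the weight and [floor_bound].
    Otherwise the truncated floor at [d = 1] is 0, so the minimum is at most 0 and [sigma_int] is
    the stronger bound. *)
Lemma sigma_bound m n : (0 < m)%N -> (0 < n)%N ->
  (\big[Order.min/+oo%E]_(d <- divisors (gcdn m n))
         (Num.max 0
            (Num.floor (1 / (q%:R - 1) *
               (n%:R / d%:R - 1 - (m * q)%:R / d%:R) : rat))
          - (vq (n %/ d)%N)%:Z)%:E <= v (sigma m n))%E.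
Proof.
move=> m_gt0 n_gt0; have g_gt0 : (0 < gcdn m n)%N by rewrite gcdn_gt0 m_gt0.
pose F d : \bar int := (Num.max 0 (Num.floor (1 / (q%:R - 1) *
    (n%:R / d%:R - 1 - (m * q)%:R / d%:R) : rat)) - (vq (n %/ d)%N)%:Z)%:E.
case: (ltnP (q * m) n) => [lt_mn|le_nm].
  rewrite [X in (_ <= v X)%E]big_seq; apply: (val_sum_ge v_val) => d d_div.
  apply: le_trans (bigmin_le_mem F d_div) _.
  move: d_div; rewrite -dvdn_divisors // => dg.
  have d_gt0 := dvdn_gt0 g_gt0 dg.
  have dm : (d %| m)%N := dvdn_trans dg (dvdn_gcdl m n).
  have dn : (d %| n)%N := dvdn_trans dg (dvdn_gcdr m n).
  have nd_gt0 : (0 < n %/ d)%N by rewrite divn_gt0 // dvdn_leq.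
  have lt_d : (q * (m %/ d) < n %/ d)%N.
    by rewrite -(ltn_pmul2r d_gt0) -mulnA !divnK.
  have := floor_bound lt_d; rewrite {1}/F -!natf_div ?dvdn_mulr //.
  rewrite -[(m * q %/ d)%N]divn_mulAC // => le_floor.
  apply: (le_trans (y := (-1 + ((ceil_div p fk (n %/ d - q * (m %/ d)))%:Z
                                - (vq (n %/ d))%:Z))%:E)).
    by rewrite lee_fin addrA lerD2r addrC.
  apply: (valM_ge v_val); first exact: eta_bound.
  by apply: (valM_ge v_val); [exact: L_weight | rewrite v_cbV].
apply: le_trans (sigma_int m_gt0 n_gt0).
have one_div : 1%N \in divisors (gcdn m n) by rewrite -dvdn_divisors ?dvd1n.
apply: le_trans (bigmin_le_mem F one_div) _.
rewrite /F lee_fin !divr1 divn1 subr_le0; apply: le_trans (_ : 0 <= _) => //.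
rewrite ge_max lexx /= -ltzD1 add0r floor_lt_int.
have q1 : (0 : rat) < q%:R - 1 by rewrite subr_gt0 ltr1n.
rewrite div1r mulrC ltr_pdivrMr // mul1r.
have : (n%:R : rat) <= (m * q)%:R by rewrite ler_nat mulnC.
by move: q1; lra.
Qed.

End Estimates.

Theorem theorem6p3
  (p : nat) (p_prime : prime p) (p_odd : odd p)
  (Qp : fieldType) (vp : Qp -> \bar int) (hQp : is_padic_field p vp)
  (k : splittingFieldType Qp) (k_galois : galois 1%AS {:k}%AS)
  (v : k -> \bar int) (hv : valuation_above vp v)
  (pi : k) (hpi : v pi = 1%:E)
  (fk : nat) (hfk : residue_field v #= `I_(p ^ fk))
  (kb : closedFieldType) (i : {rmorphism k -> kb}) (w : kb -> \bar rat)
  (hkb : is_valued_algebraic_closure v i w)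
  (Np : set nat) (hNp : monus_closed_submonoid p Np)
  (rho : nat -> k)
  (rho_unit : forall m : nat, Np m -> v (rho m) = 0%:E)
  (rhoM : forall m m' : nat, Np m -> Np m' -> rho (m * m')%N = rho m * rho m')
  (fF fkF : nat) (fF_gt0 : (0 < fF)%N) (fkF_gt0 : (0 < fkF)%N)
  (hf : (fF * fkF)%N = fk)
  (nu : nat -> k) (nu0 : nu 0%N = 1)
  (nu_unit : forall j : nat, (j < fkF)%N -> v (nu j) = 0%:E)
  (c : nat -> k)
  (hc : forall j a m : nat, (j < fkF)%N -> Np m ->
     c (p ^ (fF * j) * (p ^ fk) ^ a * m)%N = pi ^+ a * nu j * rho m)
  (eta : nat -> k)
  (heta : is_dirichlet_inverse
     (fun n => 1 / c (Nbar (gen_monoid p fF Np) n)) eta)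
  (Tr : series k -> series k)
  (hTr : is_coleman_trace v i w (lt_log (gen_monoid p fF Np) c) pi Tr)
  (m n : nat) (m_gt0 : (0 < m)%N) (n_gt0 : (0 < n)%N) :
  let q : nat := (p ^ fk)%N in
  let vq (x : nat) : int := Posz (logn p x %/ fk)%N in
  let cbar (x : nat) : k := c (Nbar (gen_monoid p fF Np) x) in
  let FF (a : nat) (g : series k) : k := Tr g a in
  let S : k := \sum_(d <- divisors (gcdn m n))
    eta d * (FF (m %/ d)%N (smonom k (n %/ d)) / cbar (n %/ d)%N) in
  [/\ ((vq m - vq n - 1)%:E <= v (FF n (smonom k m)))%E,
      ((-1)%:E <= v S)%E
    & (\big[Order.min/+oo%E]_(d <- divisors (gcdn m n))
         (Num.max 0
            (Num.floor (1 / (q%:R - 1) *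
               (n%:R / d%:R - 1 - (m * q)%:R / d%:R) : rat))
          - vq (n %/ d)%N)%:E
       - 1%:E <= v S)%E].
Proof.
have fk_gt0 : (0 < fk)%N by rewrite -hf muln_gt0 fF_gt0.
have v_val : is_valuation v by case: hv.
have [_ w_val w_ext] := hkb.
have q_gt2 : (2 < p ^ fk)%N.
  apply: leq_trans (odd_prime_gt2 p_odd p_prime) _.
  by rewrite -{1}(expn1 p) leq_exp2l ?prime_gt1.
have l0 := lt_log0 fF p_prime hNp c.
have l1 := lt_log1 fkF_gt0 hNp v_val rho_unit rhoM nu0 hc.
have v_l := v_lt_log p_prime fF_gt0 fkF_gt0 hf hNp v_val hpi rho_unit nu_unit hc.
have l_q := lt_log_q p_prime fF_gt0 fkF_gt0 hf hNp hc p_odd.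
have v_cb := v_c_Nbar p_prime fF_gt0 fkF_gt0 hf hNp v_val hpi rho_unit nu_unit hc.
have cb_q := c_Nbar_q p_prime fF_gt0 fkF_gt0 hf hNp hc.
have cb1 : c (Nbar (gen_monoid p fF Np) 1) = 1.
  rewrite (Nbar_id p_prime fF_gt0 hNp (gen_monoid1 fF hNp)).
  exact: (c_one fkF_gt0 hNp v_val rho_unit rhoM nu0 hc).
have l_den n' : v_int v (pi ^+ logn p n' * lt_log (gen_monoid p fF Np) c n').
  rewrite /v_int; apply: (le_trans (y := ((logn p n')%:Z - (logn p n' %/ fk)%N%:Z)%:E)).
    by rewrite lee_fin subr_ge0 lez_nat leq_div.
  by apply: (valM_ge v_val) => //; rewrite (v_piX hv hpi).
have l_int n' : ~~ (p ^ fk %| n')%N -> v_int v (lt_log (gen_monoid p fF Np) c n').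
  by move=> /(vq_ndiv p_prime) n'0; have := v_l n'; rewrite n'0 oppr0.
have w_int x : v_int v x -> (0 <= w (i x))%E.
  by rewrite /v_int w_ext; case: (v x) => [r| |] //=; rewrite !lee_fin ler0z.
have w_pi : w (i pi) = 1%:E by rewrite w_ext hpi.
have int_monom m' : sintegral v (smonom k m').
  move=> n'; rewrite /smonom; case: (_ == _); first by rewrite (val_one v_val).
  by rewrite (val_zero v_val) leey.
have TrE m' := hTr _ (int_monom m').
have [L [TrL L_int divW divG]] := coleman_trace_coefficients
  (v_int_sub hv) (v_int_pi hpi) (pi_neq0 hv hpi) p_prime fk_gt0
  (v_int_p p_prime hQp hv hpi fk_gt0 hfk) (fermat p_prime hv hpi fk_gt0 hfk)
  l0 l1 l_den l_q l_int (v_complete p_prime hQp hv hpi fk_gt0 hfk)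
  (v_separated p_prime hv hpi fk_gt0 hfk) (v_unit p_prime hv hpi fk_gt0 hfk)
  w_val w_int w_pi TrE q_gt2.
have L_weight m' n' := (divE hv hpi _ _).1 (divW m' n').
have L_ghost m' n' (m'_gt0 : (0 < m')%N) qm' := (divE hv hpi _ _).1 (divG m' n' m'_gt0 qm').
have v_piV : v pi^-1 = (-1)%:E := valV_fin v_val hpi.
move=> q vq cbar FF S.
(* The factor [pi^-1] in the trace accounts for the final [-1] in all three estimates. *)
have SE : S = pi^-1 * \sum_(d <- divisors (gcdn m n))
    eta d * (L (n %/ d)%N (m %/ d)%N * (1 / cbar (n %/ d)%N)).
  rewrite mulr_sumr /S !big_seq; apply: eq_bigr => d.
  rewrite -dvdn_divisors ?gcdn_gt0 ?m_gt0 // dvdn_gcd => /andP[_ dn].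
  have nd_gt0 : (0 < n %/ d)%N by rewrite divn_gt0 ?(dvdn_gt0 n_gt0 dn) // dvdn_leq.
  by rewrite /FF TrL // div1r -!mulrA mulrCA.
split.
- rewrite /FF TrL // addrC; apply: (valM_ge v_val); first by rewrite v_piV.
  exact: (L_bound p_prime fk_gt0 v_val L_int L_ghost).
- rewrite SE -[-1]addr0; apply: (valM_ge v_val); first by rewrite v_piV.
  exact: (sigma_int p_prime fk_gt0 v_val v_cb cb_q cb1 heta L_int L_ghost).
- rewrite SE (valM v_val) v_piV addeC leeD2l //.
  exact: (sigma_bound p_prime fk_gt0 v_val hpi v_cb cb_q cb1 heta L_int L_weight L_ghost).
Qed.
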